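(* Let $k$ be a local field and let $\Gamma < \mathrm{SL}_2(k)$ be a countable subgroup which is center free and unbounded (i.e. not relatively compact in $\mathrm{SL}_2(k)$). Then the following conditions are equivalent: (1) $\Gamma$ is of almost simple type; (2) $\Gamma$ is Zariski dense (in $\mathrm{SL}_2$); (3) $\Gamma$ is not virtually solvable; (4) $\Gamma$ is highly transitive.
   Context: A countable group $\Gamma$ is of almost simple type if (i) it contains no nontrivial finite normal subgroups, and (ii) whenever $M,N \lhd \Gamma$ satisfy $[M,N]=\langle e\rangle$, either $M=\langle e\rangle$ or $N=\langle e\rangle$. An action of a group on a set $X$ is $k$-transitive if it is transitive on $k$-tuples of distinct points of $X$, and highly transitive if it is $k$-transitive for every $k\ge 1$. A group is highly transitive if it admits a faithful highly transitive action on a set. *)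

(* Defs.v *)
From Stdlib Require Import Reals.
From HB Require Import structures.
From mathcomp Require Import all_boot all_algebra.
From mathcomp Require Import mpoly.

Set Implicit Arguments.
Unset Strict Implicit.
Unset Printing Implicit Defensive.

Import GRing.Theory.
Local Open Scope ring_scope.

Definition is_abs_value (k : fieldType) (abs : k -> R) : Prop :=
  (forall x, Rle R0 (abs x)) /\
  (forall x, abs x = R0 <-> x = 0) /\
  (forall x y, abs (x * y) = Rmult (abs x) (abs y)) /\
  (forall x y, Rle (abs (x + y)) (Rplus (abs x) (abs y))).

Definition nontrivial_abs (k : fieldType) (abs : k -> R) : Prop :=
  exists x, abs x <> R0 /\ abs x <> R1.

Definition converges (k : fieldType) (abs : k -> R) (u : nat -> k) (l : k) : Prop :=
  forall e : R, Rlt R0 e -> exists N : nat, forall n : nat, (N <= n)%N ->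
    Rlt (abs (u n - l)) e.

Definition locally_compact (k : fieldType) (abs : k -> R) : Prop :=
  forall x : k, exists r : R, Rlt R0 r /\
    forall u : nat -> k, (forall n, Rle (abs (u n - x)) r) ->
      exists (phi : nat -> nat) (l : k),
        (forall n, (phi n < phi n.+1)%N) /\ converges abs (fun n => u (phi n)) l.

Definition local_field (k : fieldType) (abs : k -> R) : Prop :=
  is_abs_value abs /\ nontrivial_abs abs /\ locally_compact abs.

Definition mset (k : fieldType) := 'M[k]_2 -> Prop.

Definition is_subgroup (k : fieldType) (H : mset k) : Prop :=
  H 1 /\ (forall g h, H g -> H h -> H (g * h)) /\ (forall g, H g -> H g^-1).

Definition in_SL2 (k : fieldType) (G : mset k) : Prop :=
  forall g, G g -> \det g = 1.

Definition subset_of (k : fieldType) (A B : mset k) : Prop := forall x, A x -> B x.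

Definition subgroup_of (k : fieldType) (H G : mset k) : Prop :=
  is_subgroup H /\ subset_of H G.

Definition normal_in (k : fieldType) (N G : mset k) : Prop :=
  subgroup_of N G /\ forall g n, G g -> N n -> N (g^-1 * n * g).

Definition trivial_set (k : fieldType) (S : mset k) : Prop := forall x, S x -> x = 1.

Definition finite_set (k : fieldType) (S : mset k) : Prop :=
  exists s : seq 'M[k]_2, forall x, S x -> x \in s.

Definition countable_set (k : fieldType) (S : mset k) : Prop :=
  exists f : 'M[k]_2 -> nat, forall x y, S x -> S y -> f x = f y -> x = y.

Definition center_free (k : fieldType) (G : mset k) : Prop :=
  forall z, G z -> (forall g, G g -> z * g = g * z) -> z = 1.

Definition generated (k : fieldType) (S : mset k) : mset k :=
  fun x => forall K : mset k, is_subgroup K -> subset_of S K -> K x.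

Definition commutator (k : fieldType) (m n : 'M[k]_2) : 'M[k]_2 :=
  m^-1 * n^-1 * m * n.

Definition commutator_subgroup (k : fieldType) (M N : mset k) : mset k :=
  generated (fun x => exists m n, M m /\ N n /\ x = commutator m n).

Definition almost_simple_type (k : fieldType) (G : mset k) : Prop :=
  (forall N, normal_in N G -> finite_set N -> trivial_set N) /\
  (forall M N, normal_in M G -> normal_in N G ->
     trivial_set (commutator_subgroup M N) -> trivial_set M \/ trivial_set N).

Definition derived_series (k : fieldType) (H : mset k) (n : nat) : mset k :=
  iter n (fun D => commutator_subgroup D D) H.

Definition solvable_set (k : fieldType) (H : mset k) : Prop :=
  exists n, trivial_set (derived_series H n).

Definition finite_index (k : fieldType) (H G : mset k) : Prop :=
  exists s : seq 'M[k]_2, forall g, G g -> exists2 x, x \in s & H (x^-1 * g).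

Definition virtually_solvable (k : fieldType) (G : mset k) : Prop :=
  exists H, subgroup_of H G /\ finite_index H G /\ solvable_set H.

Definition mat_coords (k : fieldType) (g : 'M[k]_2) : 'I_4 -> k :=
  fun i => g (inord (i %/ 2)) (inord (i %% 2)).

Definition zariski_dense_SL2 (k : fieldType) (G : mset k) : Prop :=
  forall p : {mpoly k[4]},
    (forall g, G g -> p.@[mat_coords g] = 0) ->
    forall g : 'M[k]_2, \det g = 1 -> p.@[mat_coords g] = 0.

Definition highly_transitive (k : fieldType) (G : mset k) : Prop :=
  exists (X : Type) (act : 'M[k]_2 -> X -> X),
    (forall x, act 1 x = x) /\
    (forall g h x, G g -> G h -> act (g * h) x = act g (act h x)) /\
    (forall g, G g -> (forall x, act g x = x) -> g = 1) /\
    (forall (n : nat) (u v : 'I_n -> X), injective u -> injective v ->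
       exists g, G g /\ forall i, act g (u i) = v i).

Definition unbounded (k : fieldType) (abs : k -> R) (G : mset k) : Prop :=
  ~ exists C : R, forall g, G g -> forall i j : 'I_2, Rle (abs (g i j)) C.

(* Main.v *)
Require Import Defs.
From Stdlib Require Import Reals Lra.
From HB Require Import structures.
From mathcomp Require Import all_boot all_algebra.
From mathcomp Require Import mpoly ring boolp.

Set Implicit Arguments.
Unset Strict Implicit.
Unset Printing Implicit Defensive.

Delimit Scope R_scope with Re.

(** Write (NE) for: the G-orbit of a point u of the projective line is never contained in a set
    {u, v}.  All conditions are equivalent to (NE), through (NE) => (4) => (1) => (3) => (NE) and
    (NE) => (2) => (NE).

    (NE) => (4).  An element of SL_2(k) with a large entry contracts the complement of a small
    ball of P^1(k) into another small ball, so G acts on P^1(k) as a (not necessarily discrete)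
    convergence group; its limit set L is perfect and any pair of points of L is attracting and
    repelling for some element of G.  Call a subgroup D good if some ball around a point of L is
    disjoint from its translates under D - 1.  Given a good D and two tuples of distinct cosets
    x_i D and y_i D, choose generic points r, a, q of L and an element h of G contracting the
    complement of a small ball around r into a small ball around a.  By ping-pong D together
    with the elements y_i^-1 h x_i generates a good subgroup (with a ball around q), in which
    h x_i and y_i represent the same coset, and which avoids any prescribed finite set
    disjoint from D.  Iterating over all pairs of tuples yields a subgroup D such that G acts
    highly transitively on G/D, and faithfully since along the way a conjugate of each
    nontrivial element is kept out of D.

    (4) => (1).  Nontrivial normal subgroups act transitively; two commuting ones act freely,
    which is incompatible with 4-transitivity on an infinite set.

    (1) => (3).  The normal core of a solvable subgroup of finite index is trivial, because
    its last nontrivial derived subgroup would be normal and commute with itself.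

    (3) => (NE), (2) => (NE).  Otherwise a subgroup of index at most two fixes a line, hence is
    metabelian, and (gu ^ u)(gu ^ v) is a nonzero polynomial vanishing on G.

    (NE) => (2).  G contains elements of arbitrarily large trace, hence one that is
    diagonalizable over k with eigenvalues of infinite order.  A polynomial vanishing on G
    then vanishes on the products of G with the corresponding torus T; moving along the three
    parameters of T h T h T shows that it vanishes on SL_2(k). *)

(** * Highly transitive actions of convergence groups *)

Section ConvergenceAction.
Variables (T : groupType) (X : Type) (d : X -> X -> R) (act : T -> X -> X).
Local Notation "x < y" := (Rlt x y) : R_scope.
Local Notation "x <= y" := (Rle x y) : R_scope.
Local Open Scope R_scope.

(** [d] is only a pseudometric: in the application points are nonzero vectors, and proportional
    vectors have distance zero. Distinctness is therefore written [0 < d x y]. *)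
Hypothesis d_ge0 : forall x y, 0 <= d x y.
Hypothesis d_refl : forall x, d x x = 0.
Hypothesis d_sym : forall x y, d x y = d y x.
Hypothesis d_tri : forall x y z, d x z <= d x y + d y z.
Hypothesis act1 : forall x, act 1%g x = x.
Hypothesis actM : forall g h x, act (g * h)%g x = act g (act h x).
Hypothesis act_lip : forall g, exists C, 0 < C /\
  forall x y, d (act g x) (act g y) <= C * d x y.
Hypothesis fix3 : forall g x y z, 0 < d x y -> 0 < d x z -> 0 < d y z ->
  d (act g x) x = 0 -> d (act g y) y = 0 -> d (act g z) z = 0 -> g = 1%g.
Hypothesis nonelem : forall p q, exists g, 0 < d (act g p) p /\ 0 < d (act g p) q.

Definition collapsing (a r : X) := forall e, 0 < e ->
  exists g, forall x, e <= d x r -> d (act g x) a < e.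

Hypothesis collapsing_ex : exists a r, collapsing a r.

(** The convergence property. Its bounded alternative is expressed by quotients that return near
    every point, so that no topology on [T] enters. *)
Hypothesis conv : forall s : nat -> T, injective s ->
  (exists a r, forall e, 0 < e -> forall N, exists n, (N <= n)%N /\
     forall x, e <= d x r -> d (act (s n) x) a < e) \/
  (forall q e, 0 < e -> exists n, forall N, exists m, (N <= m)%N /\
     d (act ((s n)^-1 * s m)%g q) q < e).

Lemma actK g x : act g^-1%g (act g x) = x.
Proof. by rewrite -actM mulVg act1. Qed.

Lemma actKV g x : act g (act g^-1%g x) = x.
Proof. by rewrite -actM mulgV act1. Qed.

Lemma act_cont g x e : 0 < e ->
  exists e', 0 < e' /\ forall y, d x y < e' -> d (act g x) (act g y) < e.
Proof.
move=> e0; have [C [C0 lip]] := act_lip g.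
exists (e / C); split; first exact: Rdiv_lt_0_compat.
move=> y hy; apply: Rle_lt_trans (lip x y) _.
have -> : e = C * (e / C) by rewrite /Rdiv (Rmult_comm e) -Rmult_assoc Rinv_r; lra.
exact: Rmult_lt_compat_l.
Qed.

Lemma act_d0 g x y : d x y = 0 -> d (act g x) (act g y) = 0.
Proof.
move=> h; have [C [C0 lip]] := act_lip g.
by have := lip x y; have := d_ge0 (act g x) (act g y); rewrite h; lra.
Qed.

Lemma act_pos g x y : 0 < d x y -> 0 < d (act g x) (act g y).
Proof.
move=> h; have := d_ge0 (act g x) (act g y).
case: (Req_dec (d (act g x) (act g y)) 0) => [h0|]; last by lra.
by have := act_d0 g^-1%g h0; rewrite !actK; lra.
Qed.

(** Pass to complements: if [g^-1] sends [x] to a point far from [r], then [x], the image of that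
    point under [g], is near [a]. *)
Lemma collapsing_inv a r : collapsing a r -> collapsing r a.
Proof.
move=> C e e0; have [g hg] := C e e0.
exists g^-1%g => x hx; case: (Rlt_le_dec (d (act g^-1%g x) r) e) => // h.
by have := hg _ h; rewrite actKV; lra.
Qed.

Lemma collapsing_act h a r : collapsing a r -> collapsing (act h a) r.
Proof.
move=> C e e0; have [e' [e'0 he']] := act_cont h a e0.
have [g hg] := C (Rmin e e') (Rmin_pos _ _ e0 e'0).
exists (h * g)%g => x hx; rewrite actM d_sym; apply: he'; rewrite d_sym.
have := hg x; have := Rmin_l e e'; have := Rmin_r e e' => h1 h2 h3.
by have := h3 (Rle_trans _ _ _ h2 hx); lra.
Qed.

(** * The limit set *)

Definition lim (a : X) := exists r, collapsing a r.

Lemma lim_act g a : lim a -> lim (act g a).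
Proof. by move=> [r C]; exists r; apply: collapsing_act. Qed.

(** Compose three elements: one contracts everything away from [r] towards [a2], the next moves [a2]
    off [r1], and the last contracts everything away from [r1] towards [a]. *)
Lemma lim_collapsing a r : lim a -> lim r -> collapsing a r.
Proof.
move=> [r1 C1] [a2 /collapsing_inv C2] e e0.
have [f hf] : exists f, 0 < d (act f a2) r1.
  case: (Req_dec (d a2 r1) 0) => h.
    have [g [hg _]] := nonelem a2 a2; exists g.
    by have := d_tri (act g a2) r1 a2; rewrite (d_sym r1); lra.
  by exists 1%g; rewrite act1; have := d_ge0 a2 r1; lra.
set D := d (act f a2) r1 in hf.
have [e' [e'0 he']] : exists e', 0 < e' /\
    forall y, d a2 y < e' -> d (act f a2) (act f y) < D / 2.
  by apply: act_cont; lra.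
have [h hh] := C2 (Rmin e e') (Rmin_pos _ _ e0 e'0).
have [g hg] : exists g, forall x, Rmin e (D / 2) <= d x r1 ->
    d (act g x) a < Rmin e (D / 2) by apply: C1; apply: Rmin_pos; lra.
exists (g * (f * h))%g => x hx; rewrite !actM.
apply: Rlt_le_trans (Rmin_l e (D / 2)); apply: hg.
apply: Rle_trans (Rmin_r _ _) _.
have : d (act h x) a2 < Rmin e e'.
  by apply: hh; apply: Rle_trans hx; exact: Rmin_l.
rewrite d_sym => h1; have := he' _ (Rlt_le_trans _ _ _ h1 (Rmin_r _ _)).
by have := d_tri (act f a2) (act f (act h x)) r1; rewrite -/D; lra.
Qed.

Lemma lim_three : exists x y z, [/\ lim x, lim y & lim z] /\
  [/\ 0 < d x y, 0 < d x z & 0 < d y z].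
Proof.
have [p [r C]] := collapsing_ex.
have lp : lim p by exists r.
have [f [hf _]] := nonelem p p.
have [g [h1 h2]] := nonelem p (act f p).
exists p, (act f p), (act g p).
by split; split; rewrite 1?[d p _]d_sym 1?[d (act f p) (act g p)]d_sym //;
  apply: lim_act.
Qed.

(** * Generic points of the limit set *)

Definition opn (P : X -> Prop) := forall x, P x ->
  exists e, 0 < e /\ forall y, d x y < e -> P y.
(** Density refers to the limit set, openness to the whole space. Finitely many conditions of this
    kind hold together at some limit point, which is how generic points are chosen. *)
Definition dns (P : X -> Prop) := forall x e, lim x -> 0 < e ->
  exists y, [/\ lim y, d x y < e & P y].
Definition odns P := opn P /\ dns P.

Lemma odns_true : odns (fun=> True).
Proof.
split=> [x _|x e lx e0]; first by exists 1; split=> //; lra.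
by exists x; split; rewrite ?d_refl.
Qed.

Lemma odns_and P Q : odns P -> odns Q -> odns (fun x => P x /\ Q x).
Proof.
move=> [oP dP] [oQ dQ]; split=> [x [Px Qx]|x e lx e0].
  have [e [e0 he]] := oP _ Px; have [f [f0 hf]] := oQ _ Qx.
  exists (Rmin e f); split; first exact: Rmin_pos.
  move=> y hy; split; [apply: he|apply: hf]; apply: Rlt_le_trans hy _.
    exact: Rmin_l.
  exact: Rmin_r.
have [y [ly dy Py]] := dP x e lx e0.
have [f [f0 hf]] := oP _ Py.
have [z [lz dz Qz]] := dQ y (Rmin f (e - d x y)) ly (Rmin_pos _ _ f0 (Rlt_Rminus _ _ dy)).
have h1 := Rmin_l f (e - d x y); have h2 := Rmin_r f (e - d x y).
exists z; split=> //; first by have := d_tri x y z; lra.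
by split=> //; apply: hf; lra.
Qed.

Lemma odns_ext (P Q : X -> Prop) : (forall x, P x <-> Q x) -> odns P -> odns Q.
Proof.
move=> PQ [oP dP]; split=> [x /PQ /oP [e [e0 he]]|x e lx e0].
  by exists e; split=> // y /he /PQ.
by have [y [ly dy /PQ Qy]] := dP x e lx e0; exists y.
Qed.

Lemma odns_seq (I : eqType) (s : seq I) (P : I -> X -> Prop) :
  (forall i, i \in s -> odns (P i)) -> odns (fun x => forall i, i \in s -> P i x).
Proof.
elim: s => [|i s IH] hP; first by apply: odns_ext odns_true => x.
have h1 := hP i (mem_head _ _).
have h2 : odns (fun x => forall i, i \in s -> P i x).
  by apply: IH => j js; apply: hP; rewrite inE js orbT.
apply: odns_ext (odns_and h1 h2) => x; split=> [[Pi Ps] j|h].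
  by rewrite inE => /orP [/eqP ->|/Ps].
by split=> [|j js]; apply: h; rewrite inE ?eqxx ?js ?orbT.
Qed.

Lemma odns_fin (I : finType) (P : I -> X -> Prop) :
  (forall i, odns (P i)) -> odns (fun x => forall i, P i x).
Proof.
move=> hP; apply: odns_ext (@odns_seq _ (enum I) P (fun i _ => hP i)) => x.
by split=> h i => [|_]; apply: h; rewrite mem_enum.
Qed.

Lemma odns_act g P : odns P -> odns (fun x => P (act g x)).
Proof.
move=> [oP dP]; split=> [x Px|x e lx e0].
  have [e [e0 he]] := oP _ Px; have [e' [e'0 he']] := act_cont g x e0.
  by exists e'; split=> // y hy; apply/he/he'.
have [e' [e'0 he']] := act_cont g^-1%g (act g x) e0.
have [y [ly dy Py]] := dP (act g x) e' (lim_act g lx) e'0.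
exists (act g^-1%g y); split; first exact: lim_act.
  by have := he' _ dy; rewrite actK.
by rewrite actKV.
Qed.

Lemma odns_ex P : odns P -> exists x, lim x /\ P x.
Proof.
move=> [_ dP]; have [x [y [z [[lx _ _] _]]]] := lim_three.
by have [t [lt _ Pt]] := dP x 1 lx Rlt_0_1; exists t.
Qed.

(** The limit set is perfect. Of three distinct limit points at least two avoid the repelling point
    [r] of [p]; a contraction towards [p] sends them to distinct limit points near [p], and one of
    these differs from [z]. *)
Lemma odns_apart z : odns (fun x => 0 < d x z).
Proof.
split=> [x hx|p e lp e0].
  exists (d x z); split=> // y hy.
  by have := d_tri x y z; have := d_ge0 x y; lra.
have [x1 [x2 [x3 [[l1 l2 l3] [h12 h13 h23]]]]] := lim_three.
have [r C] := lp.
(* Since [e'] is at most half of each mutual distance, at most one of the three points lies within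
   [e'] of [r]. *)
pose e' := Rmin e (Rmin (d x1 x2) (Rmin (d x1 x3) (d x2 x3)) / 2).
have m1 := Rmin_l (d x1 x3) (d x2 x3); have m2 := Rmin_r (d x1 x3) (d x2 x3).
have m3 := Rmin_pos _ _ h13 h23.
have m4 := Rmin_pos _ _ h12 m3.
have m5 := Rmin_l (d x1 x2) (Rmin (d x1 x3) (d x2 x3)).
have m6 := Rmin_r (d x1 x2) (Rmin (d x1 x3) (d x2 x3)).
have e'0 : 0 < e' by apply: Rmin_pos => //; lra.
have le1 : e' <= e by apply: Rmin_l.
have le2 := Rmin_r e (Rmin (d x1 x2) (Rmin (d x1 x3) (d x2 x3)) / 2).
have {}le2 : e' <= Rmin (d x1 x2) (Rmin (d x1 x3) (d x2 x3)) / 2 by [].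
have far : forall u v, 2 * e' <= d u v -> d u r < e' -> d v r < e' -> False.
  by move=> u v h1 h2 h3; have := d_tri u r v; rewrite (d_sym r v); lra.
have [u [v [lu lv huv [hu hv]]]] : exists u v, [/\ lim u, lim v, 0 < d u v &
    e' <= d u r /\ e' <= d v r].
  case: (Rlt_le_dec (d x1 r) e') => k1.
    have k2 : e' <= d x2 r by apply: Rnot_lt_le; apply: far k1; lra.
    have k3 : e' <= d x3 r by apply: Rnot_lt_le; apply: far k1; lra.
    by exists x2, x3.
  case: (Rlt_le_dec (d x2 r) e') => k2; last by exists x1, x2.
  have k3 : e' <= d x3 r by apply: Rnot_lt_le; apply: far k2; lra.
  by exists x1, x3.
have [g hg] := C e' e'0.
have gu := hg _ hu; have gv := hg _ hv; have guv := act_pos g huv.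
case: (Req_dec (d (act g u) z) 0) => hz.
  exists (act g v); split; rewrite 1?d_sym; [exact: lim_act|lra|].
  by have := d_tri (act g u) z (act g v); lra.
exists (act g u); split; rewrite 1?d_sym; [exact: lim_act|lra|].
by rewrite d_sym; have := d_ge0 (act g u) z; lra.
Qed.

(** If [g] fixed all limit points near [x], perfectness would supply three distinct fixed points. *)
Lemma odns_moved g : g <> 1%g -> odns (fun x => 0 < d (act g x) x).
Proof.
move=> g1; split=> [x hx|x e lx e0].
  set D := d (act g x) x in hx.
  have [e [e0 he]] := act_cont g x (Rdiv_lt_0_compat _ _ hx Rlt_0_2).
  exists (Rmin e (D / 2)); split; first by apply: Rmin_pos => //; lra.
  move=> y hy; have h1 := Rmin_l e (D / 2); have h2 := Rmin_r e (D / 2).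
  have := he y; have := d_tri (act g x) (act g y) x; have := d_tri (act g y) y x.
  by rewrite (d_sym y x) -/D; lra.
have [y [ly dy hy]] := (odns_apart x).2 x e lx e0.
have [z [lz dz [hz1 hz2]]] := (odns_and (odns_apart x) (odns_apart y)).2 x e lx e0.
apply: contrapT => H; apply: g1.
have fixed t : lim t -> d x t < e -> d (act g t) t = 0.
  move=> lt dt; apply: contrapT => h; apply: H; exists t; split=> //.
  by have := d_ge0 (act g t) t; lra.
apply: (@fix3 g x y z); rewrite 1?d_sym //.
- by rewrite d_sym; apply: fixed; rewrite ?d_refl.
- by rewrite d_sym; apply: fixed.
- by rewrite d_sym; apply: fixed.
Qed.

(** * Good subgroups and their wandering points *)

Definition good (D : T -> Prop) (q : X) (e0 : R) := [/\ lim q, 0 < e0 &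
  forall g, D g -> (exists y, d q y < e0 /\ d q (act g y) < e0) -> g = 1%g].

(** The points of discontinuity of [D]: all but finitely many elements of [D] move a whole ball
    around [x] off itself. *)
Definition wandering (D : T -> Prop) (x : X) := exists e (l : seq T), 0 < e /\
  forall g, D g -> (exists y, d x y < e /\ d x (act g y) < e) -> g \in l.

Definition subgrp (D : T -> Prop) := [/\ D 1%g, forall g h, D g -> D h -> D (g * h)%g
  & forall g, D g -> D g^-1%g].

(** The list [l] forces infinitely many contracting elements of [D] at every scale. *)
Definition dcollapsing (D : T -> Prop) (a r : X) := forall e (l : seq T), 0 < e ->
  exists g, [/\ D g, g \notin l & forall x, e <= d x r -> d (act g x) a < e].

Section Subgroup.
Variables (D : T -> Prop) (q : X) (e0 : R).
Hypotheses (Dgrp : subgrp D) (Dgood : good D q e0).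

Let D1 : D 1%g. Proof. by case: Dgrp. Qed.
Let DM g h : D g -> D h -> D (g * h)%g. Proof. by case: Dgrp => _ H _; apply: H. Qed.
Let DV g : D g -> D g^-1%g. Proof. by case: Dgrp => _ _ H; apply: H. Qed.

Lemma dcollapsing_inv a r : dcollapsing D a r -> dcollapsing D r a.
Proof.
move=> C e l e_0; have [g [Dg gl hg]] := C e (map (fun h : T => h^-1%g) l) e_0.
exists g^-1%g; split; [exact: DV| |] => [|x hx].
  by apply: contra gl => gl; apply/mapP; exists g^-1%g; rewrite ?invgK.
case: (Rlt_le_dec (d (act g^-1%g x) r) e) => // h.
by have := hg _ h; rewrite actKV; lra.
Qed.

(** An attracting point [a] is not wandering: perfectness gives a point [y] near it and off [r], and
    infinitely many elements of [D] carry [y] back near [a]. *)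
Lemma wandering_apart a r x : dcollapsing D a r -> lim x -> wandering D x -> 0 < d x a.
Proof.
move=> C lx [e [l [e_0 W]]]; apply: contrapT => h.
have xa : d x a = 0 by have := d_ge0 x a; lra.
have [y [ly dy hy]] := (odns_apart r).2 x e lx e_0.
have [g [Dg gl hg]] := C (Rmin e (d y r)) l (Rmin_pos _ _ e_0 hy).
have := hg y (Rmin_r _ _) => gy.
have : d x (act g y) < e.
  have := d_tri x a (act g y); rewrite (d_sym a).
  by have := Rmin_l e (d y r); lra.
by move=> k; move: gl; rewrite (W g Dg) //; exists y.
Qed.

Lemma seq_of_fresh (P : nat -> T -> Prop) :
  (forall n (l : seq T), exists g, g \notin l /\ P n g) ->
  exists s : nat -> T, injective s /\ forall n, P n (s n).
Proof.
move=> H.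
have {H} [f hf] := choice (fun nl : nat * seq T => H nl.1 nl.2).
(* [L n] lists the first [n] terms, which the next one has to avoid. *)
pose fix L n := if n is m.+1 then f (m, L m) :: L m else [::].
exists (fun n => f (n, L n)); split; last by move=> n; case: (hf (n, L n)).
have mem m n : (m < n)%N -> f (m, L m) \in L n.
  elim: n => // n IH; rewrite ltnS leq_eqVlt => /orP [/eqP ->|/IH h] /=.
    by rewrite mem_head.
  by rewrite inE h orbT.
move=> m n; case: (ltngtP m n) => // h E.
  by case: (hf (n, L n)); rewrite -E mem.
by case: (hf (m, L m)); rewrite E mem.
Qed.

(* The bounded alternative of [conv] would produce elements of D close to the identity. *)
Lemma good_collapse (s : nat -> T) : injective s -> (forall n, D (s n)) ->
  exists a r, forall e, 0 < e -> forall N, exists n, (N <= n)%N /\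
     forall x, e <= d x r -> d (act (s n) x) a < e.
Proof.
move=> si sD; case: (conv si) => // B; exfalso.
have [lq e0_0 G] := Dgood.
have [n hn] := B q e0 e0_0.
have [m [nm hm]] := hn n.+1.
have E : ((s n)^-1 * s m)%g = 1%g.
  apply: G; first by apply: DM => //; apply: DV.
  by exists q; rewrite d_refl d_sym.
have /si E' : s m = s n by rewrite -[LHS](mulVKg (s n)) E mulg1.
by rewrite E' ltnn in nm.
Qed.

Lemma notin_tail (s : nat -> T) (l : seq T) : injective s ->
  exists N, forall n, (N <= n)%N -> s n \notin l.
Proof.
move=> si; elim: l => [|g l [N hN]]; first by exists 0%N.
have [[n0 E]|h] := pselect (exists n, s n = g).
  exists (maxn N n0.+1) => n; rewrite geq_max => /andP [h1 h2].
  rewrite inE negb_or hN // andbT -E; apply/eqP => /si E'.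
  by rewrite E' ltnn in h2.
exists N => n hn; rewrite inE negb_or hN // andbT.
by apply/eqP => E; apply: h; exists n.
Qed.

Lemma collapse_dcollapsing (s : nat -> T) a r : injective s -> (forall n, D (s n)) ->
  (forall e, 0 < e -> forall N, exists n, (N <= n)%N /\
     forall x, e <= d x r -> d (act (s n) x) a < e) -> dcollapsing D a r.
Proof.
move=> si sD C e l e_0; have [N hN] := notin_tail l si.
by have [n [Nn hn]] := C e e_0 N; exists (s n); split=> //; apply: hN.
Qed.

Lemma invS_pos n : 0 < / INR n.+1.
Proof. by apply: Rinv_0_lt_compat; apply: lt_0_INR; apply/ltP. Qed.

Lemma invS_small e : 0 < e -> exists N, forall n, (N <= n)%N -> / INR n.+1 < e.
Proof.
move=> e_0; have [N hN] := archimed_cor1 e e_0.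
exists N => n /leP hn; case: hN => hN1 hN2; apply: Rle_lt_trans hN1.
apply: Rinv_le_contravar; first exact: lt_0_INR.
by apply: le_INR; apply: PeanoNat.Nat.le_trans hn _; apply: PeanoNat.Nat.le_succ_diag_r.
Qed.

(** Proper discontinuity for two base points. Infinitely many exceptions would contain contractions
    with attracting point [a] and repelling point [r]; as [x] is off [r] and [y] is off [a], these
    cannot carry points close to [x] close to [y]. *)
Lemma wandering_pair x y : lim x -> lim y -> wandering D x -> wandering D y ->
  exists e (l : seq T), 0 < e /\
    forall g, D g -> (exists z, d x z < e /\ d y (act g z) < e) -> g \in l.
Proof.
move=> lx ly Wx Wy; apply: contrapT => H.
have [|s [si hs]] := @seq_of_fresh (fun n g =>
    D g /\ exists z, d x z < / INR n.+1 /\ d y (act g z) < / INR n.+1).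
  move=> n l; apply: contrapT => H'; apply: H.
  exists (/ INR n.+1), l; split; first exact: invS_pos.
  move=> g Dg hz; apply: contrapT => /negP gl; apply: H'.
  by exists g.
have sD n : D (s n) by case: (hs n).
have [a [r C]] := good_collapse si sD.
have C' := collapse_dcollapsing si sD C.
have ya := wandering_apart C' ly Wy.
have xr := wandering_apart (dcollapsing_inv C') lx Wx.
pose e := Rmin (d y a) (d x r) / 2.
have hm := Rmin_pos _ _ ya xr.
have m1 := Rmin_l (d y a) (d x r); have m2 := Rmin_r (d y a) (d x r).
have e_0 : 0 < e by rewrite /e; lra.
have [N hN] := invS_small e_0.
have [n [Nn hn]] := C e e_0 N.
have [_ [z [z1 z2]]] := hs n; have sm := hN n Nn.
have : e <= d z r by have := d_tri x z r; rewrite /e in sm *; lra.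
move/hn => h; have := d_tri y (act (s n) z) a; rewrite /e in sm h; lra.
Qed.

Lemma wandering_act g x : D g -> wandering D x -> wandering D (act g x).
Proof.
move=> Dg [e [l [e_0 W]]].
have [e' [e'0 he']] := act_cont g^-1%g (act g x) e_0.
exists e', (map (fun h => g * h * g^-1)%g l); split=> // h Dh [y [y1 y2]].
apply/mapP; exists (g^-1 * h * g)%g; last first.
  by rewrite !mulgA mulgK mulgV mul1g.
apply: W; first by exact: (DM (DM (DV Dg) Dh) Dg).
exists (act g^-1%g y); have := he' _ y1; have := he' _ y2.
by rewrite actK !actM actKV; split.
Qed.

(** For density, suppose that no limit point near [x] wanders. Elements of [D] then bring points
    near [x] back near [x], and they accumulate to contractions. The point [x] is neither attracting
    nor repelling for these, which contradicts the return. *)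
Lemma odns_wandering : odns (wandering D).
Proof.
split=> [x [e [l [e_0 W]]]|x e lx e_0].
  exists (e / 2); split; first by lra.
  move=> y hy; exists (e / 2), l; split; first by lra.
  move=> g Dg [z [z1 z2]]; apply: W => //; exists z.
  by have := d_tri x y z; have := d_tri x y (act g z); lra.
have [lq e0_0 G] := Dgood.
have Wq : wandering D q.
  by exists e0, [:: 1%g]; split=> // g Dg h; rewrite inE (G g Dg h).
apply: contrapT => H.
have H' y : lim y -> d x y < e -> wandering D y -> False by move=> *; apply: H; exists y.
have nW : ~ wandering D x by apply: H' => //; rewrite d_refl.
have [|s [si hs]] := @seq_of_fresh (fun n g =>
    D g /\ exists z, d x z < / INR n.+1 /\ d x (act g z) < / INR n.+1).
  move=> n l; apply: contrapT => h; apply: nW.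
  exists (/ INR n.+1), l; split; first exact: invS_pos.
  by move=> g Dg hz; apply: contrapT => /negP gl; apply: h; exists g.
have sD n : D (s n) by case: (hs n).
have [a [r C]] := good_collapse si sD.
have C' := collapse_dcollapsing si sD C.
(* If [x] were the attracting point [b], translates of the wandering point [q] under [D] would enter
   the ball around [x], and they wander too. *)
have key b c : dcollapsing D b c -> 0 < d x b.
  move=> K; apply: contrapT => hb.
  have xb : d x b = 0 by have := d_ge0 x b; lra.
  have qc := wandering_apart (dcollapsing_inv K) lq Wq.
  have [g [Dg _ hg]] := K (Rmin e (d q c)) [::] (Rmin_pos _ _ e_0 qc).
  have h := hg _ (Rmin_r _ _).
  apply: (H' (act g q)); [exact: lim_act| |exact: wandering_act].
  have := d_tri x b (act g q); rewrite (d_sym b).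
  by have := Rmin_l e (d q c); lra.
have xa := key _ _ C'.
have xr := key _ _ (dcollapsing_inv C').
pose e1 := Rmin (d x a) (d x r) / 2.
have hm := Rmin_pos _ _ xa xr.
have m1 := Rmin_l (d x a) (d x r); have m2 := Rmin_r (d x a) (d x r).
have e1_0 : 0 < e1 by rewrite /e1; lra.
have [N hN] := invS_small e1_0.
have [n [Nn hn]] := C e1 e1_0 N.
have [_ [z [z1 z2]]] := hs n; have sm := hN n Nn.
have : e1 <= d z r by have := d_tri x z r; rewrite /e1 in sm *; lra.
move/hn => h; have := d_tri x (act (s n) z) a; rewrite /e1 in sm h; lra.
Qed.

(** An element [g] of [D] makes the images under [u] and [u'] of a small ball around [r] meet only
    if this is unavoidable. For [u], [u'] inverse to coset representatives, this separates the
    images modulo [D]. *)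
Definition sep (u u' : T) (r : X) := exists e, 0 < e /\ forall g w, D g ->
  d r w < e -> d r (act (u'^-1 * g * u)%g w) < e -> (g * u)%g = u'.

Definition sepz (u : T) (z r : X) := exists e, 0 < e /\ forall g w, D g ->
  d r w < e -> d z (act (g * u)%g w) < e -> False.

(** Near a point whose images under [u] and [u'] both wander, [wandering_pair] leaves finitely many
    [g] to consider. A generic point is moved by each nontrivial [u'^-1 * g * u] among them. *)
Lemma odns_sep u u' : odns (sep u u').
Proof.
split=> [x [e [e_0 S]]|x e lx e_0].
  exists (e / 2); split; first by lra.
  move=> y hy; exists (e / 2); split; first by lra.
  move=> g w Dg w1 w2; apply: (S g w Dg).
    by have := d_tri x y w; lra.
  by have := d_tri x y (act (u'^-1 * g * u)%g w); lra.
have oW := odns_wandering.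
have [x0 [lx0 dx0 [W1 W2]]] :=
  (odns_and (odns_act u oW) (odns_act u' oW)).2 x e lx e_0.
have [e1 [l [e1_0 P]]] := wandering_pair (lim_act u lx0) (lim_act u' lx0) W1 W2.
have [f1 [f1_0 h1]] := act_cont u x0 e1_0.
have [f2 [f2_0 h2]] := act_cont u' x0 e1_0.
pose f := Rmin (Rmin f1 f2) (e - d x x0).
have f_0 : 0 < f by apply: Rmin_pos; [exact: Rmin_pos | lra].
have fe : f <= e - d x x0 by apply: Rmin_r.
have ff : f <= Rmin f1 f2 by apply: Rmin_l.
have ff1 := Rmin_l f1 f2; have ff2 := Rmin_r f1 f2.
pose l' := [seq (u'^-1 * g * u)%g | g <- l].
have O : odns (fun x => forall h, h \in [seq h <- l' | h != 1%g] -> 0 < d (act h x) x).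
  by apply: odns_seq => h; rewrite mem_filter => /andP [/eqP h_1 _]; apply: odns_moved.
have [y [ly dy hy]] := O.2 x0 (f / 2) lx0 ltac:(lra).
exists y; split=> //; first by have := d_tri x x0 y; lra.
(* shrink so that the finitely many remaining elements move the whole ball off itself *)
have [e2 [e2_0 he2]] : exists e2, 0 < e2 /\ forall h, h \in [seq h <- l' | h != 1%g] ->
    forall w, d y w < e2 -> d y (act h w) < e2 -> False.
  elim: [seq h <- l' | h != 1%g] hy => [|h t IH] hy.
    by exists 1; split; first lra.
  have [e2 [e2_0 he2]] : exists e2, 0 < e2 /\ forall h, h \in t ->
      forall w, d y w < e2 -> d y (act h w) < e2 -> False.
    by apply: IH => h' h'_t; apply: hy; rewrite inE h'_t orbT.
  have hh := hy h (mem_head _ _).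
  have [e3 [e3_0 he3]] := act_cont h y (Rdiv_lt_0_compat _ _ hh Rlt_0_2).
  pose e4 := Rmin e2 (Rmin e3 (d (act h y) y / 2)).
  have m1 : e4 <= e2 by apply: Rmin_l.
  have m2 : e4 <= Rmin e3 (d (act h y) y / 2) by apply: Rmin_r.
  have m3 := Rmin_l e3 (d (act h y) y / 2); have m4 := Rmin_r e3 (d (act h y) y / 2).
  exists e4; split; first by apply: Rmin_pos => //; apply: Rmin_pos => //; lra.
  move=> h'; rewrite inE => /orP [/eqP ->|h't] w w1 w2.
    have := he3 w ltac:(lra); have := d_tri (act h y) (act h w) y.
    by rewrite (d_sym (act h w) y); lra.
  by apply: (he2 h' h't w); lra.
exists (Rmin e2 (f / 2)); split; first by apply: Rmin_pos => //; lra.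
move=> g w Dg w1 w2; have k1 := Rmin_l e2 (f / 2); have k2 := Rmin_r e2 (f / 2).
have gl : g \in l.
  apply: P => //; exists (act u w); split.
    by apply: h1; have := d_tri x0 y w; lra.
  have -> : act g (act u w) = act u' (act (u'^-1 * g * u)%g w).
    by rewrite -!actM !mulgA mulgV mul1g.
  by apply: h2; have := d_tri x0 y (act (u'^-1 * g * u)%g w); lra.
have [E|ne] := eqVneq (u'^-1 * g * u)%g 1%g.
  by apply: (@mulgI _ u'^-1%g); rewrite mulgA E mulVg.
exfalso; apply: (he2 (u'^-1 * g * u)%g _ w); [|lra|lra].
by rewrite mem_filter ne; apply/mapP; exists g.
Qed.

(** Again [wandering_pair] leaves finitely many [g], and a generic point is sent to [z] by no
    [g * u] among them. *)
Lemma odns_sepz u z : lim z -> wandering D z -> odns (sepz u z).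
Proof.
move=> lz Wz; split=> [x [e [e_0 S]]|x e lx e_0].
  exists (e / 2); split; first by lra.
  move=> y hy; exists (e / 2); split; first by lra.
  move=> g w Dg w1 w2; apply: (S g w Dg); last by lra.
  by have := d_tri x y w; lra.
have [x0 [lx0 dx0 W1]] := (odns_act u odns_wandering).2 x e lx e_0.
have [e1 [l [e1_0 P]]] := wandering_pair (lim_act u lx0) lz W1 Wz.
have [f1 [f1_0 h1]] := act_cont u x0 e1_0.
pose f := Rmin f1 (e - d x x0).
have f_0 : 0 < f by apply: Rmin_pos => //; lra.
have fe : f <= e - d x x0 by apply: Rmin_r.
have ff : f <= f1 by apply: Rmin_l.
have O : odns (fun x => forall g : T, g \in l -> 0 < d (act (g * u)%g x) z).
  by apply: odns_seq => g _; apply: (odns_act _ (odns_apart z)).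
have [y [ly dy hy]] := O.2 x0 (f / 2) lx0 ltac:(lra).
exists y; split=> //; first by have := d_tri x x0 y; lra.
have [e2 [e2_0 he2]] : exists e2, 0 < e2 /\ forall g : T, g \in l ->
    forall w, d y w < e2 -> d z (act (g * u)%g w) < e2 -> False.
  elim: l hy {P O} => [|h t IH] hy.
    by exists 1; split; first lra.
  have [e2 [e2_0 he2]] : exists e2, 0 < e2 /\ forall g : T, g \in t ->
      forall w, d y w < e2 -> d z (act (g * u)%g w) < e2 -> False.
    by apply: IH => h' h'_t; apply: hy; rewrite inE h'_t orbT.
  have hh := hy h (mem_head _ _).
  have [e3 [e3_0 he3]] := act_cont (h * u)%g y (Rdiv_lt_0_compat _ _ hh Rlt_0_2).
  pose e4 := Rmin e2 (Rmin e3 (d (act (h * u)%g y) z / 2)).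
  have m1 : e4 <= e2 by apply: Rmin_l.
  have m2 : e4 <= Rmin e3 (d (act (h * u)%g y) z / 2) by apply: Rmin_r.
  have m3 := Rmin_l e3 (d (act (h * u)%g y) z / 2); have m4 := Rmin_r e3 (d (act (h * u)%g y) z / 2).
  exists e4; split; first by apply: Rmin_pos => //; apply: Rmin_pos => //; lra.
  move=> h'; rewrite inE => /orP [/eqP ->|h't] w w1 w2.
    have := he3 w ltac:(lra); have := d_tri (act (h * u)%g y) (act (h * u)%g w) z.
    by rewrite (d_sym (act (h * u)%g w) z); lra.
  by apply: (he2 h' h't w); lra.
pose e5 := Rmin e2 (Rmin (f / 2) e1).
have k1 : e5 <= e2 by apply: Rmin_l.
have k2 : e5 <= Rmin (f / 2) e1 by apply: Rmin_r.
have k3 := Rmin_l (f / 2) e1; have k4 := Rmin_r (f / 2) e1.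
exists e5; split; first by apply: Rmin_pos => //; apply: Rmin_pos => //; lra.
move=> g w Dg w1 w2; apply: (he2 g _ w); [|lra|lra].
apply: P => //; exists (act u w); rewrite -actM; split; last by lra.
by apply: h1; have := d_tri x0 y w; lra.
Qed.

(** Let [h] contract both [p] and [g p] into the ball around [q]. The conjugate [h * g * h^-1] then
    sends a point of this ball into the ball, so goodness makes it trivial. *)
Lemma good_core g : (forall h, D (h * g * h^-1)%g) -> g = 1%g.
Proof.
move=> H; have [lq e0_0 G] := Dgood.
have [a Cqa] := lq.
have [p [lp [p1 p2]]] := odns_ex (odns_and (odns_apart a) (odns_act g (odns_apart a))).
have e_0 := Rmin_pos _ _ e0_0 (Rmin_pos _ _ p1 p2).
have [h hh] := Cqa _ e_0.
have m1 := Rmin_l e0 (Rmin (d p a) (d (act g p) a)).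
have m2 := Rmin_r e0 (Rmin (d p a) (d (act g p) a)).
have m3 := Rmin_l (d p a) (d (act g p) a).
have m4 := Rmin_r (d p a) (d (act g p) a).
have k1 := hh p ltac:(lra); have k2 := hh (act g p) ltac:(lra).
have E : (h * g * h^-1)%g = 1%g.
  apply: G => //; exists (act h p); rewrite !actM actK d_sym [d q _]d_sym; lra.
by have := congr1 (fun x => h^-1 * x * h)%g E; rewrite !mulgA mulVg mul1g mulgVK mulg1 mulVg.
Qed.

End Subgroup.

(** * Ping-pong over a subgroup *)

Section PingPong.
(** [t i true] is a new generator, [t i false] its inverse, and [C i b] is the region into which
    [t i b] plays. By [disj] the [D]-translates of all these regions are pairwise disjoint. *)
Variables (D : T -> Prop) (I : Type) (t : I -> bool -> T) (C : I -> bool -> X -> Prop).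
Hypothesis Dgrp : subgrp D.
Hypothesis tV : forall i b, t i (~~ b) = (t i b)^-1%g.
Hypothesis tC : forall i b x, ~ C i (~~ b) x -> C i b (act (t i b) x).
Hypothesis disj : forall g i b j c x, D g -> C i b x -> C j c (act g x) ->
  [/\ g = 1%g, i = j & b = c].

(** Reduced words starting with [t i b], as in the free product of [D] with a free group on [I]. The
    excluded case is a cancellation of [t i b] against an adjacent [t i (~~ b)]. *)
Inductive word : I -> bool -> T -> Prop :=
| word_last i b g : D g -> word i b (t i b * g)%g
| word_cons i b g j c h : D g -> word j c h -> ~ [/\ g = 1%g, i = j & c = ~~ b] ->
    word i b (t i b * (g * h))%g.

Definition normal_form g := D g \/
  exists g0 i b h, [/\ D g0, word i b h & g = (g0 * h)%g].

Definition span (g : T) := forall K, subgrp K -> (forall h, D h -> K h) ->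
  (forall i b, K (t i b)) -> K g.

Lemma span_subgrp : subgrp span.
Proof.
split=> [K [K1 _ _] //|g h sg sh K KG KD Kt|g sg K KG KD Kt].
  by have [_ KM _] := KG; apply: KM; [exact: sg | exact: sh].
by have [_ _ KV] := KG; apply: KV; exact: sg.
Qed.

Lemma normal_form_D g x : D g -> normal_form x -> normal_form (g * x)%g.
Proof.
have [D1 DM DV] := Dgrp.
move=> Dg [Dx|[g0 [i [b [h [Dg0 wh ->]]]]]]; first by left; apply: DM.
by right; exists (g * g0)%g, i, b, h; rewrite mulgA; split=> //; apply: DM.
Qed.

(** The new letter either extends the reduced word or cancels against its first letter. *)
Lemma normal_form_t i b x : normal_form x -> normal_form (t i b * x)%g.
Proof.
have [D1 DM DV] := Dgrp.
move=> [Dx|[g0 [j [c [h [Dg0 wh ->]]]]]].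
  by right; exists 1%g, i, b, (t i b * x)%g; rewrite mul1g; split=> //; constructor.
have [[g1 ij cb]|ne] := pselect [/\ g0 = 1%g, i = j & c = ~~ b]; last first.
  right; exists 1%g, i, b, (t i b * (g0 * h))%g; rewrite mul1g; split=> //.
  exact: word_cons wh ne.
move: wh; rewrite g1 mul1g -ij cb {Dg0 g1 ij cb} => wh.
inversion wh as [i' b' g Dg|i' b' g j' c' h' Dg wh' _]; subst.
  by rewrite tV mulVKg; left.
by rewrite tV mulVKg; right; exists g, j', c', h'.
Qed.

(** The elements that preserve normal forms under left multiplication, together with their inverses,
    form a subgroup containing all generators; apply one of them to [1]. *)
Lemma span_normal_form g : span g -> normal_form g.
Proof.
have [D1 DM DV] := Dgrp.
move=> /(_ (fun g => (forall x, normal_form x -> normal_form (g * x)%g) /\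
  (forall x, normal_form x -> normal_form (g^-1 * x)%g))) H.
rewrite -[g]mulg1; apply: (proj1 (H _ _ _)); last by left.
- split=> [|h k [h1 h2] [k1 k2]|h [h1 h2]].
  + by split=> x; rewrite ?invg1 mul1g.
  + split=> x nx; first by rewrite -mulgA; apply/h1/k1.
    by rewrite invgM -mulgA; apply/k2/h2.
  + by split=> x; rewrite ?invgK //; [apply: h2 | apply: h1].
- by move=> h Dh; split=> x; apply: normal_form_D => //; apply: DV.
- by move=> i b; split=> x; rewrite -?tV; apply: normal_form_t.
Qed.

(** The ping-pong argument: after each syllable the point lies in a region [C j c], and by [disj]
    the following element of [D] cannot put it into [C i (~~ b)] unless there is a cancellation. *)
Lemma word_act i b h x : word i b h -> (forall g j c, D g -> ~ C j c (act g x)) ->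
  C i b (act h x).
Proof.
move=> wh free; elim: {i b h} wh => [i b g Dg|i b g j c h Dg _ IH ne].
  by rewrite actM; apply: tC; apply: free.
rewrite !actM; apply: tC => Ci.
by have [g1 ji cb] := disj Dg IH Ci; apply: ne; split.
Qed.

Lemma span_act g : span g -> D g \/ exists g0 i b, D g0 /\
  forall x, (forall g j c, D g -> ~ C j c (act g x)) -> C i b (act (g0 * g)%g x).
Proof.
have [D1 DM DV] := Dgrp.
move=> /span_normal_form [|[g0 [i [b [h [Dg0 wh ->]]]]]]; first by left.
right; exists g0^-1%g, i, b; split; first exact: DV.
by move=> x free; rewrite mulKg; apply: word_act.
Qed.

End PingPong.

(** * Matching two tuples of cosets *)

Lemma common_radius (I : finType) (P : I -> R -> Prop) :
  (forall i e e', e' <= e -> P i e -> P i e') ->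
  (forall i, exists e, 0 < e /\ P i e) -> exists e, 0 < e /\ forall i, P i e.
Proof.
move=> mono H.
suff [e [e_0 he]] : exists e, 0 < e /\ forall i, i \in enum I -> P i e.
  by exists e; split=> // i; apply: he; rewrite mem_enum.
elim: (enum I) => [|i s [e [e_0 he]]]; first by exists 1; split=> //; lra.
have [f [f_0 hf]] := H i.
exists (Rmin e f); split=> [|j]; first exact: Rmin_pos.
rewrite inE => /orP [/eqP ->|js]; first by apply: mono hf; exact: Rmin_r.
by apply: mono (he j js); exact: Rmin_l.
Qed.

Lemma sepz_ball D u v z s : sepz D u (act v^-1%g z) s ->
  exists e, 0 < e /\ forall g w, D g -> d s w < e -> d z (act (v * g * u)%g w) < e -> False.
Proof.
move=> [e [e_0 S]]; have [e' [e'0 he']] := act_cont v^-1%g z e_0.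
exists (Rmin e e'); split; first exact: Rmin_pos.
have m1 := Rmin_l e e'; have m2 := Rmin_r e e'.
move=> g w Dg w1 w2; apply: (S g w Dg); first by lra.
have := he' _ (Rlt_le_trans _ _ _ w2 m2).
by rewrite -actM -!mulgA mulKg.
Qed.

(** The generators [(y i)^-1 * h * x i] play on neighbourhoods of [(x i)^-1 r] and [(y i)^-1 a],
    whose [D]-translates are disjoint from each other and miss the images under [1] and [F] of a
    ball around [p]. An element of the new group outside [D] moves this ball, up to [D], into one of
    these regions; so it does not bring a point of the ball back, and it is not in [F]. *)
Lemma extension (D : T -> Prop) q e (I : finType) (x y : I -> T) (F : seq T) :
  subgrp D -> good D q e ->
  (forall i j, D ((x i)^-1 * x j)%g -> i = j) ->
  (forall i j, D ((y i)^-1 * y j)%g -> i = j) ->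
  exists h D' q' e', [/\ subgrp D', good D' q' e', forall g, D g -> D' g,
    forall i, D' ((y i)^-1 * h * x i)%g & forall f, f \in F -> D' f -> D f].
Proof.
move=> Dgrp Dgood xD yD; have [D1 DM DV] := Dgrp.
have oW := odns_wandering Dgrp Dgood.
(* The points are chosen in the order [r], [a], [p], with [a] and [p] also separated from the
   relevant [D]-orbits of the earlier ones. *)
have [r [lr [rW rS]]] := odns_ex (odns_and
  (odns_fin (fun i => odns_act (x i)^-1%g oW))
  (odns_fin (fun ij : I * I => odns_sep Dgrp Dgood (x ij.1)^-1%g (x ij.2)^-1%g))).
have lxr i : lim (act (x i)^-1%g r) by apply: lim_act.
have [a [la [[aW aS] aZ]]] := odns_ex (odns_and (odns_and
  (odns_fin (fun i => odns_act (y i)^-1%g oW))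
  (odns_fin (fun ij : I * I => odns_sep Dgrp Dgood (y ij.1)^-1%g (y ij.2)^-1%g)))
  (odns_fin (fun ij : I * I =>
     odns_sepz Dgrp Dgood (y ij.1)^-1%g (lxr ij.2) (rW ij.2)))).
have lya i : lim (act (y i)^-1%g a) by apply: lim_act.
(* With [1] added to [F], the same estimates cover the ball around [p] itself. *)
pose F' := seq_sub (1%g :: F).
have [p [lp [[pS pr] pa]]] := odns_ex (odns_and (odns_and
  (odns_sep Dgrp Dgood 1%g 1%g)
  (odns_fin (fun fi : F' * I => odns_sepz Dgrp Dgood (ssval fi.1) (lxr fi.2) (rW fi.2))))
  (odns_fin (fun fi : F' * I => odns_sepz Dgrp Dgood (ssval fi.1) (lya fi.2) (aW fi.2)))).
have [e1 [e1_0 R1]] : exists e, 0 < e /\ forall ij : I * I, forall g w, D g ->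
    d r w < e -> d r (act ((x ij.2)^-1^-1 * g * (x ij.1)^-1)%g w) < e ->
    (g * (x ij.1)^-1)%g = (x ij.2)^-1%g.
  apply: common_radius => [ij f f' f'f H g w Dg w1 w2|]; last exact: rS.
  by apply: (H g w) => //; lra.
have [e2 [e2_0 R2]] : exists e, 0 < e /\ forall ij : I * I, forall g w, D g ->
    d a w < e -> d a (act ((y ij.2)^-1^-1 * g * (y ij.1)^-1)%g w) < e ->
    (g * (y ij.1)^-1)%g = (y ij.2)^-1%g.
  apply: common_radius => [ij f f' f'f H g w Dg w1 w2|]; last exact: aS.
  by apply: (H g w) => //; lra.
have [e3 [e3_0 R3]] : exists e, 0 < e /\ forall ij : I * I, forall g w, D g ->
    d a w < e -> d r (act (x ij.2 * g * (y ij.1)^-1)%g w) < e -> False.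
  apply: common_radius => [ij f f' f'f H g w Dg w1 w2|ij].
    by apply: (H g w) => //; lra.
  exact: sepz_ball (aZ ij).
have [e4 [e4_0 R4]] : exists e, 0 < e /\ forall fi : F' * I, forall g w, D g ->
    d p w < e -> d r (act (x fi.2 * g * ssval fi.1)%g w) < e -> False.
  apply: common_radius => [ij f f' f'f H g w Dg w1 w2|ij].
    by apply: (H g w) => //; lra.
  exact: sepz_ball (pr ij).
have [e5 [e5_0 R5]] : exists e, 0 < e /\ forall fi : F' * I, forall g w, D g ->
    d p w < e -> d a (act (y fi.2 * g * ssval fi.1)%g w) < e -> False.
  apply: common_radius => [ij f f' f'f H g w Dg w1 w2|ij].
    by apply: (H g w) => //; lra.
  exact: sepz_ball (pa ij).
have [e6 [e6_0 R6]] := pS.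
have [rho [rho0 hrho]] : exists rho, 0 < rho /\ forall i : 'I_6,
    rho <= nth 0 [:: e1; e2; e3; e4; e5; e6] i.
  apply: common_radius => [i f f'|i]; first by lra.
  exists (nth 0 [:: e1; e2; e3; e4; e5; e6] i); split; last by lra.
  by case: i => -[|[|[|[|[|[|]]]]]] //=.
have l1 : rho <= e1 by exact: (hrho (@Ordinal 6 0 isT)).
have l2 : rho <= e2 by exact: (hrho (@Ordinal 6 1 isT)).
have l3 : rho <= e3 by exact: (hrho (@Ordinal 6 2 isT)).
have l4 : rho <= e4 by exact: (hrho (@Ordinal 6 3 isT)).
have l5 : rho <= e5 by exact: (hrho (@Ordinal 6 4 isT)).
have l6 : rho <= e6 by exact: (hrho (@Ordinal 6 5 isT)).
have [h hh] := lim_collapsing la lr rho0.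
pose t i (b : bool) := if b then ((y i)^-1 * h * x i)%g else ((y i)^-1 * h * x i)^-1%g.
pose C i (b : bool) w := if b then d a (act (y i) w) < rho else d r (act (x i) w) < rho.
have tV i b : t i (~~ b) = (t i b)^-1%g by case: b; rewrite /t //= invgK.
have tC1 i w : ~ C i false w -> C i true (act (t i true) w).
  rewrite /C /t /= !actM actKV => /Rnot_lt_le H.
  by rewrite d_sym; apply: hh; rewrite d_sym.
have tC i b w : ~ C i (~~ b) w -> C i b (act (t i b) w).
  case: b => [|H]; first exact: tC1.
  apply: contrapT => H'; apply: H.
  by have := tC1 _ _ H'; rewrite (tV i true : t i false = _) actKV.
have mixed g i j w : D g -> C i true w -> C j false (act g w) -> False.
  rewrite /C => Dg h1 h2; apply: (R3 (i, j) g (act (y i) w) Dg) => /=; first by lra.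
  by rewrite !actM actK; lra.
have disj g i b j c w : D g -> C i b w -> C j c (act g w) -> [/\ g = 1%g, i = j & b = c].
  move=> Dg; case: b; case: c.
  - rewrite /C => h1 h2.
    have E : (g * (y i)^-1)%g = (y j)^-1%g.
      apply: (R2 (i, j) g (act (y i) w) Dg) => /=; first by lra.
      by rewrite invgK !actM actK; lra.
    have Eg : g = ((y j)^-1 * y i)%g by rewrite -E mulgVK.
    have ij : j = i by apply: yD; rewrite -Eg.
    by rewrite Eg ij mulVg.
  - by move=> h1 h2; case: (mixed g i j w).
  - by move=> h1 h2; case: (mixed g^-1%g j i (act g w)); rewrite ?actK //; exact: DV.
  - rewrite /C => h1 h2.
    have E : (g * (x i)^-1)%g = (x j)^-1%g.
      apply: (R1 (i, j) g (act (x i) w) Dg) => /=; first by lra.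
      by rewrite invgK !actM actK; lra.
    have Eg : g = ((x j)^-1 * x i)%g by rewrite -E mulgVK.
    have ij : j = i by apply: xD; rewrite -Eg.
    by rewrite Eg ij mulVg.
have offC (f : F') w : d p w < rho -> forall g j c, D g -> ~ C j c (act (g * ssval f)%g w).
  move=> w1 g j [] Dg; rewrite /C => h1.
    by apply: (R5 (f, j) g w Dg) => /=; [lra | rewrite -mulgA actM; exact: Rlt_le_trans h1 _].
  by apply: (R4 (f, j) g w Dg) => /=; [lra | rewrite -mulgA actM; exact: Rlt_le_trans h1 _].
have F1 : 1%g \in 1%g :: F by rewrite mem_head.
have free w : d p w < rho -> forall g j c, D g -> ~ C j c (act g w).
  by move=> w1 g j c Dg; have := offC (SeqSub F1) w w1 g j c Dg; rewrite /= mulg1.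
exists h, (span D t), p, rho; split.
- exact: span_subgrp.
- split=> // g sg [w [w1 w2]].
  case: (span_act Dgrp tV tC disj sg) => [Dg|[g0 [i [b [Dg0 H]]]]].
    suff : (g * 1)%g = 1%g by rewrite mulg1.
    by apply: (R6 g w Dg); rewrite ?invg1 ?mul1g ?mulg1; lra.
  by have := H w (free w w1); rewrite actM => /free; case.
- by move=> g Dg K _ KD _; apply: KD.
- by move=> i K _ _ /(_ i true).
- move=> f fF sf; case: (span_act Dgrp tV tC disj sf) => // -[g0 [i [b [Dg0 H]]]].
  have fF1 : f \in 1%g :: F by rewrite inE fF orbT.
  have pp : d p p < rho by rewrite d_refl.
  by case: (offC (SeqSub fF1) p pp g0 i b Dg0); apply: H; apply: free.
Qed.

(** * Exhausting all pairs of tuples *)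

Variable code : T -> nat.
Hypothesis code_inj : injective code.

(** A stage of the construction: a good subgroup and a finite list of elements which it must
    avoid. *)
Definition admissible (S : (T -> Prop) * seq T) := [/\ subgrp S.1,
  exists q e, good S.1 q e & forall f, f \in S.2 -> ~ S.1 f].

Definition code_pairs (l : seq (T * T)) : nat :=
  pickle [seq (code p.1, code p.2) | p <- l].

Lemma code_pairs_inj : injective code_pairs.
Proof.
move=> l l' /(pcan_inj pickleK); apply: inj_map => -[a b] [a' b'] [] /code_inj -> /code_inj ->.
by [].
Qed.

Definition separated (D : T -> Prop) (l : seq (T * T)) := forall p p', p \in l -> p' \in l ->
  (D (p.1^-1 * p'.1)%g -> p = p') /\ (D (p.2^-1 * p'.2)%g -> p = p').

Lemma admissible_step n S : admissible S -> exists S', [/\ admissible S',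
  (forall g, S.1 g -> S'.1 g) /\ (forall f, f \in S.2 -> f \in S'.2),
  forall l, code_pairs l = n -> separated S.1 l ->
    exists h, forall p, p \in l -> S'.1 (p.2^-1 * h * p.1)%g &
  forall g, code g = n -> g <> 1%g -> exists h, (h * g * h^-1)%g \in S'.2].
Proof.
case: S => D F [/= Dgrp [q [e Dgood]] FD].
have [F1 [FF1 F1D F1n]] : exists F1 : seq T, [/\ forall f, f \in F -> f \in F1,
    forall f, f \in F1 -> ~ D f &
    forall g, code g = n -> g <> 1%g -> exists h, (h * g * h^-1)%g \in F1].
  have [[g [gn g1]]|H] := pselect (exists g, code g = n /\ g <> 1%g); last first.
    by exists F; split=> // g gn g1; case: H; exists g.
  have [h hD] : exists h, ~ D (h * g * h^-1)%g.
    apply: contrapT => H; apply: g1; apply: (good_core Dgood) => h.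
    by apply: contrapT => H'; apply: H; exists h.
  exists ((h * g * h^-1)%g :: F); split=> [f fF|f|g' g'n _].
  - by rewrite inE fF orbT.
  - by rewrite inE => /orP [/eqP ->|/FD].
  - by exists h; rewrite (code_inj (etrans g'n (esym gn))) mem_head.
have [[l [ln lD]]|H] := pselect (exists l, code_pairs l = n /\ separated D l); last first.
  exists (D, F1); split=> //=; first by split=> //; exists q, e.
  by move=> l ln lD; case: H; exists l.
have [i j|i j|h [D' [q' [e' [D'grp D'good DD' hD' FD']]]]] :=
    @extension D q e (seq_sub l) (fun i => (ssval i).1) (fun i => (ssval i).2) F1 Dgrp Dgood.
- by move=> H; apply: val_inj; apply: (proj1 (lD _ _ (ssvalP i) (ssvalP j))).
- by move=> H; apply: val_inj; apply: (proj2 (lD _ _ (ssvalP i) (ssvalP j))).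
exists (D', F1); split=> //=.
  by split=> //; [exists q', e' | move=> f fF1 D'f; apply: (F1D f fF1); exact: FD'].
move=> l' l'n _; have -> : l' = l by apply: code_pairs_inj; rewrite l'n.
by exists h => p pl; exact: (hD' (SeqSub pl)).
Qed.

Lemma admissible_ex : exists S, admissible S.
Proof.
exists (fun g => g = 1%g, [::]); split=> //=.
  by split=> // [g h -> ->|g ->]; rewrite ?mulg1 ?invg1.
have [x [lx _]] := odns_ex odns_true.
by exists x, 1; split=> //; lra.
Qed.

(** Take the union of the chain of stages. Goodness need not pass to the union, so the trivial core
    comes from the forbidden lists. *)
Lemma core_free_highly_transitive_subgroup : exists D, [/\ subgrp D,
  forall g, (forall h, D (h * g * h^-1)%g) -> g = 1%g &
  forall l, separated D l -> exists h, forall p, p \in l -> D (p.2^-1 * h * p.1)%g].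
Proof.
have [S0 S0a] := admissible_ex.
have [f hf] := choice (fun nS : nat * {S | admissible S} =>
  admissible_step nS.1 (proj2_sig nS.2)).
pose next n S := exist admissible (f (n, S)) (let: And4 a _ _ _ := hf (n, S) in a).
pose fix chain n := if n is m.+1 then next m (chain m) else exist admissible S0 S0a.
pose Dn n := (sval (chain n)).1; pose Fn n := (sval (chain n)).2.
have adm n : admissible (sval (chain n)) := proj2_sig (chain n).
have step n : [/\ (forall g, Dn n g -> Dn n.+1 g) /\ (forall f, f \in Fn n -> f \in Fn n.+1),
  forall l, code_pairs l = n -> separated (Dn n) l ->
    exists h, forall p, p \in l -> Dn n.+1 (p.2^-1 * h * p.1)%g &
  forall g, code g = n -> g <> 1%g -> exists h, (h * g * h^-1)%g \in Fn n.+1].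
  by have [_ h1 h2 h3] := hf (n, chain n).
have DnS m n g : (m <= n)%N -> Dn m g -> Dn n g.
  move=> /subnKC <-; elim: (n - m)%N => [|k IH]; first by rewrite addn0.
  by rewrite addnS => /IH; case: (step (m + k)%N) => -[+ _] _ _; apply.
have FnS m n g : (m <= n)%N -> g \in Fn m -> g \in Fn n.
  move=> /subnKC <-; elim: (n - m)%N => [|k IH]; first by rewrite addn0.
  by rewrite addnS => /IH; case: (step (m + k)%N) => -[_ +] _ _; apply.
exists (fun g => exists n, Dn n g); split.
- split=> [|g h [m Dg] [n Dh]|g [n Dg]].
  + by exists 0%N; case: (adm 0%N) => -[].
  + exists (maxn m n); have [[_ DM _] _ _] := adm (maxn m n).
    by apply: DM; [apply: DnS Dg; exact: leq_maxl | apply: DnS Dh; exact: leq_maxr].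
  + by exists n; have [[_ _ DV] _ _] := adm n; apply: DV.
- move=> g H; apply: contrapT => g1.
  have [_ _ /(_ g erefl g1) [h hF]] := step (code g).
  have [m Dm] := H h.
  pose N := maxn m (code g).+1.
  have [_ _ /(_ (h * g * h^-1)%g)] := adm N; apply.
    by apply: FnS hF; exact: leq_maxr.
  by apply: DnS Dm; exact: leq_maxl.
(* A list separated for the union is separated at every stage, in particular at the one indexed by
   its code. *)
- move=> l lD; have [_ /(_ l erefl) H _] := step (code_pairs l).
  have [p p' pl p'l|h hh] := H; last by exists h => p pl; exists (code_pairs l).+1; exact: hh.
  have [h1 h2] := lD p p' pl p'l.
  by split=> Dp; [apply: h1|apply: h2]; exists (code_pairs l).
Qed.

Theorem convergence_highly_transitive : exists (Y : Type) (ac : T -> Y -> Y),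
  [/\ forall y, ac 1%g y = y, forall g h y, ac (g * h)%g y = ac g (ac h y),
   forall g, (forall y, ac g y = y) -> g = 1%g &
   forall n (u v : 'I_n -> Y), injective u -> injective v ->
     exists g, forall i, ac g (u i) = v i].
Proof.
have [D [[D1 DM DV] core HT]] := core_free_highly_transitive_subgroup.
(* Left cosets are predicates, so that extensionality makes equal cosets equal points. *)
pose coset x := (fun y => D (x^-1 * y)%g) : T -> Prop.
have cosetE x y : coset x = coset y <-> D (x^-1 * y)%g.
  split=> [E|Dxy].
    have : coset y y by rewrite /coset mulVg.
    by rewrite -E.
  apply: funext => z; apply: propext; split=> [Dxz|Dyz].
    rewrite /coset; have -> : (y^-1 * z = (x^-1 * y)^-1 * (x^-1 * z))%g.
      by rewrite invgM invgK -mulgA mulVKg.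
    by apply: DM => //; apply: DV.
  rewrite /coset; have -> : (x^-1 * z = (x^-1 * y) * (y^-1 * z))%g by rewrite -mulgA mulVKg.
  exact: DM.
pose Y := {A : T -> Prop | exists x, A = coset x}.
have Yinj (A B : Y) : sval A = sval B -> A = B.
  by case: A B => [A a] [B b] /= E; subst; congr exist; exact: Prop_irrelevance.
pose mk x : Y := exist _ (coset x) (ex_intro _ x erefl).
have mv g (A : Y) : exists x, (fun y => sval A (g^-1 * y)%g) = coset x.
  have [x E] := svalP A; exists (g * x)%g; apply: funext => y; rewrite E.
  by rewrite /coset invgM mulgA.
pose ac g A : Y := exist _ _ (mv g A).
have acE g x : ac g (mk x) = mk (g * x)%g.
  by apply: Yinj; apply: funext => y; rewrite /= /coset invgM mulgA.
have mkP A : exists x, A = mk x.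
  by case: A => A [x E]; exists x; apply: Yinj.
have mkE x y : mk x = mk y <-> D (x^-1 * y)%g.
  by rewrite -cosetE; split=> [/(congr1 sval)|E]; last exact: Yinj.
exists Y, ac; split.
- by move=> A; have [x ->] := mkP A; rewrite acE mul1g.
- by move=> g h A; have [x ->] := mkP A; rewrite !acE mulgA.
- move=> g H; apply: core => h.
  have := H (mk h^-1%g); rewrite acE => /esym /mkE.
  by rewrite invgK mulgA.
- move=> n u v ui vi.
  have [x hx] := choice (fun i => mkP (u i)).
  have [y hy] := choice (fun i => mkP (v i)).
  have [p p'|h hh] := HT [seq (x i, y i) | i <- enum 'I_n].
    move=> /mapP [i _ ->] /mapP [j _ ->] /=.
    split=> /mkE; rewrite -?hx -?hy; first by move/ui ->.
    by move/vi ->.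
  exists h => i; rewrite hx hy acE; apply/esym/mkE.
  rewrite mulgA; apply: (hh (x i, y i)).
  by apply/mapP; exists i; rewrite ?mem_enum.
Qed.

End ConvergenceAction.

Import GRing.Theory.
Local Open Scope ring_scope.

(** * Local fields and the projective line *)

Section AbsoluteValue.
Variables (k : fieldType) (abs : k -> R).
Hypothesis absP : is_abs_value abs.

Lemma abs_ge0 x : (0 <= abs x)%Re.
Proof. by case: absP. Qed.

Lemma abs_eq0 x : abs x = 0%Re <-> x = 0.
Proof. by case: absP => _ []. Qed.

Lemma absM x y : abs (x * y) = (abs x * abs y)%Re.
Proof. by case: absP => _ [_ []]. Qed.

Lemma absD x y : (abs (x + y)%R <= abs x + abs y)%Re.
Proof. by case: absP => _ [_ []]. Qed.

Lemma abs0 : abs 0 = 0%Re.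
Proof. exact/abs_eq0. Qed.

Lemma abs_gt0 x : x <> 0 -> (0 < abs x)%Re.
Proof. by move=> x0; have := abs_ge0 x; have := abs_eq0 x => [[h _]] [|/esym/h]. Qed.

Lemma abs1 : abs 1 = 1%Re.
Proof.
have := absM 1 1; rewrite mulr1 => h.
have : (0 < abs 1)%Re by apply/abs_gt0/eqP/oner_neq0.
by nra.
Qed.

Lemma absN x : abs (- x) = abs x.
Proof.
have h : abs (-1) = 1%Re.
  have := absM (-1) (-1); rewrite mulrNN mulr1 abs1 => h.
  by have := abs_ge0 (-1); nra.
by rewrite -mulN1r absM h Rmult_1_l.
Qed.

Lemma absB x y : abs (x - y) = abs (y - x).
Proof. by rewrite -absN opprB. Qed.

Lemma absV x : abs x^-1 = (/ abs x)%Re.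
Proof.
have [->|x0] := eqVneq x 0; first by rewrite invr0 abs0 Rinv_0.
apply: (Rmult_eq_reg_l (abs x)); last by have := abs_gt0 (elimN eqP x0); lra.
by rewrite -absM divff // abs1 Rinv_r //; have := abs_gt0 (elimN eqP x0); lra.
Qed.

Lemma absX x n : abs (x ^+ n) = (abs x ^ n)%Re.
Proof. by elim: n => [|n IH] /=; rewrite ?abs1 // exprS absM IH. Qed.

Lemma absD3 x y z : (abs (x + y + z)%R <= abs x + abs y + abs z)%Re.
Proof. by have := absD (x + y) z; have := absD x y; lra. Qed.

Lemma abs_le_sub x y : (abs x - abs y <= abs (x - y)%R)%Re.
Proof. by have := absD (x - y) y; rewrite subrK; lra. Qed.

Lemma abs_near x l e : (abs (x - l)%R < e)%Re -> (abs x < abs l + e)%Re.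
Proof. by have := absD (x - l) l; rewrite subrK; lra. Qed.

Lemma converges_subseq (u : nat -> k) l (phi : nat -> nat) :
  (forall n, (phi n < phi n.+1)%N) -> converges abs u l -> converges abs (u \o phi) l.
Proof.
move=> mono cv e e0; have [N hN] := cv e e0; exists N => n Nn; apply: hN.
apply: leq_trans Nn _; elim: n => // n IH; exact: leq_ltn_trans IH (mono n).
Qed.

Lemma converges_all (I : finType) (u : I -> nat -> k) l e :
  (forall i, converges abs (u i) (l i)) -> (0 < e)%Re ->
  exists N, forall n, (N <= n)%N -> forall i, (abs (u i n - l i)%R < e)%Re.
Proof.
move=> cv e0.
suff [N hN] : exists N, forall n, (N <= n)%N -> forall i, i \in enum I ->
    (abs (u i n - l i)%R < e)%Re.
  by exists N => n Nn i; apply: hN => //; rewrite mem_enum.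
elim: (enum I) => [|i s [N hN]]; first by exists 0%N.
have [M hM] := cv i e e0; exists (maxn N M) => n; rewrite geq_max => /andP [h1 h2] j.
by rewrite inE => /orP [/eqP ->|]; [exact: hM | exact: hN].
Qed.

Lemma phi_comp (phi psi : nat -> nat) : (forall n, (phi n < phi n.+1)%N) ->
  (forall n, (psi n < psi n.+1)%N) -> forall n, (phi (psi n) < phi (psi n.+1))%N.
Proof.
move=> h1 h2 n; have mono m p : (m < p)%N -> (phi m < phi p)%N.
  elim: p => // p IH; rewrite ltnS leq_eqVlt => /orP [/eqP ->|/IH h]; first exact: h1.
  exact: ltn_trans h (h1 p).
exact: mono.
Qed.

Lemma phi_ge (phi : nat -> nat) n : (forall n, (phi n < phi n.+1)%N) -> (n <= phi n)%N.
Proof. by move=> mono; elim: n => // n IH; exact: leq_ltn_trans IH (mono n). Qed.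

Hypothesis nontriv : nontrivial_abs abs.
Hypothesis lc : locally_compact abs.

Lemma large_abs (C : R) : exists c, c <> 0 /\ (C < abs c)%Re.
Proof.
have [x [x0 x1]] := nontriv.
have nx : x <> 0 by move=> /abs_eq0.
have hx := abs_gt0 nx.
have [y [y0 y1]] : exists y, y <> 0 /\ (1 < abs y)%Re.
  have [|] := Rlt_le_dec 1 (abs x); first by exists x.
  move=> h; exists x^-1; split; first by apply/eqP; rewrite invr_eq0; exact/eqP.
  rewrite absV -Rinv_1; apply: Rinv_lt_contravar; lra.
have [N hN] := Pow_x_infinity (abs y) ltac:(rewrite Rabs_pos_eq; [lra|exact: abs_ge0]) (C + 1)%Re.
exists (y ^+ N); split; first by apply/eqP; rewrite expf_neq0 //; exact/eqP.
have := hN N (PeanoNat.Nat.le_refl N); rewrite -absX Rabs_pos_eq; first by lra.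
exact: abs_ge0.
Qed.

(** Local compactness at 0 concerns a ball of some radius [r] only; dividing by a scalar of absolute
    value above [C / r] brings the sequence into it. *)
Lemma bounded_subseq (u : nat -> k) C : (forall n, (abs (u n) <= C)%Re) ->
  exists (phi : nat -> nat) l, (forall n, (phi n < phi n.+1)%N) /\ converges abs (u \o phi) l.
Proof.
move=> uC; have [r [r0 H]] := lc 0.
have C0 : (0 <= C)%Re by have := uC 0%N; have := abs_ge0 (u 0%N); lra.
have [c [c0 hc]] := large_abs (C / r).
have pc := abs_gt0 c0.
have hc' : (C <= r * abs c)%Re.
  have -> : C = (r * (C / r))%Re by rewrite /Rdiv (Rmult_comm C) -Rmult_assoc Rinv_r; lra.
  by apply: Rmult_le_compat_l; lra.
have [|phi [l [mono cv]]] := H (fun n => c^-1 * u n).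
  move=> n; rewrite subr0 absM absV.
  apply: (Rmult_le_reg_l (abs c)) => //.
  by rewrite -Rmult_assoc Rinv_r; have := uC n; nra.
exists phi, (c * l); split=> // e e0.
have [N hN] := cv (e / abs c)%Re (Rdiv_lt_0_compat _ _ e0 pc).
exists N => n /hN h; rewrite /comp.
have -> : u (phi n) - c * l = c * (c^-1 * u (phi n) - l).
  by rewrite mulrBr mulrA divff ?mul1r //; exact/eqP.
rewrite absM; have -> : e = (abs c * (e / abs c))%Re.
  by rewrite /Rdiv (Rmult_comm e) -Rmult_assoc Rinv_r; lra.
exact: Rmult_lt_compat_l.
Qed.

Lemma bounded_subseq_fin (I : finType) (u : I -> nat -> k) C :
  (forall i n, (abs (u i n) <= C)%Re) ->
  exists (phi : nat -> nat) (l : I -> k), (forall n, (phi n < phi n.+1)%N) /\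
    forall i, converges abs (u i \o phi) (l i).
Proof.
move=> uC.
suff [phi [l [mono cv]]] : exists (phi : nat -> nat) (l : I -> k),
    (forall n, (phi n < phi n.+1)%N) /\
    forall i, i \in enum I -> converges abs (u i \o phi) (l i).
  by exists phi, l; split=> // i; apply: cv; rewrite mem_enum.
elim: (enum I) => [|i s [phi [l [mono cv]]]]; first by exists id, (fun=> 0).
have [psi [m [mono' cv']]] := bounded_subseq (fun n => uC i (phi n)).
exists (phi \o psi), (fun j => if j == i then m else l j).
split=> [n|j]; first exact: (phi_comp mono mono' n).
rewrite inE; have [-> _|ji /= js] := eqVneq j i; first exact: cv'.
exact: (converges_subseq mono' (cv j js)).
Qed.


End AbsoluteValue.

(** * Two by two matrices and the projective line *)

Lemma mul_mx2 (F : fieldType) (g h : 'M[F]_2) i j :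
  (g * h) i j = g i 0 * h 0 j + g i 1 * h 1 j.
Proof. by rewrite -mulmxE mxE big_ord_recl big_ord1; congr (_ + g i _ * h _ j); apply: val_inj. Qed.

Lemma det_mx2 (F : fieldType) (g : 'M[F]_2) : \det g = g 0 0 * g 1 1 - g 0 1 * g 1 0.
Proof.
rewrite (expand_det_row _ 0) big_ord_recl big_ord1 /cofactor !det_mx11 !mxE /=.
rewrite (_ : lift 0 0 = 1); last exact: val_inj.
rewrite (_ : lift 1 0 = 0); last exact: val_inj.
by rewrite expr0 expr1 mul1r mulN1r mulrN.
Qed.

Lemma ord2P (P : 'I_2 -> Prop) : P 0 -> P 1 -> forall i, P i.
Proof.
move=> h0 h1 [[|[|//]] hi]; [move: h0|move: h1]; congr P; exact: val_inj.
Qed.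

Lemma mx2P (F : fieldType) (g h : 'M[F]_2) : g 0 0 = h 0 0 -> g 0 1 = h 0 1 ->
  g 1 0 = h 1 0 -> g 1 1 = h 1 1 -> g = h.
Proof. by move=> *; apply/matrixP => i j; move: i j; do 2!apply: ord2P. Qed.

Definition mk2 (F : fieldType) (a b c e : F) : 'M[F]_2 := \matrix_(i, j)
  if i == 0 then (if j == 0 then a else b) else (if j == 0 then c else e).

Lemma mk2E (F : fieldType) (a b c e : F) :
  (mk2 a b c e 0 0 = a) * (mk2 a b c e 0 1 = b) *
  (mk2 a b c e 1 0 = c) * (mk2 a b c e 1 1 = e).
Proof. by rewrite !mxE. Qed.

Lemma one_mx2 (F : fieldType) : ((1 : 'M[F]_2) 0 0 = 1) * ((1 : 'M[F]_2) 0 1 = 0) *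
  ((1 : 'M[F]_2) 1 0 = 0) * ((1 : 'M[F]_2) 1 1 = 1).
Proof. by rewrite !mxE. Qed.

Lemma det1_unit (F : fieldType) (g : 'M[F]_2) : \det g = 1 -> g \is a GRing.unit.
Proof. by move=> h; rewrite -[_ \is a _]/(g \in unitmx) unitmxE h unitr1. Qed.

Lemma inv_mx2 (F : fieldType) (g : 'M[F]_2) : \det g = 1 ->
  g^-1 = mk2 (g 1 1) (- g 0 1) (- g 1 0) (g 0 0).
Proof.
move=> dg; apply: (mulrI (det1_unit dg)); rewrite divrr ?det1_unit //.
rewrite det_mx2 in dg.
by apply: mx2P; rewrite mul_mx2 !mk2E !one_mx2 // -?dg; ring.
Qed.

Section Plane.
Variable k : fieldType.
Implicit Types (g h : 'M[k]_2) (u v w : k * k).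

(** For nonzero vectors its vanishing means that they span the same line, so points of the
    projective line are handled as nonzero vectors without a quotient. *)
Definition wedge u v : k := u.1 * v.2 - u.2 * v.1.

Definition mv g u : k * k := (g 0 0 * u.1 + g 0 1 * u.2, g 1 0 * u.1 + g 1 1 * u.2).

Lemma mv1 u : mv 1 u = u.
Proof. by case: u => x y; rewrite /mv !one_mx2 /=; congr pair; ring. Qed.

Lemma mvM g h u : mv (g * h) u = mv g (mv h u).
Proof. by rewrite /mv !mul_mx2 /=; congr pair; ring. Qed.

Lemma mv0 g : mv g 0 = 0.
Proof. by rewrite /mv /= !mulr0 addr0. Qed.

Lemma mvK g u : \det g = 1 -> mv g^-1 (mv g u) = u.
Proof. by move=> dg; rewrite -mvM mulVr ?mv1 ?det1_unit. Qed.

Lemma mv_neq0 g u : \det g = 1 -> u != 0 -> mv g u != 0.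
Proof.
by move=> dg; apply: contraNN => /eqP h; rewrite -(mvK u dg) h mv0.
Qed.

Lemma wedge_mv g u v : wedge (mv g u) (mv g v) = \det g * wedge u v.
Proof. by rewrite /wedge /mv /= det_mx2; ring. Qed.

Lemma wedgeC u v : wedge u v = - wedge v u.
Proof. by rewrite /wedge; ring. Qed.

Lemma wedgevv u : wedge u u = 0.
Proof. by rewrite /wedge; ring. Qed.

Lemma wedge_trans u v w : v != 0 -> wedge u v = 0 -> wedge v w = 0 -> wedge u w = 0.
Proof.
rewrite /wedge => v0 h1 h2.
have e1 : v.1 * (u.1 * w.2 - u.2 * w.1) = 0.
  have -> : v.1 * (u.1 * w.2 - u.2 * w.1) =
    (u.1 * v.2 - u.2 * v.1) * w.1 + (v.1 * w.2 - v.2 * w.1) * u.1 by ring.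
  by rewrite h1 h2 !mul0r addr0.
have e2 : v.2 * (u.1 * w.2 - u.2 * w.1) = 0.
  have -> : v.2 * (u.1 * w.2 - u.2 * w.1) =
    (u.1 * v.2 - u.2 * v.1) * w.2 + (v.1 * w.2 - v.2 * w.1) * u.2 by ring.
  by rewrite h1 h2 !mul0r addr0.
apply: contraNeq v0 => n0; case: v {h1 h2} e1 e2 => x y /= /eqP + /eqP.
by rewrite !mulf_eq0 (negbTE n0) !orbF => /eqP -> /eqP ->.
Qed.

(* The three equations Q(x) = 0, for the quadratic form Q(x) = gx ^ x, are linear in the
   coefficients of Q, with determinant the product of the three wedges. *)
Lemma three_fixed g u v w : wedge u v <> 0 -> wedge u w <> 0 -> wedge v w <> 0 ->
  wedge (mv g u) u = 0 -> wedge (mv g v) v = 0 -> wedge (mv g w) w = 0 ->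
  g = (g 0 0)%:M.
Proof.
move=> /eqP huv /eqP huw /eqP hvw hu hv hw.
pose D := wedge u v * (wedge u w * wedge v w).
have D0 : D != 0 by rewrite !mulf_neq0.
have cancel x : D * x = 0 -> x = 0.
  by move=> /eqP; rewrite mulf_eq0 (negbTE D0) /= => /eqP.
have hb : g 0 1 = 0.
  apply: cancel; have -> : D * g 0 1 =
      wedge (mv g u) u * (v.1 * w.1 * (v.1 * w.2 - v.2 * w.1))
    + wedge (mv g v) v * (u.1 * w.1 * (w.1 * u.2 - w.2 * u.1))
    + wedge (mv g w) w * (u.1 * v.1 * (u.1 * v.2 - u.2 * v.1)).
    by rewrite /D /wedge /mv /=; ring.
  by rewrite hu hv hw !mul0r !addr0.
have hc : g 1 0 = 0.
  apply: cancel; have -> : D * g 1 0 =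
    - (wedge (mv g u) u * (v.2 * w.2 * (v.1 * w.2 - v.2 * w.1))
    + wedge (mv g v) v * (u.2 * w.2 * (w.1 * u.2 - w.2 * u.1))
    + wedge (mv g w) w * (u.2 * v.2 * (u.1 * v.2 - u.2 * v.1))).
    by rewrite /D /wedge /mv /=; ring.
  by rewrite hu hv hw !mul0r !addr0 oppr0.
have had : g 0 0 - g 1 1 = 0.
  apply: cancel; have -> : D * (g 0 0 - g 1 1) =
    - (wedge (mv g u) u * ((v.1 * w.2 + v.2 * w.1) * (v.1 * w.2 - v.2 * w.1))
    + wedge (mv g v) v * ((w.1 * u.2 + w.2 * u.1) * (w.1 * u.2 - w.2 * u.1))
    + wedge (mv g w) w * ((u.1 * v.2 + u.2 * v.1) * (u.1 * v.2 - u.2 * v.1))).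
    by rewrite /D /wedge /mv /=; ring.
  by rewrite hu hv hw !mul0r !addr0 oppr0.
by apply: mx2P; rewrite ?hb ?hc !mxE //= -(subrK (g 1 1) (g 0 0)) had add0r.
Qed.

End Plane.

(** * The metric on the projective line *)

Section ProjectiveMetric.
Variables (k : fieldType) (abs : k -> R).
Hypothesis absP : is_abs_value abs.
Implicit Types (g h : 'M[k]_2) (u v w : k * k).

Definition nv u : R := Rmax (abs u.1) (abs u.2).

Lemma nv_ge u : (abs u.1 <= nv u)%Re /\ (abs u.2 <= nv u)%Re.
Proof. by split; [exact: Rmax_l | exact: Rmax_r]. Qed.

Lemma nv_le u C : (abs u.1 <= C)%Re -> (abs u.2 <= C)%Re -> (nv u <= C)%Re.
Proof. by move=> *; apply: Rmax_lub. Qed.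

Lemma nv_ge0 u : (0 <= nv u)%Re.
Proof. by have := abs_ge0 absP u.1; have [] := nv_ge u; lra. Qed.

Lemma nv_gt0 u : u != 0 -> (0 < nv u)%Re.
Proof.
move=> u0; have [n1 n2] := nv_ge u.
have [e1|/eqP e1] := eqVneq u.1 0; last by have := abs_gt0 absP e1; lra.
have [e2|/eqP e2] := eqVneq u.2 0; last by have := abs_gt0 absP e2; lra.
by case: u e1 e2 u0 {n1 n2} => x y /= -> ->; rewrite eqxx.
Qed.

Lemma nv_neq0 u : nv u = 1%Re -> u != 0.
Proof.
move=> h; apply/eqP => u0; move: h; rewrite u0 /nv /= abs0 // Rmax_left; lra.
Qed.

Definition bdd g (C : R) := forall i j, (abs (g i j) <= C)%Re.

Lemma bdd_ge0 g C : bdd g C -> (0 <= C)%Re.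
Proof. by move=> /(_ 0 0); have := abs_ge0 absP (g 0 0); lra. Qed.

Lemma abs_wedge u v : (abs (wedge u v) <= 2 * nv u * nv v)%Re.
Proof.
rewrite /wedge; apply: Rle_trans (absD absP _ _) _; rewrite absN // !absM //.
have [u1 u2] := nv_ge u; have [v1 v2] := nv_ge v.
have := abs_ge0 absP u.1; have := abs_ge0 absP u.2.
have := abs_ge0 absP v.1; have := abs_ge0 absP v.2 => *.
have := Rmult_le_compat (abs u.1) (nv u) (abs v.2) (nv v).
have := Rmult_le_compat (abs u.2) (nv u) (abs v.1) (nv v).
by lra.
Qed.

Lemma nv_mv g C u : bdd g C -> (nv (mv g u) <= 2 * C * nv u)%Re.
Proof.
move=> gC; have [u1 u2] := nv_ge u; have C0 := bdd_ge0 gC.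
have := abs_ge0 absP u.1; have := abs_ge0 absP u.2 => p1 p2.
have H i : (abs (g i 0 * u.1 + g i 1 * u.2)%R <= 2 * C * nv u)%Re.
  apply: Rle_trans (absD absP _ _) _; rewrite !absM //.
  have := Rmult_le_compat (abs (g i 0)) C (abs u.1) (nv u) (abs_ge0 absP _) p2 (gC i 0) u1.
  have := Rmult_le_compat (abs (g i 1)) C (abs u.2) (nv u) (abs_ge0 absP _) p1 (gC i 1) u2.
  by lra.
by apply: nv_le; apply: H.
Qed.

(** The inverse is the adjugate, which has the same entries up to sign and position. *)
Lemma bdd_inv g C : \det g = 1 -> bdd g C -> bdd g^-1 C.
Proof.
move=> dg gC i j; rewrite inv_mx2 //.
by move: i j; do 2!apply: ord2P; rewrite mk2E ?absN; try exact: gC.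
Qed.

Lemma nv_mv_ge g C u : \det g = 1 -> bdd g C -> (nv u <= 2 * C * nv (mv g u))%Re.
Proof. by move=> dg gC; have := nv_mv (mv g u) (bdd_inv dg gC); rewrite mvK. Qed.

(** The chordal distance for the sup norm; nonzero rescaling of either vector does not change it. *)
Definition pdist u v : R := (abs (wedge u v) / (nv u * nv v))%Re.

Lemma pdist_ge0 u v : (0 <= pdist u v)%Re.
Proof.
rewrite /pdist /Rdiv; apply: Rmult_le_pos; first exact: abs_ge0.
have [|/Rle_lt_or_eq_dec [h|<-]] := Rlt_le_dec (nv u * nv v) 0.
- by have := Rmult_le_pos _ _ (nv_ge0 u) (nv_ge0 v); lra.
- by left; exact: Rinv_0_lt_compat.
- by rewrite Rinv_0; lra.
Qed.

Lemma pdistE u v : u != 0 -> v != 0 -> (pdist u v * (nv u * nv v) = abs (wedge u v))%Re.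
Proof.
move=> u0 v0; have := nv_gt0 u0; have := nv_gt0 v0 => *.
rewrite /pdist /Rdiv Rmult_assoc Rinv_l; first by lra.
by apply: Rmult_integral_contrapositive_currified; lra.
Qed.

Lemma pdist_le u v e : u != 0 -> v != 0 -> (abs (wedge u v) <= e * (nv u * nv v))%Re ->
  (pdist u v <= e)%Re.
Proof.
move=> u0 v0; rewrite -pdistE // => h.
apply: Rmult_le_reg_r h; apply: Rmult_lt_0_compat; exact: nv_gt0.
Qed.

Lemma pdist_refl u : pdist u u = 0%Re.
Proof. by rewrite /pdist wedgevv abs0 // /Rdiv Rmult_0_l. Qed.

Lemma pdist_sym u v : pdist u v = pdist v u.
Proof. by rewrite /pdist wedgeC absN // Rmult_comm. Qed.

Lemma pdist_eq0 u v : u != 0 -> v != 0 -> pdist u v = 0%Re <-> wedge u v = 0.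
Proof.
move=> u0 v0; have h := pdistE u0 v0; split=> e.
  by rewrite e Rmult_0_l in h; apply/(abs_eq0 absP).
by rewrite /pdist e abs0 // /Rdiv Rmult_0_l.
Qed.

Lemma pdist_gt0 u v : u != 0 -> v != 0 -> (0 < pdist u v)%Re <-> wedge u v <> 0.
Proof.
by move=> u0 v0; have := pdist_eq0 u0 v0; have := pdist_ge0 u v => ? [h1 h2]; split;
  [move=> h /h2; lra | move=> h; case: (Req_dec (pdist u v) 0) => [/h1 //|]; lra].
Qed.

(* In the sup norm the triangle inequality holds with constant one, because
   (u ^ w) v = (u ^ v) w + (v ^ w) u. *)
Lemma pdist_tri u v w : u != 0 -> v != 0 -> w != 0 -> (pdist u w <= pdist u v + pdist v w)%Re.
Proof.
move=> u0 v0 w0; apply: pdist_le => //.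
have pu := nv_gt0 u0; have pv := nv_gt0 v0; have pw := nv_gt0 w0.
apply: (Rmult_le_reg_r (nv v)) => //.
have -> : ((pdist u v + pdist v w) * (nv u * nv w) * nv v =
  pdist u v * (nv u * nv v) * nv w + pdist v w * (nv v * nv w) * nv u)%Re by lra.
rewrite !pdistE //.
have [u1 u2] := nv_ge u; have [w1 w2] := nv_ge w.
have a1 := abs_ge0 absP (wedge u v); have a2 := abs_ge0 absP (wedge v w).
have a3 := abs_ge0 absP (wedge u w).
have H x y z : wedge u w * x = wedge u v * y + wedge v w * z ->
    (abs y <= nv w)%Re -> (abs z <= nv u)%Re ->
    (abs (wedge u w) * abs x <= abs (wedge u v) * nv w + abs (wedge v w) * nv u)%Re.
  move=> E hy hz; rewrite -absM // E; apply: Rle_trans (absD absP _ _) _.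
  by rewrite !absM //; apply: Rplus_le_compat; apply: Rmult_le_compat_l.
rewrite [nv v]/nv; apply: (Rmax_case_strong (abs v.1) (abs v.2) (fun x =>
  abs (wedge u w) * x <= abs (wedge u v) * nv w + abs (wedge v w) * nv u)%Re) => _.
  by apply: H w1 u1; rewrite /wedge; ring.
by apply: H w2 u2; rewrite /wedge; ring.
Qed.

(** The numerator is invariant under [g], and each norm shrinks by a factor of at most [2 * C]. *)
Lemma pdist_lip g C u v : \det g = 1 -> bdd g C -> u != 0 -> v != 0 ->
  (pdist (mv g u) (mv g v) <= 4 * C * C * pdist u v)%Re.
Proof.
move=> dg gC u0 v0; apply: pdist_le; rewrite ?mv_neq0 // wedge_mv dg mul1r -pdistE //.
have C0 := bdd_ge0 gC; have d0 := pdist_ge0 u v.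
have hu := nv_mv_ge u dg gC; have hv := nv_mv_ge v dg gC.
have pu := nv_gt0 u0; have pv := nv_gt0 v0.
have h : (nv u * nv v <= (2 * C * nv (mv g u)) * (2 * C * nv (mv g v)))%Re.
  by apply: Rmult_le_compat; lra.
apply: Rle_trans (Rmult_le_compat_l _ _ _ d0 h) _; lra.
Qed.

Definition pair_of u (i : 'I_2) : k := if i == 0 then u.1 else u.2.

(** A vector spanning the kernel of the row vector [u], when [u] is nonzero. *)
Definition ker_of u : k * k := (- u.2, u.1).

Lemma nv_ker u : nv (ker_of u) = nv u.
Proof. by rewrite /nv /= absN // Rmax_comm. Qed.

Lemma wedge_ker u v : wedge v (ker_of u) = u.1 * v.1 + u.2 * v.2.
Proof. by rewrite /wedge /=; ring. Qed.

(* With e the largest entry of g, the error g - e a r^T has a single nonzero entry, which is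
   +-1/e because det g = 1. *)
Lemma rank_one_approx g : \det g = 1 -> exists (e : k) a r E,
  [/\ e <> 0 /\ bdd g (abs e), nv a = 1%Re, nv r = 1%Re, bdd E 1 &
  forall i j, g i j = e * (pair_of a i * pair_of r j) + e^-1 * E i j].
Proof.
move=> dg; have dg' := dg; rewrite det_mx2 in dg'.
have [i0 [j0 max]] : exists i0 j0, forall i j, (abs (g i j) <= abs (g i0 j0))%Re.
  have row i : exists j0, forall j, (abs (g i j) <= abs (g i j0))%Re.
    have [h|h] := Rle_dec (abs (g i 0)) (abs (g i 1)).
      by exists 1; apply: ord2P => //; lra.
    by exists 0; apply: ord2P => //; lra.
  have [j0 h0] := row 0; have [j1 h1] := row 1.
  have [h|h] := Rle_dec (abs (g 0 j0)) (abs (g 1 j1)).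
    by exists 1, j1; apply: ord2P => j //; have := h0 j; lra.
  by exists 0, j0; apply: ord2P => j //; have := h1 j; lra.
have e0 : g i0 j0 != 0.
  apply/eqP => e0; have z i j : g i j = 0.
    apply/(abs_eq0 absP); have := max i j; rewrite e0 abs0 //.
    by have := abs_ge0 absP (g i j); lra.
  by move: dg'; rewrite !z mul0r subr0 => /esym/eqP; rewrite oner_eq0.
have b1 : bdd (mk2 0 0 0 1 : 'M[k]_2) 1 /\ bdd (mk2 0 0 (-1) 0 : 'M[k]_2) 1 /\
          bdd (mk2 0 (-1) 0 0 : 'M[k]_2) 1 /\ bdd (mk2 1 0 0 0 : 'M[k]_2) 1.
  by do !split; do 2!apply: ord2P; rewrite mk2E ?absN // ?abs0 ?abs1 //; lra.
case: b1 => b1 [b2 [b3 b4]].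
have q1 x y : (abs x <= abs y)%Re -> y != 0 -> (abs (x / y) <= 1)%Re.
  move=> h /eqP y0; rewrite absM // absV //; have p := abs_gt0 absP y0.
  by apply: (Rmult_le_reg_r (abs y)) => //; rewrite Rmult_assoc Rinv_l; lra.
have n1 x : (abs x <= 1)%Re -> nv (1, x) = 1%Re.
  by move=> h; rewrite /nv /= abs1 // Rmax_left.
have n2 x : (abs x <= 1)%Re -> nv (x, 1) = 1%Re.
  by move=> h; rewrite /nv /= abs1 // Rmax_right.
pose e := g i0 j0.
have m i j : (abs (g i j / e) <= 1)%Re by apply: q1.
have cell (x y z s : k) : e != 0 -> x * e - y * z = s -> x = e * (y / e * (z / e)) + e^-1 * s.
  by move=> e0' <-; field.
have one (x : k) : e != 0 -> x = e * (x / e * 1) + e^-1 * 0 by move=> ?; field.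
have one' (x : k) : e != 0 -> x = e * (1 * (x / e)) + e^-1 * 0 by move=> ?; field.
have id1 : e = e * (1 * 1) + e^-1 * 0 by ring.
(* The four cases are the positions of the largest entry; the error sits in the opposite corner. *)
move: i0 j0 @e e0 max m cell one one' id1; apply: ord2P; apply: ord2P => e e0 max m cell one one' id1;
  exists e.
- exists (1, g 1 0 / e), (1, g 0 1 / e), (mk2 0 0 0 1).
  split; [by split=> //; exact/eqP|exact: n1|exact: n1|done|].
  do 2!apply: ord2P; rewrite mk2E /pair_of /=; [exact: id1|exact: one'|exact: one|].
  by apply: cell => //; rewrite /e -dg'; ring.
- exists (1, g 1 1 / e), (g 0 0 / e, 1), (mk2 0 0 (-1) 0).
  split; [by split=> //; exact/eqP|exact: n1|exact: n2|done|].
  do 2!apply: ord2P; rewrite mk2E /pair_of /=; [exact: one'|exact: id1| |exact: one].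
  by apply: cell => //; rewrite /e -dg'; ring.
- exists (g 0 0 / e, 1), (1, g 1 1 / e), (mk2 0 (-1) 0 0).
  split; [by split=> //; exact/eqP|exact: n2|exact: n1|done|].
  do 2!apply: ord2P; rewrite mk2E /pair_of /=; [exact: one| |exact: id1|exact: one'].
  by apply: cell => //; rewrite /e -dg'; ring.
- exists (g 0 1 / e, 1), (g 1 0 / e, 1), (mk2 1 0 0 0).
  split; [by split=> //; exact/eqP|exact: n2|exact: n2|done|].
  do 2!apply: ord2P; rewrite mk2E /pair_of /=; [ |exact: one|exact: one'|exact: id1].
  by apply: cell => //; rewrite /e -dg'; ring.
Qed.

End ProjectiveMetric.

(** * Unbounded and bounded sequences of matrices *)

Section Sequences.
Variables (k : fieldType) (abs : k -> R).
Hypothesis absP : is_abs_value abs.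
Implicit Types (g h f : 'M[k]_2) (u v w : k * k).
Local Notation nv := (nv abs).
Local Notation bdd := (bdd abs).
Local Notation pdist := (pdist abs).

Definition near u v (e : R) := (abs (u.1 - v.1)%R < e)%Re /\ (abs (u.2 - v.2)%R < e)%Re.

Lemma nv_sub u v : wedge u v = wedge (u - v) v.
Proof. by rewrite /wedge /=; ring. Qed.

Lemma nv_near u v e : near u v e -> (nv u < nv v + e)%Re.
Proof.
move=> [/abs_near - /(_ absP) h1 /abs_near - /(_ absP) h2]; have [v1 v2] := nv_ge abs v.
by apply: Rmax_lub_lt; lra.
Qed.

Lemma nv_near_sub u v e : near u v e -> (nv (u - v)%R <= e)%Re.
Proof. by move=> [h1 h2]; apply: nv_le; left. Qed.

Lemma near_sym u v e : near u v e -> near v u e.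
Proof. by case=> h1 h2; split; rewrite absB. Qed.

Lemma near_ker u v e : near u v e -> near (ker_of u) (ker_of v) e.
Proof. by case=> h1 h2; split=> //=; rewrite -opprD absN. Qed.

Lemma pdist_near u v e : nv u = 1%Re -> nv v = 1%Re -> near u v e -> (pdist u v <= 2 * e)%Re.
Proof.
move=> nu nw h; rewrite /pdist nu nw nv_sub /Rdiv Rmult_1_r Rinv_1 Rmult_1_r.
by have := abs_wedge absP (u - v) v; have := nv_near_sub h; rewrite nw; lra.
Qed.

Definition rank_one_form g (e : k) u v (E : 'M[k]_2) :=
  [/\ e <> 0, nv u = 1%Re, nv v = 1%Re, bdd E 1 &
  forall i j, g i j = e * (pair_of u i * pair_of v j) + e^-1 * E i j].

(** Here [g x = e t u + e^-1 E x] with [abs t] at least [eta * nv x]. Only the error contributes to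
    the wedge with [u], whereas the main term makes the norm of [g x] large. *)
Lemma rank_one_collapse g e u v E x eta : rank_one_form g e u v E -> \det g = 1 -> x != 0 ->
  (0 < eta)%Re -> (eta <= pdist x (ker_of v))%Re -> (2 < eta * (abs e * abs e))%Re ->
  (pdist (mv g x) u * (eta * (abs e * abs e) - 2) <= 4)%Re.
Proof.
move=> [e0 nu nw E1 gE] dg x0 eta0 hx he.
have px := nv_gt0 absP x0; have pe := abs_gt0 absP e0.
pose t := wedge x (ker_of v).
have gx1 : (mv g x).1 = e * t * u.1 + e^-1 * (mv E x).1.
  by rewrite /mv /= !gE /t wedge_ker /pair_of /=; ring.
have gx2 : (mv g x).2 = e * t * u.2 + e^-1 * (mv E x).2.
  by rewrite /mv /= !gE /t wedge_ker /pair_of /=; ring.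
have tE : (abs t = pdist x (ker_of v) * nv x)%Re.
  rewrite /t -(pdistE absP) //; first by rewrite nv_ker // nw; lra.
  by apply: (nv_neq0 absP); rewrite nv_ker.
have Ex := nv_mv absP x E1.
have [Ex1 Ex2] := nv_ge abs (mv E x).
have ht : (eta * nv x <= abs t)%Re by rewrite tE; apply: Rmult_le_compat_r; lra.
have low (y ui Ei : k) : y = e * t * ui + e^-1 * Ei -> abs ui = 1%Re ->
    (abs Ei <= 2 * nv x)%Re -> (abs e * (eta * nv x) - / abs e * (2 * nv x) <= abs y)%Re.
  move=> yE ui1 hE.
  have := absD absP y (- (e^-1 * Ei)); rewrite {1}yE addrK absN // !absM // absV // ui1.
  have := Rmult_le_compat_l (abs e) _ _ (Rlt_le _ _ pe) ht.
  have := Rmult_le_compat_l (/ abs e) _ _ (Rlt_le _ _ (Rinv_0_lt_compat _ pe)) hE.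
  by lra.
have ngx : (abs e * (eta * nv x) - / abs e * (2 * nv x) <= nv (mv g x))%Re.
  have [n1 n2] := nv_ge abs (mv g x).
  move: (nu : Rmax (abs u.1) (abs u.2) = 1%Re); apply: (Rmax_case_strong (abs u.1) (abs u.2) (fun y => y = 1%Re -> _)).
    by move=> _ u1; apply: Rle_trans n1; apply: (low _ _ _ gx1) => //; lra.
  by move=> _ u1; apply: Rle_trans n2; apply: (low _ _ _ gx2) => //; lra.
have gx0 : mv g x != 0 by exact: mv_neq0.
have u0 : u != 0 by exact: (nv_neq0 absP).
have W : wedge (mv g x) u = e^-1 * wedge (mv E x) u.
  by rewrite /wedge gx1 gx2; ring.
have hW : (abs (wedge (mv g x) u) <= / abs e * (4 * nv x))%Re.
  rewrite W absM // absV //; apply: Rmult_le_compat_l.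
    by left; exact: Rinv_0_lt_compat.
  by have := abs_wedge absP (mv E x) u; rewrite nu; lra.
have d0 := pdist_ge0 absP (mv g x) u.
rewrite -(pdistE absP) // nu Rmult_1_r in hW.
have h1 := Rmult_le_compat_l _ _ _ d0 ngx.
have h2 : (pdist (mv g x) u * (abs e * (eta * nv x) - / abs e * (2 * nv x))
   <= / abs e * (4 * nv x))%Re by lra.
have h3 := Rmult_le_compat_l (abs e) _ _ (Rlt_le _ _ pe) h2.
have ee : (abs e * / abs e = 1)%Re by apply: Rinv_r; lra.
apply: (Rmult_le_reg_r (nv x)) => //.
have -> : (4 * nv x = abs e * (/ abs e * (4 * nv x)))%Re by rewrite -Rmult_assoc ee; lra.
apply: Rle_trans h3; right.
have -> : (abs e * (pdist (mv g x) u * (abs e * (eta * nv x) - / abs e * (2 * nv x))) =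
  pdist (mv g x) u * (abs e * abs e * (eta * nv x) - (abs e * / abs e) * (2 * nv x)))%Re by lra.
by rewrite ee; lra.
Qed.

Hypothesis nontriv : nontrivial_abs abs.
Hypothesis lc : locally_compact abs.

(** The unit vectors of the rank one approximations have coordinates bounded by 1, so a subsequence
    of them converges; [e n] is large because it bounds the entries. *)
Lemma rank_one_limit (s : nat -> 'M[k]_2) : (forall n, \det (s n) = 1) ->
  (forall n, ~ bdd (s n) (INR n)) ->
  exists (phi : nat -> nat) (e : nat -> k) (u v : nat -> k * k) (E : nat -> 'M[k]_2) a r,
    [/\ forall n, (phi n < phi n.+1)%N,
        forall n, rank_one_form (s (phi n)) (e n) (u n) (v n) (E n),
        forall n, (INR n < abs (e n))%Re, nv a = 1%Re /\ nv r = 1%Re &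
        forall eps, (0 < eps)%Re -> exists N, forall n, (N <= n)%N ->
          near (u n) a eps /\ near (v n) r eps].
Proof.
move=> ds ub.
have [e He] := choice (fun n => rank_one_approx absP (ds n)).
have [u Hu] := choice He; have [v Hv] := choice Hu; have [E HE] := choice Hv.
have nv1 w : nv w = 1%Re -> (abs w.1 <= 1)%Re /\ (abs w.2 <= 1)%Re.
  by move=> w1; have [] := nv_ge abs w; rewrite w1.
pose c (bc : bool * bool) n :=
  let w := if bc.1 then u n else v n in if bc.2 then w.1 else w.2.
have [[b b'] n|phi [l [mono cv]]] := @bounded_subseq_fin _ _ absP nontriv lc _ c 1%Re.
  by case: (HE n) => _ /nv1 [? ?] /nv1 [? ?] _ _; case: b; case: b'.
pose a := (l (true, true), l (true, false)); pose r := (l (false, true), l (false, false)).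
have cv' eps : (0 < eps)%Re -> exists N, forall n, (N <= n)%N ->
    near (u (phi n)) a eps /\ near (v (phi n)) r eps.
  move=> eps0; have [N hN] := converges_all cv eps0.
  exists N => n /hN H; do !split.
  - exact: (H (true, true)).
  - exact: (H (true, false)).
  - exact: (H (false, true)).
  - exact: (H (false, false)).
have lim1 w : (forall eps, (0 < eps)%Re -> exists x, nv x = 1%Re /\ near x w eps) -> nv w = 1%Re.
  move=> H; apply: Rle_antisym; apply: Rnot_lt_le => h.
    have [x [x1 /near_sym/nv_near]] := H (nv w - 1)%Re ltac:(lra); lra.
  have [x [x1 /nv_near]] := H (1 - nv w)%Re ltac:(lra); lra.
exists phi, (e \o phi), (u \o phi), (v \o phi), (E \o phi), a, r; split=> // [n|n|].
- by case: (HE (phi n)) => -[e0 _] *; split.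
- case: (HE (phi n)) => -[e0 be] _ _ _ _ /=.
  apply: Rnot_le_lt => h; apply: (ub (phi n)) => i j.
  apply: Rle_trans (be i j) (Rle_trans _ _ _ h _); apply: le_INR; apply/leP.
  exact: phi_ge.
- split; apply: lim1 => eps /cv' [N /(_ N (leqnn N)) [h1 h2]].
    by exists (u (phi N)); split=> //; case: (HE (phi N)).
  by exists (v (phi N)); split=> //; case: (HE (phi N)).
Qed.

Lemma INR_large (C : R) : exists N, forall n, (N <= n)%N -> (C < INR n)%Re.
Proof.
have [N hN] := INR_unbounded C; exists N => n /leP /le_INR; lra.
Qed.

(** The attracting point is the limit of the column vectors [u n], the repelling one the kernel of
    the limit of the row vectors [v n]. *)
Lemma seq_collapse (s : nat -> 'M[k]_2) : (forall n, \det (s n) = 1) ->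
  (forall n, ~ bdd (s n) (INR n)) ->
  exists (phi : nat -> nat) a r, [/\ forall n, (phi n < phi n.+1)%N, a != 0, r != 0 &
    forall e, (0 < e)%Re -> exists N, forall n, (N <= n)%N -> forall x, x != 0 ->
      (e <= pdist x r)%Re -> (pdist (mv (s (phi n)) x) a < e)%Re].
Proof.
move=> ds ub.
have [phi [e [u [v [E [a [r [mono form elarge [na nr] cv]]]]]]]] := rank_one_limit ds ub.
have a0 : a != 0 by exact: (nv_neq0 absP).
have r0 : ker_of r != 0 by apply: (nv_neq0 absP); rewrite nv_ker.
exists phi, a, (ker_of r); split=> // eps eps0.
have [N1 h1] := cv (eps / 8)%Re ltac:(lra).
(* This makes [eps / 2 * (abs (e n) * abs (e n)) - 2] exceed [32 / eps], whence a distance of at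
   most [eps / 8] to [u n]. *)
have [N2 h2] := INR_large (1 + (2 + 32 / eps) * (2 / eps))%Re.
exists (maxn N1 N2) => n; rewrite geq_max => /andP [n1 n2] x x0 hx.
have [nu nv'] := h1 n n1; have e1 := Rlt_trans _ _ _ (h2 n n2) (elarge n).
have [e0 u1 v1 E1 _] := form n.
have kv : ker_of (v n) != 0 by apply: (nv_neq0 absP); rewrite nv_ker.
have un0 : u n != 0 by exact: (nv_neq0 absP).
have dv : (pdist (ker_of (v n)) (ker_of r) <= 2 * (eps / 8))%Re.
  by apply: pdist_near; rewrite ?nv_ker //; exact: near_ker.
have hx' : (eps / 2 <= pdist x (ker_of (v n)))%Re.
  by have := pdist_tri absP x0 kv r0; lra.
have pi : (0 < / eps)%Re by exact: Rinv_0_lt_compat.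
have ie : (eps * / eps = 1)%Re by apply: Rinv_r; lra.
have big : (2 + 32 / eps < eps / 2 * (abs (e n) * abs (e n)))%Re.
  have q1 : (1 < abs (e n))%Re by rewrite /Rdiv in e1; nra.
  have q2 : ((2 + 32 / eps) * (2 / eps) < abs (e n) * abs (e n))%Re.
    by have := Rmult_lt_compat_r (abs (e n)) 1 (abs (e n)); lra.
  have := Rmult_lt_compat_l (eps / 2) _ _ ltac:(lra) q2.
  have -> : (eps / 2 * ((2 + 32 / eps) * (2 / eps)) = (2 + 32 / eps) * (eps * / eps))%Re.
    by rewrite /Rdiv; lra.
  by rewrite ie; lra.
have p32 : (0 < 32 / eps)%Re by rewrite /Rdiv; lra.
have := rank_one_collapse (form n) (ds _) x0 (Rdiv_lt_0_compat _ _ eps0 Rlt_0_2) hx' ltac:(lra).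
set q := pdist _ _ => hq.
have q0 : (0 <= q)%Re by exact: pdist_ge0.
have : (q * (32 / eps) <= 4)%Re.
  by apply: Rle_trans hq; apply: Rmult_le_compat_l => //; lra.
move=> /(Rmult_le_compat_r eps _ _ (Rlt_le _ _ eps0)).
have -> : (q * (32 / eps) * eps = 32 * q * (eps * / eps))%Re by rewrite /Rdiv; lra.
rewrite ie => hq'.
have gx0 : mv (s (phi n)) x != 0 by exact: mv_neq0.
have := pdist_tri absP gx0 un0 a0; rewrite -/q.
by have := pdist_near u1 na nu; lra.
Qed.

Definition tr2 g := g 0 0 + g 1 1.

Lemma tr2_bdd g h C : bdd g C -> bdd h 1 -> (abs (tr2 (g * h)) <= 4 * C)%Re.
Proof.
move=> gC h1; rewrite /tr2 !mul_mx2.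
have C0 := bdd_ge0 absP gC.
have H i j : (abs (g i j * h j i)%R <= C)%Re.
  rewrite absM //; have := Rmult_le_compat _ C _ 1 (abs_ge0 absP (g i j))
    (abs_ge0 absP (h j i)) (gC i j) (h1 j i); lra.
have D x y : (abs x <= 2 * C)%Re -> (abs y <= 2 * C)%Re -> (abs (x + y)%R <= 4 * C)%Re.
  by move=> ? ?; have := absD absP x y; lra.
have D' x y : (abs x <= C)%Re -> (abs y <= C)%Re -> (abs (x + y)%R <= 2 * C)%Re.
  by move=> ? ?; have := absD absP x y; lra.
by apply: D; apply: D'; apply: H.
Qed.

(** The trace of [f * s n] is about [e n] times the wedge of [f (u n)] and [ker_of (v n)]. By (NE)
    some [f] in [G] moves the attracting point off the repelling one, which keeps this wedge away
    from zero. *)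
Lemma large_trace (G : mset k) : is_subgroup G -> in_SL2 G -> unbounded abs G ->
  (forall u v, u != 0 -> v != 0 -> exists g, G g /\ wedge (mv g u) u <> 0 /\ wedge (mv g u) v <> 0) ->
  forall C, exists g, G g /\ (C < abs (tr2 g))%Re.
Proof.
move=> [G1 [GM GV]] GS Gu NE C.
have [|s hs] := @choice nat _ (fun n (g : 'M[k]_2) => G g /\ ~ bdd g (INR n)).
  move=> n; apply: contrapT => H; apply: Gu; exists (INR n) => g Gg i j.
  by apply: contrapT => h; apply: H; exists g; split=> // /(_ i j).
have ds n : \det (s n) = 1 by apply: GS; case: (hs n).
have ub n : ~ bdd (s n) (INR n) by case: (hs n).
have [phi [e [u [v [E [a [r [mono form elarge [na nr] cv]]]]]]]] := rank_one_limit ds ub.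
have a0 : a != 0 by exact: (nv_neq0 absP).
have r0 : ker_of r != 0 by apply: (nv_neq0 absP); rewrite nv_ker.
have [f [Gf [_ hf]]] := NE a (ker_of r) a0 r0.
have D0 := abs_gt0 absP hf; set D := abs _ in D0.
have [Cf fC] : exists Cf, bdd f Cf.
  exists (abs (f 0%R 0%R) + abs (f 0%R 1%R) + abs (f 1%R 0%R) + abs (f 1%R 1%R))%Re.
  have p i j := abs_ge0 absP (f i j).
  by do 2!apply: ord2P; have := p 0 0; have := p 0 1; have := p 1 0; have := p 1 1; lra.
have Cf0 := bdd_ge0 absP fC.
(* Replacing [u n] and [v n] by their limits costs at most [4 * Cf] times the error each, hence less
   than [D / 2] in total. *)
pose K := (8 * Cf + 1)%Re.
have [N1 h1] := cv (D / 2 / K)%Re ltac:(apply: Rdiv_lt_0_compat; rewrite /K; lra).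
have [N2 h2] := INR_large (1 + (Rmax C 0 + 4 * Cf) * (2 / D))%Re.
pose n := maxn N1 N2.
have [nu nv'] := h1 n (leq_maxl _ _).
have e1 := Rlt_trans _ _ _ (h2 n (leq_maxr _ _)) (elarge n).
have [e0 u1 v1 E1 gE] := form n.
exists (f * s (phi n)); split; first by apply: GM => //; case: (hs (phi n)).
set x := wedge (mv f (u n)) (ker_of (v n)).
have trE : tr2 (f * s (phi n)) = e n * x + (e n)^-1 * tr2 (f * E n).
  by rewrite /tr2 !mul_mx2 !gE /x /wedge /mv /pair_of /=; ring.
have xD : (D / 2 <= abs x)%Re.
  have -> : x = wedge (mv f a) (ker_of r) -
      (wedge (mv f (a - u n)) (ker_of (v n)) + wedge (mv f a) (ker_of (r - v n))).
    by rewrite /x /wedge /mv /=; ring.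
  have := abs_le_sub absP (wedge (mv f a) (ker_of r))
     (wedge (mv f (a - u n)) (ker_of (v n)) + wedge (mv f a) (ker_of (r - v n))).
  rewrite -/D; set y := wedge _ _; set z := wedge _ _ => h.
  have hy : (abs y <= 4 * Cf * nv (a - u n)%R)%Re.
    apply: Rle_trans (abs_wedge absP _ _) _; rewrite nv_ker // v1.
    by have := nv_mv absP (a - u n) fC; lra.
  have hz : (abs z <= 4 * Cf * nv (r - v n)%R)%Re.
    apply: Rle_trans (abs_wedge absP _ _) _; rewrite nv_ker //.
    have := nv_mv absP a fC; rewrite na => fa.
    have := Rmult_le_compat_r _ _ _ (nv_ge0 absP (r - v n)) fa; lra.
  have ha := nv_near_sub (near_sym nu); have hr := nv_near_sub (near_sym nv').
  have hK : (D / 2 / K * K = D / 2)%Re by rewrite /Rdiv Rmult_assoc Rinv_l /K; lra.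
  have q0 : (0 < D / 2 / K)%Re by apply: Rdiv_lt_0_compat; rewrite /K; lra.
  have k1 := Rmult_le_compat_l (4 * Cf) _ _ ltac:(lra) ha.
  have k2 := Rmult_le_compat_l (4 * Cf) _ _ ltac:(lra) hr.
  have := absD absP y z; rewrite {2}/K in hK; lra.
have C0 := Rmax_l C 0; have C1 := Rmax_r C 0.
have iD : (0 < 2 / D)%Re by apply: Rdiv_lt_0_compat; lra.
have q0 : (0 <= (Rmax C 0 + 4 * Cf) * (2 / D))%Re by apply: Rmult_le_pos; lra.
have ei : (/ abs (e n) <= 1)%Re by rewrite -Rinv_1; apply: Rinv_le_contravar; lra.
have ei0 : (0 < / abs (e n))%Re by apply: Rinv_0_lt_compat; lra.
have := abs_le_sub absP (e n * x) (- ((e n)^-1 * tr2 (f * E n))).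
rewrite opprK -trE absN // !absM // absV //.
have := tr2_bdd fC E1 => ht.
have t0 := abs_ge0 absP (tr2 (f * E n)).
have k3 : (/ abs (e n) * abs (tr2 (f * E n)) <= 4 * Cf)%Re.
  by have := Rmult_le_compat_r _ _ _ t0 ei; lra.
have k4 : (Rmax C 0 + 4 * Cf < abs (e n) * (D / 2))%Re.
  have := Rmult_lt_compat_r (D / 2) ((Rmax C 0 + 4 * Cf) * (2 / D)) (abs (e n)) ltac:(lra) ltac:(lra).
  have -> : ((Rmax C 0 + 4 * Cf) * (2 / D) * (D / 2) = (Rmax C 0 + 4 * Cf) * (D * / D))%Re.
    by rewrite /Rdiv; lra.
  by rewrite Rinv_r; lra.
have k5 := Rmult_le_compat_l (abs (e n)) _ _ (abs_ge0 absP _) xD.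
by lra.
Qed.

(** Along an entrywise convergent subsequence [s n] and [s m] move [q] to nearby points, and the
    inverse of [s n] is Lipschitz with constant [4 * C * C]. *)
Lemma bounded_return (s : nat -> 'M[k]_2) C : (forall n, \det (s n) = 1) ->
  (forall n, bdd (s n) C) -> forall q e, q != 0 -> (0 < e)%Re ->
  exists n, forall N, exists m, (N <= m)%N /\ (pdist (mv ((s n)^-1 * s m) q) q < e)%Re.
Proof.
move=> ds sC q e q0 e0.
have [|phi [l [mono cv]]] := @bounded_subseq_fin _ _ absP nontriv lc ('I_2 * 'I_2)%type
  (fun ij n => s n ij.1 ij.2) C; first by move=> [i j] n; apply: sC.
have C0 := bdd_ge0 absP (sC 0%N).
have C1 : (0 < C)%Re.
  apply: Rnot_le_lt => h.
  have z i j : s 0%N i j = 0.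
    by apply/(abs_eq0 absP); have := sC 0%N i j; have := abs_ge0 absP (s 0%N i j); lra.
  by move: (ds 0%N); rewrite det_mx2 !z mul0r subr0 => /esym/eqP; rewrite oner_eq0.
(* The two estimates multiply to [64 * C * C * C * (e / K)], which is [e / 2]. *)
pose K := (128 * C * C * C)%Re.
have K0 : (0 < K)%Re by rewrite /K; do !apply: Rmult_lt_0_compat; lra.
have [N hN] := converges_all cv (Rdiv_lt_0_compat _ _ e0 K0).
exists (phi N) => M; exists (phi (maxn N M)).
split; first by apply: leq_trans (leq_maxr N M) (phi_ge _ mono).
set g := s (phi N); set h := s (phi (maxn N M)).
have gh : bdd (h - g) (2 * (e / K)).
  move=> i j; rewrite !mxE.
  have h1 : (abs (h i j - l (i, j))%R < e / K)%Re := hN (maxn N M) (leq_maxl _ _) (i, j).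
  have h2 : (abs (l (i, j) - g i j)%R < e / K)%Re by rewrite absB //; exact: (hN N (leqnn N) (i, j)).
  have -> : h i j - g i j = (h i j - l (i, j)) + (l (i, j) - g i j) by rewrite addrA subrK.
  by apply: Rle_trans (absD absP _ _) _; lra.
have dg : \det g = 1 by exact: ds.
have dh : \det h = 1 by exact: ds.
have hq0 : mv h q != 0 by exact: mv_neq0.
have gq0 : mv g q != 0 by exact: mv_neq0.
have dg' : \det g^-1 = 1 by rewrite -[g^-1]/(invmx g) det_inv dg invr1.
have gC : bdd g C by exact: sC.
have W : (pdist (mv h q) (mv g q) <= 16 * C * (e / K))%Re.
  apply: pdist_le => //.
  have -> : wedge (mv h q) (mv g q) = wedge (mv (h - g) q) (mv g q).
    by rewrite /wedge /mv !mxE /=; ring.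
  apply: Rle_trans (abs_wedge absP _ _) _.
  have h1 := nv_mv absP q gh; have h2 := nv_mv_ge absP q dh (sC _).
  have p := nv_ge0 absP (mv g q).
  have q2 : (0 < e / K)%Re by exact: Rdiv_lt_0_compat.
  have h3 := Rmult_le_compat_l (4 * (e / K)) _ _ ltac:(lra) h2.
  have h4 : (nv (mv (h - g) q) <= 8 * C * (e / K) * nv (mv h q))%Re by lra.
  have := Rmult_le_compat_r _ _ _ p h4; lra.
have E : q = mv g^-1 (mv g q) by rewrite mvK.
rewrite mvM {2}E.
have := pdist_lip absP dg' (bdd_inv absP dg gC) hq0 gq0.
have h3 := Rmult_le_compat_l (4 * C * C) _ _ ltac:(apply: Rmult_le_pos; lra) W.
have KE : (K * (e / K) = e)%Re by rewrite /Rdiv -Rmult_assoc (Rmult_comm K) Rmult_assoc Rinv_r; lra.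
have : (4 * C * C * (16 * C * (e / K)) * 2 = e)%Re by rewrite -[RHS]KE {2}/K; lra.
by lra.
Qed.

End Sequences.

(** * The convergence action of a matrix group *)

Section MatrixGroup.
Variables (k : fieldType) (G : mset k) (Ggrp : is_subgroup G) (GS : in_SL2 G).

(** The boolean reflection of [G] makes this a subtype; the two proofs are arguments so that the
    group structure can be attached to the type. *)
Definition group_of of is_subgroup G & in_SL2 G := {g : 'M[k]_2 | `[< G g >]}.
Local Notation T := (group_of Ggrp GS).

HB.instance Definition _ := Choice.copy T {g : 'M[k]_2 | `[< G g >]}.

Definition group_elt g (Gg : G g) : T := exist (fun g => is_true `[< G g >]) g (asboolT Gg).
Definition elt (x : T) : 'M[k]_2 := sval x.

Lemma elt_in x : G (elt x).
Proof. exact/asboolP/(svalP x). Qed.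

Lemma elt_inj : injective elt.
Proof. exact: val_inj. Qed.

Definition group_one : T := group_elt (proj1 Ggrp).
Definition group_mul (x y : T) : T :=
  group_elt (proj1 (proj2 Ggrp) _ _ (elt_in x) (elt_in y)).
Definition group_inv (x : T) : T := group_elt (proj2 (proj2 Ggrp) _ (elt_in x)).

Lemma elt_unit x : elt x \is a GRing.unit.
Proof. exact/det1_unit/GS/elt_in. Qed.

Lemma group_mulA : associative group_mul.
Proof. by move=> x y z; apply: elt_inj; rewrite /elt /= mulrA. Qed.
Lemma group_mul1 : left_id group_one group_mul.
Proof. by move=> x; apply: elt_inj; rewrite /elt /= mul1r. Qed.
Lemma group_1mul : right_id group_one group_mul.
Proof. by move=> x; apply: elt_inj; rewrite /elt /= mulr1. Qed.
Lemma group_mulV : left_inverse group_one group_inv group_mul.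
Proof. by move=> x; apply: elt_inj; rewrite /elt /= mulVr ?elt_unit. Qed.
Lemma group_mulV' : right_inverse group_one group_inv group_mul.
Proof. by move=> x; apply: elt_inj; rewrite /elt /= divrr ?elt_unit. Qed.

HB.instance Definition _ :=
  isGroup.Build T group_mulA group_mul1 group_1mul group_mulV group_mulV'.

Definition line := {u : k * k | u != 0}.

Lemma elt_det x : \det (elt x) = 1.
Proof. exact/GS/elt_in. Qed.

Definition line_act (x : T) (p : line) : line :=
  exist (fun u => is_true (u != 0)) (mv (elt x) (sval p)) (mv_neq0 (elt_det x) (svalP p)).

(** This is (NE), with equality of points of the projective line expressed by [wedge]. *)
Definition nonelementary := forall u v : k * k, u != 0 -> v != 0 ->
  exists g, G g /\ wedge (mv g u) u <> 0 /\ wedge (mv g u) v <> 0.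

Variable abs : k -> R.
Hypothesis lf : local_field abs.

Let absP : is_abs_value abs. Proof. by case: lf. Qed.
Let nontriv : nontrivial_abs abs. Proof. by case: lf => _ []. Qed.
Let lc : locally_compact abs. Proof. by case: lf => _ []. Qed.

Lemma entries_bdd (g : 'M[k]_2) : exists C, bdd abs g C.
Proof.
exists (abs (g 0%R 0%R) + abs (g 0%R 1%R) + abs (g 1%R 0%R) + abs (g 1%R 1%R))%Re.
have p i j := abs_ge0 absP (g i j).
by do 2!apply: ord2P; have := p 0 0; have := p 0 1; have := p 1 0; have := p 1 1; lra.
Qed.

(** If large entries occur arbitrarily late, a subsequence contracts; otherwise a tail is bounded
    and returns. *)
Lemma line_conv (s : nat -> T) : injective s ->
  (exists a r : line, forall e, (0 < e)%Re -> forall N, exists n, (N <= n)%N /\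
     forall x : line, (e <= pdist abs (sval x) (sval r))%Re ->
       (pdist abs (sval (line_act (s n) x)) (sval a) < e)%Re) \/
  (forall (q : line) e, (0 < e)%Re -> exists n, forall N, exists m, (N <= m)%N /\
     (pdist abs (sval (line_act ((s n)^-1 * s m)%g q)) (sval q) < e)%Re).
Proof.
move=> si.
have [H|H] := pselect (forall (C : R) N, exists n, (N <= n)%N /\ ~ bdd abs (elt (s n)) C).
  left; have [t ht] := choice (fun n => H (INR n) n).
  have [||phi [a [r [mono a0 r0 C]]]] := @seq_collapse _ _ absP nontriv lc (elt \o (s \o t)).
  - by move=> n; exact: elt_det.
  - by move=> n; case: (ht n).
  exists (exist (fun u => is_true (u != 0)) a a0), (exist (fun u => is_true (u != 0)) r r0).
  move=> e e0 N; have [M hM] := C e e0.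
  exists (t (phi (maxn M N))); split.
    apply: leq_trans (proj1 (ht _)); apply: leq_trans (phi_ge _ mono); exact: leq_maxr.
  by move=> [x x0] /= hx; apply: hM => //; exact: leq_maxl.
right; have [C [N HC]] : exists (C : R) N, forall n, bdd abs (elt (s (N + n)%N)) C.
  apply: contrapT => H'; apply: H => C N; apply: contrapT => H''; apply: H'.
  exists C, N => n; apply: contrapT => nb; apply: H''.
  by exists (N + n)%N; rewrite leq_addr.
move=> [q q0] e e0.
have [||n hn] := @bounded_return _ _ absP nontriv lc (fun n => elt (s (N + n)%N)) C _ _ q e q0 e0.
- by move=> n; exact: elt_det.
- exact: HC.
exists (N + n)%N => M; have [m [Mm hm]] := hn M; exists (N + m)%N; split=> //.
exact: leq_trans Mm (leq_addl _ _).
Qed.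

Lemma line_collapsing : unbounded abs G -> exists a r : line, forall e, (0 < e)%Re ->
  exists g : T, forall x : line, (e <= pdist abs (sval x) (sval r))%Re ->
    (pdist abs (sval (line_act g x)) (sval a) < e)%Re.
Proof.
move=> Gu; have [|s hs] := @choice nat T (fun n g => ~ bdd abs (elt g) (INR n)).
  move=> n; apply: contrapT => H; apply: Gu; exists (INR n) => g Gg i j.
  by apply: contrapT => h; apply: H; exists (group_elt Gg) => /(_ i j).
have [|//|phi [a [r [mono a0 r0 C]]]] := @seq_collapse _ _ absP nontriv lc (elt \o s).
  by move=> n; exact: elt_det.
exists (exist (fun u => is_true (u != 0)) a a0), (exist (fun u => is_true (u != 0)) r r0).
move=> e e0; have [M hM] := C e e0.
by exists (s (phi M)) => -[x x0] /= hx; apply: hM.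
Qed.

Theorem nonelementary_highly_transitive : countable_set G -> center_free G ->
  unbounded abs G -> nonelementary -> highly_transitive G.
Proof.
move=> [code hcode] cf Gu NE.
pose d (x y : line) := pdist abs (sval x) (sval y).
have d_ge0 x y : (0 <= d x y)%Re by exact: pdist_ge0.
have d_refl x : d x x = 0%Re by exact: pdist_refl.
have d_sym x y : d x y = d y x by exact: pdist_sym.
have d_tri x y z : (d x z <= d x y + d y z)%Re.
  exact: (pdist_tri absP (svalP x) (svalP y) (svalP z)).
have act1 x : line_act 1%g x = x by apply: val_inj; rewrite /= mv1.
have actM g h x : line_act (g * h)%g x = line_act g (line_act h x).
  by apply: val_inj; rewrite /= mvM.
have act_lip g : exists C, (0 < C)%Re /\
    forall x y, (d (line_act g x) (line_act g y) <= C * d x y)%Re.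
  have [C hC] := entries_bdd (elt g).
  exists (4 * (C + 1) * (C + 1))%Re; have C0 := bdd_ge0 absP hC.
  split; first by nra.
  move=> [x x0] [y y0]; apply: pdist_lip => //; first exact: elt_det.
  by move=> i j; have := hC i j; lra.
have fix3 (g : T) x y z : (0 < d x y)%Re -> (0 < d x z)%Re -> (0 < d y z)%Re ->
    d (line_act g x) x = 0%Re -> d (line_act g y) y = 0%Re ->
    d (line_act g z) z = 0%Re -> g = 1%g.
  case: x y z => x x0 [y y0] [z z0].
  move=> /(pdist_gt0 absP x0 y0) hxy /(pdist_gt0 absP x0 z0) hxz /(pdist_gt0 absP y0 z0) hyz.
  have m u (u0 : u != 0) := pdist_eq0 absP (mv_neq0 (elt_det g) u0) u0.
  move=> /(m _ x0) hx /(m _ y0) hy /(m _ z0) hz.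
  (* Three fixed lines make [g] scalar, hence central in [G]. *)
  have E := three_fixed hxy hxz hyz hx hy hz.
  apply: elt_inj; apply: cf; first exact: elt_in.
  by move=> h _; rewrite E -!mulmxE scalar_mxC.
have nonelem p q : exists g, (0 < d (line_act g p) p)%Re /\ (0 < d (line_act g p) q)%Re.
  case: p q => p p0 [q q0]; have [g [Gg [h1 h2]]] := NE p q p0 q0.
  have gp : mv g p != 0 by apply: mv_neq0 => //; exact: GS.
  by exists (group_elt Gg); split; apply/(pdist_gt0 absP).
have code_inj : injective (code \o elt).
  by move=> x y /(hcode _ _ (elt_in x) (elt_in y)) /elt_inj.
have [Y [ac [ac1 acM faith HT]]] := convergence_highly_transitive d_ge0 d_refl d_sym d_tri
  act1 actM act_lip fix3 nonelem (line_collapsing Gu) line_conv code_inj.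
(* The action has to be defined on all matrices; outside [G] it is the identity. *)
exists Y, (fun g y => if pselect (G g) is left Gg then ac (group_elt Gg) y else y).
have acE g (Gg : G g) y : (if pselect (G g) is left Gg then ac (group_elt Gg) y else y)
    = ac (group_elt Gg) y.
  case: pselect => // Gg'; congr (ac _ y); exact: elt_inj.
split; [|split; [|split]].
- move=> y; rewrite (acE _ (proj1 Ggrp)) -[RHS]ac1; congr (ac _ y); exact: elt_inj.
- move=> g h y Gg Gh; have Ggh := proj1 (proj2 Ggrp) _ _ Gg Gh.
  rewrite (acE _ Ggh) (acE _ Gg) (acE _ Gh) -acM; congr (ac _ y); exact: elt_inj.
- move=> g Gg H; suff /(congr1 elt) : group_elt Gg = 1%g by [].
  by apply: faith => y; rewrite -[RHS](H y) (acE _ Gg).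
- move=> n u v ui vi; have [g hg] := HT n u v ui vi.
  exists (elt g); split=> [|i]; first exact: elt_in.
  by rewrite (acE _ (elt_in g)) -hg; congr (ac _ _); exact: elt_inj.
Qed.

End MatrixGroup.

(** * Elementary subgroups *)

Section Elementary.
Variable k : fieldType.
Implicit Types (g h m n : 'M[k]_2) (u v w : k * k).

Lemma complement u : u != 0 -> exists w, wedge u w <> 0.
Proof.
case: u => x y; rewrite -pair_eqE /= negb_and => /orP [/eqP x0|/eqP y0].
  by exists (0, 1); rewrite /wedge /= mulr1 mulr0 subr0.
by exists (1, 0); rewrite /wedge /= mulr0 mulr1 sub0r => /eqP; rewrite oppr_eq0 => /eqP.
Qed.

Lemma wedge0_scale u w : u != 0 -> wedge w u = 0 -> exists c, w = (c * u.1, c * u.2).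
Proof.
case: u w => x y [x' y']; rewrite -pair_eqE /= negb_and /wedge /=.
move=> /orP [x0|y0] /eqP; rewrite subr_eq0 => /eqP E.
  exists (x' / x); congr pair; first by rewrite divfK.
  by apply: (mulIf x0); rewrite -E; field.
exists (y' / y); congr pair; last by rewrite divfK.
by apply: (mulIf y0); rewrite E; field.
Qed.

Lemma mv_scale g c u : mv g (c * u.1, c * u.2) = (c * (mv g u).1, c * (mv g u).2).
Proof. by rewrite /mv /=; congr pair; ring. Qed.

Lemma mv_ext g h u w : wedge u w <> 0 -> mv g u = mv h u -> mv g w = mv h w -> g = h.
Proof.
move=> /eqP D [a1 a2] [b1 b2].
have key (x y x' y' : k) : x * u.1 + y * u.2 = x' * u.1 + y' * u.2 ->
    x * w.1 + y * w.2 = x' * w.1 + y' * w.2 -> x = x' /\ y = y'.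
  move=> e1 e2; split; apply: (mulIf D).
    have -> : x * wedge u w = (x * u.1 + y * u.2) * w.2 - (x * w.1 + y * w.2) * u.2.
      by rewrite /wedge; ring.
    by rewrite e1 e2 /wedge; ring.
  have -> : y * wedge u w = (x * w.1 + y * w.2) * u.1 - (x * u.1 + y * u.2) * w.1.
    by rewrite /wedge; ring.
  by rewrite e1 e2 /wedge; ring.
have [e1 e2] := key _ _ _ _ a1 b1; have [e3 e4] := key _ _ _ _ a2 b2.
exact: mx2P.
Qed.

Lemma commutator_sub (M N K : mset k) : is_subgroup K ->
  (forall m n, M m -> N n -> K (commutator m n)) -> subset_of (commutator_subgroup M N) K.
Proof. by move=> KG H x; apply=> // y [m [n [Mm [Nn ->]]]]; apply: H. Qed.

Lemma commutator_eq m n : \det m = 1 -> \det n = 1 -> commutator m n = (n * m)^-1 * (m * n).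
Proof.
by move=> /det1_unit um /det1_unit un; rewrite /commutator invrM // !mulrA.
Qed.

Lemma det_inv1 g : \det g = 1 -> \det g^-1 = 1.
Proof. by move=> h; rewrite -[g^-1]/(invmx g) det_inv h invr1. Qed.

Lemma det_mul1 g h : \det g = 1 -> \det h = 1 -> \det (g * h) = 1.
Proof. by move=> h1 h2; rewrite -mulmxE det_mulmx h1 h2 mulr1. Qed.

Lemma fix_line_inv g u : \det g = 1 -> wedge (mv g u) u = 0 -> wedge (mv g^-1 u) u = 0.
Proof.
move=> dg h; have := wedge_mv g (mv g^-1 u) u.
by rewrite dg mul1r -mvM divrr ?det1_unit // mv1 wedgeC h oppr0.
Qed.

(** Commutators fix [u], because scalars commute. Matrices of determinant one fixing [u] shift a
    complementary vector [w] by multiples of [u], so they commute. *)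
Lemma line_stabilizer_solvable (H : mset k) u : u != 0 -> in_SL2 H ->
  (forall g, H g -> wedge (mv g u) u = 0) -> solvable_set H.
Proof.
move=> u0 HS Hu; exists 2.
pose P : mset k := fun g => \det g = 1 /\ mv g u = u.
have PG : is_subgroup P.
  split; first by split; [exact: det1 | exact: mv1].
  split=> [g h [g1 gu] [h1 hu]|g [g1 gu]].
    by split; [exact: det_mul1 | rewrite mvM hu gu].
  by split; [exact: det_inv1 | rewrite -{1}gu mvK].
have D1 : subset_of (derived_series H 1) P.
  apply: commutator_sub => // m n Hm Hn.
  have dm := HS _ Hm; have dn := HS _ Hn.
  split.
    by rewrite commutator_eq // det_mul1 ?det_inv1 ?det_mul1.
  have [a ea] := wedge0_scale u0 (Hu _ Hm); have [b eb] := wedge0_scale u0 (Hu _ Hn).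
  have E : mv (m * n) u = mv (n * m) u.
    by rewrite !mvM eb mv_scale ea mv_scale eb; congr pair; rewrite /=; ring.
  by rewrite commutator_eq // mvM E mvK // det_mul1.
have [w hw] := complement u0.
have Pw g : P g -> exists c, mv g w = (w.1 + c * u.1, w.2 + c * u.2).
  move=> [dg gu]; have := wedge_mv g u w; rewrite dg mul1r gu => E.
  have [|c hc] := @wedge0_scale u (mv g w - w) u0.
    have -> : wedge (mv g w - w) u = wedge u w - wedge u (mv g w) by rewrite /wedge /=; ring.
    by rewrite E subrr.
  exists c; rewrite -[LHS](subrK w) hc; congr pair; exact: addrC.
apply: (@commutator_sub _ _ (fun x => x = 1)).
  by split=> //; split=> [g h -> ->|g ->]; rewrite ?mulr1 ?invr1.
move=> m n /D1 Pm /D1 Pn.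
have [[dm mu] [dn nu]] := (Pm, Pn).
suff E : m * n = n * m.
  by rewrite commutator_eq // E mulVr // det1_unit ?det_mul1.
apply: (mv_ext hw); first by rewrite !mvM mu nu mu.
have [a ea] := Pw _ Pm; have [b eb] := Pw _ Pn.
have shift g c x : mv g (x.1 + c * u.1, x.2 + c * u.2) =
    ((mv g x).1 + c * (mv g u).1, (mv g x).2 + c * (mv g u).2).
  by rewrite /mv /=; congr pair; ring.
by rewrite !mvM ea eb !shift mu nu ea eb /=; congr pair; ring.
Qed.

Lemma not_virtually_solvable_nonelementary (G : mset k) : is_subgroup G -> in_SL2 G ->
  ~ virtually_solvable G -> nonelementary G.
Proof.
move=> [G1 [GM GV]] GS nvs u v u0 v0; apply: contrapT => H; apply: nvs.
have orb g : G g -> wedge (mv g u) u = 0 \/ wedge (mv g u) v = 0.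
  move=> Gg; have [h1|h1] := pselect (wedge (mv g u) u = 0); first by left.
  right; apply: contrapT => h2; apply: H; exists g; by [].
pose S : mset k := fun g => G g /\ wedge (mv g u) u = 0.
exists S; split; last split.
- split; last by move=> g [].
  split; first by rewrite /S mv1 wedgevv.
  split=> [g h [Gg gu] [Gh hu]|g [Gg gu]].
    split; first exact: GM.
    rewrite mvM; have gu0 : mv g u != 0 by apply: mv_neq0 => //; exact: GS.
    by apply: wedge_trans gu0 _ gu; rewrite wedge_mv hu mulr0.
  by split; [exact: GV | apply: fix_line_inv => //; exact: GS].
- have [[g0 [Gg0 hg0]]|all] := pselect (exists g0, G g0 /\ wedge (mv g0 u) u <> 0); last first.
    exists [:: 1] => g Gg; exists 1; rewrite ?mem_head // invr1 mul1r; split=> //.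
    by apply: contrapT => h; apply: all; exists g.
  exists [:: 1; g0] => g Gg; have [h|h] := pselect (wedge (mv g u) u = 0).
    by exists 1; rewrite ?mem_head // invr1 mul1r.
  (* All elements outside the stabilizer send the line of [u] to that of [v], so [g0] represents the
     only other coset. *)
  exists g0; first by rewrite !inE eqxx orbT.
  split; first by apply: GM => //; apply: GV.
  have [//|hv] := orb g Gg; have [//|hv0] := orb g0 Gg0.
  have dg := GS _ Gg; have dg0 := GS _ Gg0.
  have E : wedge (mv g u) (mv g0 u) = 0.
    by apply: wedge_trans v0 hv _; rewrite wedgeC hv0 oppr0.
  have := wedge_mv g0^-1 (mv g u) (mv g0 u).
  by rewrite E mulr0 mvK // mvM.
- by apply: (@line_stabilizer_solvable _ u) => // [g [Gg _]|g []]; first exact: GS.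
Qed.

Definition wedge_form u w : {mpoly k[4]} :=
  (w.2 * u.1)%:MP * 'X_(inord 0) + (w.2 * u.2)%:MP * 'X_(inord 1)
  - ((w.1 * u.1)%:MP * 'X_(inord 2) + (w.1 * u.2)%:MP * 'X_(inord 3)).

Lemma mat_coordsE g : ((mat_coords g (inord 0) = g 0 0) * (mat_coords g (inord 1) = g 0 1)) *
  ((mat_coords g (inord 2) = g 1 0) * (mat_coords g (inord 3) = g 1 1)).
Proof.
have i0 : inord 0 = 0 :> 'I_2 by apply: val_inj; rewrite /= inordK.
have i1 : inord 1 = 1 :> 'I_2 by apply: val_inj; rewrite /= inordK.
by rewrite /mat_coords !inordK // /= -?i0 -?i1.
Qed.

Lemma wedge_formE u w g : (wedge_form u w).@[mat_coords g] = wedge (mv g u) w.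
Proof.
rewrite /wedge_form mevalB !mevalD !mevalM !mevalC !mevalXU !mat_coordsE.
by rewrite /wedge /mv /=; ring.
Qed.

Lemma zariski_dense_nonelementary (G : mset k) : zariski_dense_SL2 G -> nonelementary G.
Proof.
move=> Z u v u0 v0; apply: contrapT => H.
have orb g : G g -> wedge (mv g u) u = 0 \/ wedge (mv g u) v = 0.
  move=> Gg; have [h1|h1] := pselect (wedge (mv g u) u = 0); first by left.
  by right; apply: contrapT => h2; apply: H; exists g.
(* If [v] is proportional to [u], any vector independent of [u] can take its place. *)
have [w [huw ow]] : exists w, wedge u w <> 0 /\
    forall g, G g -> wedge (mv g u) u = 0 \/ wedge (mv g u) w = 0.
  have [uv|uv] := pselect (wedge u v = 0); last by exists v.
  have [w hw] := complement u0; exists w; split=> // g /orb [|h]; left=> //.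
  by apply: wedge_trans v0 h _; rewrite wedgeC uv oppr0.
pose c := (wedge u w)^-1.
have /eqP huw' := huw.
(* The transvection sending [x] to [x + c (x ^ w) w]; it takes [u] to [u + w], where both factors of
   the polynomial are nonzero. *)
pose t := mk2 (1 + c * w.2 * w.1) (- (c * w.1 * w.1)) (c * w.2 * w.2) (1 - c * w.1 * w.2).
have dt : \det t = 1 by rewrite det_mx2 !mk2E; ring.
have tu : mv t u = (u.1 + w.1, u.2 + w.2).
  rewrite /mv !mk2E /c; congr pair; move: huw'; rewrite /wedge => huw'; field; exact: huw'.
have := Z (wedge_form u u * wedge_form u w) _ t dt.
rewrite mevalM !wedge_formE tu => E.
have /eqP : wedge (u.1 + w.1, u.2 + w.2) u * wedge (u.1 + w.1, u.2 + w.2) w = 0.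
  by apply: E => g Gg; rewrite mevalM !wedge_formE; case: (ow g Gg) => ->; rewrite ?mul0r ?mulr0.
have -> : wedge (u.1 + w.1, u.2 + w.2) u = - wedge u w by rewrite /wedge /=; ring.
have -> : wedge (u.1 + w.1, u.2 + w.2) w = wedge u w by rewrite /wedge /=; ring.
by rewrite mulf_eq0 oppr_eq0 orbb (negbTE huw').
Qed.

End Elementary.

(** * Almost simple type and virtual solvability *)

Section Finiteness.
Variables (k : fieldType) (abs : k -> R) (G : mset k).
Hypotheses (lf : local_field abs) (Gu : unbounded abs G).

(** At most one element of [G] per label of a finite type leaves finitely many elements, so their
    entries would be bounded. *)
Lemma unbounded_infinite (I : finType) (Q : 'M[k]_2 -> I -> Prop) :
  (forall g, G g -> exists i, Q g i) ->
  (forall g h i, G g -> G h -> Q g i -> Q h i -> g = h) -> False.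
Proof.
move=> Qex Qinj; apply: Gu.
suff [C hC] : exists C, forall g i, G g -> i \in enum I -> Q g i -> bdd abs g C.
  by exists C => g Gg; have [i Qi] := Qex g Gg; apply: hC Qi => //; rewrite mem_enum.
elim: (enum I) => [|i s [C hC]]; first by exists 0%Re.
have [[h [Gh Qh]]|H] := pselect (exists h, G h /\ Q h i); last first.
  exists C => g j Gg; rewrite inE => /orP [/eqP -> Qg|]; last exact: hC.
  by case: H; exists g.
have [C' hC'] := entries_bdd lf h.
exists (Rmax C C') => g j Gg; rewrite inE => /orP [/eqP -> Qg|js Qg] a b.
  rewrite (Qinj g h i Gg Gh Qg Qh); exact: Rle_trans (hC' a b) (Rmax_r _ _).
exact: Rle_trans (hC g j Gg js Qg a b) (Rmax_l _ _).
Qed.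

End Finiteness.

(** * Normal subgroups of highly transitive groups *)

Section Transitivity.
Variables (k : fieldType) (abs : k -> R) (G : mset k).
Hypotheses (lf : local_field abs) (Ggrp : is_subgroup G) (GS : in_SL2 G).
Hypothesis Gu : unbounded abs G.
Variables (X : eqType) (act : 'M[k]_2 -> X -> X).
Hypothesis act1 : forall x, act 1 x = x.
Hypothesis actM : forall g h x, G g -> G h -> act (g * h) x = act g (act h x).
Hypothesis faithful : forall g, G g -> (forall x, act g x = x) -> g = 1.
Hypothesis ht : forall (n : nat) (u v : 'I_n -> X), injective u -> injective v ->
  exists g, G g /\ forall i, act g (u i) = v i.

Let G1 : G 1. Proof. by case: Ggrp. Qed.
Let GM g h : G g -> G h -> G (g * h). Proof. by case: Ggrp => _ [H _]; apply: H. Qed.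
Let GV g : G g -> G g^-1. Proof. by case: Ggrp => _ [_ H]; apply: H. Qed.
Let GU g : G g -> g \is a GRing.unit. Proof. by move=> /GS /det1_unit. Qed.

Lemma act_invK g x : G g -> act g^-1 (act g x) = x.
Proof. by move=> Gg; rewrite -actM ?mulVr ?act1 ?GU //; exact: GV. Qed.

Lemma act_seq (l l' : seq X) : uniq l -> uniq l' -> size l = size l' ->
  exists g, G g /\ map (act g) l = l'.
Proof.
case: l => [|x0 l] ul ul' sl.
  by exists 1; split=> //; case: l' sl {ul'}.
set m := x0 :: l in ul sl *.
have inj (s : seq X) : uniq s -> size s = size m -> injective (fun i : 'I_(size m) => nth x0 s i).
  move=> us ss i j /eqP; rewrite nth_uniq ?ss // => /eqP; exact: val_inj.
have [g [Gg hg]] := ht (inj m ul erefl) (inj l' ul' (esym sl)).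
exists g; split=> //; apply: (@eq_from_nth _ x0); first by rewrite size_map.
move=> i; rewrite size_map => hi; rewrite (nth_map x0) //.
exact: (hg (Ordinal hi)).
Qed.

(** If [l] exhausted [X], faithfulness would label each element of [G] by a self-map of a finite
    set. *)
Lemma act_fresh (l : seq X) : exists x, x \notin l.
Proof.
apply: contrapT => H.
have all_l x : x \in l by apply: contrapT => /negP h; apply: H; exists x.
have {}all_l x : exists i, tnth (in_tuple l) i = x.
  by have /tnthP [i ->] : x \in in_tuple l := all_l x; exists i.
apply: (@unbounded_infinite _ _ G lf Gu {ffun 'I_(size l) -> 'I_(size l)}
  (fun g t => forall i, tnth (in_tuple l) (t i) = act g (tnth (in_tuple l) i))).
  move=> g _; have [f hf] := choice (fun i => all_l (act g (tnth (in_tuple l) i))).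
  by exists (finfun f) => i; rewrite ffunE.
move=> g h t Gg Gh hg hh.
have E : h^-1 * g = 1.
  apply: faithful => [|x]; first by apply: GM => //; apply: GV.
  have [i <-] := all_l x.
  by rewrite actM //; [rewrite -hg hh act_invK | exact: GV].
by rewrite -[LHS](mulVKr (GU Gh)) E mulr1.
Qed.

(** Some [z] is moved by [n], and 2-transitivity conjugates the pair of [z] and [n z] to that of [x]
    and [y]. *)
Lemma normal_transitive (N : mset k) n x y : normal_in N G -> N n -> n <> 1 -> x <> y ->
  exists m, N m /\ act m x = y.
Proof.
move=> [[_ NG] Nn] Hn n1 /eqP xy.
have [z /eqP hz] : exists z, act n z <> z.
  by apply: contrapT => H; apply: n1; apply: faithful => [|z]; [exact: NG|];
    apply: contrapT => h; apply: H; exists z.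
have [g [Gg [gx gy]]] := @act_seq [:: x; y] [:: z; act n z]
  ltac:(by rewrite /= inE xy) ltac:(by rewrite /= inE eq_sym hz) erefl.
exists (g^-1 * n * g); split; first exact: Nn.
have Gn := NG _ Hn; have GVg := GV Gg.
by rewrite actM ?actM //; [rewrite gx -gy act_invK | exact: GM].
Qed.

(** A nontrivial [N] would reach every point other than [x] from [x], but [X] is infinite. *)
Lemma finite_normal_trivial (N : mset k) : normal_in N G -> finite_set N -> trivial_set N.
Proof.
move=> NG [s hs] n Nn; apply: contrapT => n1.
have [x _] := act_fresh [::].
have [y] := act_fresh (x :: [seq act m x | m <- s]); rewrite inE negb_or => /andP [yx /negP ys].
have [|m [Nm E]] := @normal_transitive N n x y NG Nn n1.
  by move=> xy; rewrite xy eqxx in yx.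
by apply: ys; apply/mapP; exists m; rewrite ?E //; exact: hs.
Qed.

(* A subgroup commuting with a transitive one acts freely, whereas an element of N mapping
   x to z and w to w' has a conjugate mapping x to z but not w to w'. *)
Lemma commuting_normal_trivial (M N : mset k) : normal_in M G -> normal_in N G ->
  trivial_set (commutator_subgroup M N) -> trivial_set M \/ trivial_set N.
Proof.
move=> MG NG triv; apply: contrapT => H.
have [m0 [Mm0 m01]] : exists m, M m /\ m <> 1.
  apply: contrapT => h; apply: H; left => m Mm; apply: contrapT => m1; apply: h.
  by exists m.
have [n0 [Nn0 n01]] : exists n, N n /\ n <> 1.
  apply: contrapT => h; apply: H; right => m Mm; apply: contrapT => m1; apply: h.
  by exists m.
have [[_ MsG] _] := MG; have [[[_ [NM NV]] NsG] Nn] := NG.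
have comm m n : M m -> N n -> m * n = n * m.
  move=> Mm Hn; have Gm := MsG _ Mm; have Gn := NsG _ Hn.
  have E : commutator m n = 1.
    by apply: triv => K _ KS; apply: KS; exists m, n.
  rewrite commutator_eq in E; [|exact: GS..].
  by rewrite -[RHS]mulr1 -E mulVKr // GU //; exact: GM.
have free n x : N n -> act n x = x -> n = 1.
  move=> Hn nx; apply: faithful => [|y]; first exact: NsG.
  have [<- //|/eqP xy] := eqVneq x y.
  have [m [Mm my]] := normal_transitive MG Mm0 m01 xy.
  have Gm := MsG _ Mm; have Gn := NsG _ Hn.
  by rewrite -my -actM // -comm // actM // nx.
have Gn0 := NsG _ Nn0.
have [x _] := act_fresh [::].
set z := act n0 x.
have zx : z != x by apply/eqP => h; exact: n01 (free _ _ Nn0 h).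
have [w] := act_fresh [:: x; z; act n0^-1 x]; rewrite !inE !negb_or => /and3P [wx wz wn].
set w' := act n0 w.
have inj : injective (act n0) by apply: (can_inj (g := act n0^-1)) => y; exact: act_invK.
have w'w : w' != w by apply/eqP => h; exact: n01 (free _ _ Nn0 h).
have w'z : w' != z by rewrite (inj_eq inj).
have w'x : w' != x by apply: contraNneq wn => <-; rewrite act_invK.
(* The element [g] fixes [x], [z], [w] and sends [w'] to [w'']. Conjugating [n0] by it keeps [x]
   going to [z], so by freeness changes nothing; yet this forces [g] to fix [w']. *)
have [w''] := act_fresh [:: x; z; w; w'].
rewrite !inE !negb_or => /and4P [w''x w''z w''w w''w'].
have [g [Gg [gx gz gw gw']]] := @act_seq [:: x; z; w; w'] [:: x; z; w; w'']
  ltac:(by rewrite /= !inE !negb_or; do !(apply/andP; split) => //; rewrite eq_sym)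
  ltac:(by rewrite /= !inE !negb_or; do !(apply/andP; split) => //; rewrite eq_sym) erefl.
have GVg := GV Gg.
have Nn1 : N (g^-1 * n0 * g) by exact: Nn.
have n1E y : act (g^-1 * n0 * g) y = act g^-1 (act n0 (act g y)).
  by rewrite actM ?actM //; exact: GM.
have gVz : act g^-1 z = z by rewrite -{1}gz act_invK.
have E : (g^-1 * n0 * g)^-1 * n0 = 1.
  apply: (@free _ x); first by apply: NM => //; apply: NV.
  have n1x : act (g^-1 * n0 * g) x = z by rewrite n1E gx.
  rewrite actM //; last by apply: GV; exact: NsG.
  by rewrite -/z -n1x act_invK //; exact: NsG.
have E' : n0 = g^-1 * n0 * g.
  by rewrite -[LHS](mulVKr (GU (NsG _ Nn1))) E mulr1.
have : act g w' = w'.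
  by rewrite {1}/w' E' n1E gw -actM ?divrr ?act1 ?GU.
by move=> gw'2; rewrite -gw' gw'2 eqxx in w''w'.
Qed.

End Transitivity.

Lemma highly_transitive_almost_simple (k : fieldType) (abs : k -> R) (G : mset k) :
  local_field abs -> is_subgroup G -> in_SL2 G -> unbounded abs G ->
  highly_transitive G -> almost_simple_type G.
Proof.
move=> lf Ggrp GS Gu [X [act [act1 [actM [faith HT]]]]]; split.
  (* [{classic X}] gives the arbitrary type [X] a classical decidable equality. *)
  exact: (@finite_normal_trivial k abs G lf Ggrp GS Gu {classic X} act act1 actM faith HT).
exact: (@commuting_normal_trivial k abs G lf Ggrp GS Gu {classic X} act act1 actM faith HT).
Qed.

(** * The core of a solvable subgroup of finite index *)

Section Core.
Variables (k : fieldType) (abs : k -> R) (G : mset k).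
Hypotheses (lf : local_field abs) (Ggrp : is_subgroup G) (GS : in_SL2 G).
Hypothesis Gu : unbounded abs G.

Let G1 : G 1. Proof. by case: Ggrp. Qed.
Let GM g h : G g -> G h -> G (g * h). Proof. by case: Ggrp => _ [H _]; apply: H. Qed.
Let GV g : G g -> G g^-1. Proof. by case: Ggrp => _ [_ H]; apply: H. Qed.
Let GU g : G g -> g \is a GRing.unit. Proof. by move=> /GS /det1_unit. Qed.

Lemma generated_subgroup (S : mset k) : is_subgroup (generated S).
Proof.
split; first by move=> K [].
split=> [g h gS hS K KG SK|g gS K KG SK]; have [_ [KM KV]] := KG.
  by apply: KM; [exact: gS | exact: hS].
by apply: KV; exact: gS.
Qed.

Lemma conjM g x y : G g -> g^-1 * (x * y) * g = (g^-1 * x * g) * (g^-1 * y * g).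
Proof. by move=> /GU ug; rewrite !mulrA mulrK. Qed.

Lemma conjV g x : G g -> G x -> g^-1 * x^-1 * g = (g^-1 * x * g)^-1.
Proof.
move=> /GU ug /GU ux.
by rewrite [in RHS]invrM ?[_ * x \is a _]unitrMl ?unitrV // invrM ?unitrV // invrK mulrA.
Qed.

Lemma conj_commutator g m n : G g -> G m -> G n ->
  g^-1 * commutator m n * g = commutator (g^-1 * m * g) (g^-1 * n * g).
Proof. by move=> Gg Gm Gn; rewrite /commutator -!conjV // -!conjM. Qed.

Lemma commutator_normal (M : mset k) : normal_in M G -> normal_in (commutator_subgroup M M) G.
Proof.
move=> [[_ MG] Mn].
have CG : subset_of (commutator_subgroup M M) G.
  apply: commutator_sub => // m n /MG Gm /MG Gn.
  by do !apply: GM => //; apply: GV.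
split; first by split=> //; exact: generated_subgroup.
move=> g x Gg Cx.
pose P : mset k := fun x => G x /\ commutator_subgroup M M (g^-1 * x * g).
have [C1 [CM CV]] := generated_subgroup (fun x => exists m n, M m /\ M n /\ x = commutator m n).
suff [] : P x by [].
move: x Cx; apply: commutator_sub.
  split; first by split=> //; rewrite mulr1 mulVr ?GU.
  split=> [x y [Gx Px] [Gy Py]|x [Gx Px]].
    by split; [exact: GM | rewrite conjM //; exact: CM].
  by split; [exact: GV | rewrite conjV //; exact: CV].
move=> m n Mm Hn; have Gm := MG _ Mm; have Gn := MG _ Hn.
split; first by do !apply: GM => //; apply: GV.
rewrite conj_commutator // => K _; apply.
by exists (g^-1 * m * g), (g^-1 * n * g); split; [exact: Mn|split; [exact: Mn|]].
Qed.

Lemma derived_normal (K : mset k) n : normal_in K G -> normal_in (derived_series K n) G.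
Proof. by move=> KG; elim: n => // n IH; exact: commutator_normal. Qed.

Lemma derived_mono (K H : mset k) n : subset_of K H ->
  subset_of (derived_series K n) (derived_series H n).
Proof.
move=> KH; elim: n => // n IH x Kx L LG LS; apply: Kx => // y [m [p [Km [Kp ->]]]].
by apply: LS; exists m, p; split; [exact: IH|split; [exact: IH|]].
Qed.

(** Label [g] by a map describing how it permutes the cosets of [H]. Elements with a common label
    differ by an element of the core, so a trivial core would make [G] finite. *)
Lemma finite_index_core_nontrivial (H : mset k) : subgroup_of H G -> finite_index H G ->
  ~ trivial_set (fun g => G g /\ forall x, G x -> H (x^-1 * g * x)).
Proof.
move=> [[H1 [HM HV]] HG] [s hs] triv.
have rep x z : G z -> H (x^-1 * z) -> G x.
  move=> Gz Hx; have Gx : G x^-1.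
    by rewrite -[x^-1](mulrK (GU Gz)); apply: GM; [exact: HG | exact: GV].
  by rewrite -[x]invrK; exact: GV.
pose r (i : 'I_(size s)) := tnth (in_tuple s) i.
apply: (@unbounded_infinite _ _ G lf Gu {ffun 'I_(size s) -> 'I_(size s)}
  (fun g t => forall i, G (r i) -> G (r (t i)) /\ H ((r (t i))^-1 * (g * r i)))).
  move=> g Gg.
  have ex i : exists j, G (r i) -> G (r j) /\ H ((r j)^-1 * (g * r i)).
    have [Gi|nG] := pselect (G (r i)); last by exists i.
    have [x xs Hx] := hs _ (GM Gg Gi).
    have /tnthP [j xj] : x \in in_tuple s by [].
    exists j => _; rewrite /r -xj; split=> //.
    exact: rep (GM Gg Gi) Hx.
  have [f hf] := choice ex.
  by exists (finfun f) => i; rewrite ffunE; exact: hf.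
move=> g h t Gg Gh hg hh.
have ugh := GU Gh.
have E : h^-1 * g = 1.
  apply: triv; split=> [|x Gx]; first by apply: GM => //; apply: GV.
  have [y ys Hy] := hs _ Gx; have Gy := rep _ _ Gx Hy.
  have /tnthP [i yi] : y \in in_tuple s by [].
  have Gi : G (r i) by rewrite /r -yi.
  have [Gt H_g] := hg i Gi; have [_ H_h] := hh i Gi.
  have Hc : H (y^-1 * (h^-1 * g) * y).
    have -> : y^-1 * (h^-1 * g) * y = ((r (t i))^-1 * (h * r i))^-1 * ((r (t i))^-1 * (g * r i)).
      rewrite (invrM (GU (GV Gt)) (GU (GM Gh Gi))) (invrM (GU Gh) (GU Gi)) invrK.
      by rewrite yi -/(r i) !mulrA (mulrK (GU Gt)).
    by apply: HM => //; apply: HV.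
  have -> : x^-1 * (h^-1 * g) * x = (y^-1 * x)^-1 * (y^-1 * (h^-1 * g) * y) * (y^-1 * x).
    by rewrite (invrM (GU (GV Gy)) (GU Gx)) invrK !mulrA !(mulrK (GU Gy)).
  by apply: (HM) => //; apply: (HM) => //; apply: HV.
by rewrite -[LHS](mulVKr ugh) E mulr1.
Qed.

Lemma almost_simple_not_virtually_solvable : almost_simple_type G -> ~ virtually_solvable G.
Proof.
move=> [_ comm] [H [HG [fi [n sol]]]].
pose K : mset k := fun g => G g /\ forall x, G x -> H (x^-1 * g * x).
have [[H1 [HM HV]] HsG] := (HG : subgroup_of H G).
have KG : normal_in K G.
  split; last first.
    move=> g m Gg [Gm Hm]; split=> [|x Gx].
      by apply: GM => //; apply: GM => //; apply: GV.
    have -> : x^-1 * (g^-1 * m * g) * x = (g * x)^-1 * m * (g * x).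
      by rewrite invrM ?GU // !mulrA.
    by apply: Hm; exact: GM.
  split; last by move=> g [].
  split; first by split=> // x Gx; rewrite mulr1 mulVr ?GU.
  split=> [g h [Gg Hg] [Gh Hh]|g [Gg Hg]].
    by split=> [|x Gx]; [exact: GM | rewrite conjM //; apply: HM; [exact: Hg|exact: Hh]].
  by split=> [|x Gx]; [exact: GV | rewrite conjV //; apply: HV; exact: Hg].
have KH : subset_of K H by move=> g [_ /(_ 1 G1)]; rewrite invr1 mul1r mulr1.
apply: (finite_index_core_nontrivial HG fi).
have : trivial_set (derived_series K n) by move=> x /(derived_mono KH) /sol.
(* Each derived subgroup of the core is normal in [G]; once its commutator subgroup is trivial it is
   itself trivial. This descends to the core. *)
elim: n {sol} => // n IH triv; apply: IH.
by have [] := comm _ _ (derived_normal n KG) (derived_normal n KG) triv.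
Qed.

End Core.

(** * Zariski density *)

Section Laurent.
Variable k : fieldType.

(** Functions agreeing with a Laurent polynomial off zero; clearing the denominator leaves an
    ordinary polynomial. *)
Definition laurent (f : k -> k) := exists (q : {poly k}) N,
  forall s, s != 0 -> s ^+ N * f s = q.[s].

Lemma laurent_ext f g : (forall s, s != 0 -> f s = g s) -> laurent f -> laurent g.
Proof. by move=> fg [q [N h]]; exists q, N => s s0; rewrite -fg // h. Qed.

Lemma laurent_const c : laurent (fun=> c).
Proof. by exists c%:P, 0%N => s _; rewrite hornerC mul1r. Qed.

Lemma laurent_id : laurent id.
Proof. by exists 'X, 0%N => s _; rewrite hornerX mul1r. Qed.

Lemma laurent_inv : laurent (fun s => s^-1).
Proof. by exists 1, 1%N => s s0; rewrite expr1 hornerE divff. Qed.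

Lemma laurent_add f g : laurent f -> laurent g -> laurent (fun s => f s + g s).
Proof.
move=> [p [N hp]] [q [M hq]]; exists (p * 'X^M + q * 'X^N), (N + M)%N => s s0.
by rewrite hornerD !hornerM !hornerXn -hp // -hq // exprD; move: (s ^+ N) (s ^+ M) => a b; ring.
Qed.

Lemma laurent_mul f g : laurent f -> laurent g -> laurent (fun s => f s * g s).
Proof.
move=> [p [N hp]] [q [M hq]]; exists (p * q), (N + M)%N => s s0.
by rewrite hornerM -hp // -hq // exprD mulrACA.
Qed.

Lemma laurent_sum (I : Type) (r : seq I) (F : I -> k -> k) :
  (forall i, laurent (F i)) -> laurent (fun s => \sum_(i <- r) F i s).
Proof.
move=> h; elim: r => [|i r IH].
  by apply: laurent_ext (laurent_const 0) => s _; rewrite big_nil.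
by apply: laurent_ext (laurent_add (h i) IH) => s _; rewrite big_cons.
Qed.

Lemma laurent_prod (I : Type) (r : seq I) (F : I -> k -> k) :
  (forall i, laurent (F i)) -> laurent (fun s => \prod_(i <- r) F i s).
Proof.
move=> h; elim: r => [|i r IH].
  by apply: laurent_ext (laurent_const 1) => s _; rewrite big_nil.
by apply: laurent_ext (laurent_mul (h i) IH) => s _; rewrite big_cons.
Qed.

Lemma laurent_exp f n : laurent f -> laurent (fun s => f s ^+ n).
Proof.
move=> h; elim: n => [|n IH]; first by apply: laurent_ext (laurent_const 1).
by apply: laurent_ext (laurent_mul h IH) => s _; rewrite exprS.
Qed.

Lemma laurent_meval n (p : {mpoly k[n]}) (v : k -> 'I_n -> k) :
  (forall i, laurent (fun s => v s i)) -> laurent (fun s => p.@[v s]).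
Proof.
move=> h; apply: (@laurent_ext (fun s => \sum_(m <- msupp p) p@_m * \prod_i v s i ^+ m i)).
  by move=> s _; rewrite mevalE.
apply: laurent_sum => m; apply: laurent_mul; first exact: laurent_const.
by apply: laurent_prod => i; apply: laurent_exp.
Qed.

Lemma laurent_vanish f : laurent f ->
  (forall rs : seq k, exists s, [/\ s != 0, s \notin rs & f s = 0]) ->
  forall s, s != 0 -> f s = 0.
Proof.
move=> [q [N h]] inf s s0.
suff q0 : q = 0.
  by have /eqP := h s s0; rewrite q0 horner0 mulf_eq0 expf_eq0 (negbTE s0) andbF => /eqP.
apply/eqP; apply: contrapT => /negP q0.
(* [size q] is one more than the degree, so this is one root too many. *)
have [rs [urs rrs srs]] : exists rs, [/\ uniq rs, all (root q) rs & size rs = size q].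
  elim: (size q) => [|n [rs [urs rrs srs]]]; first by exists [::].
  have [t [t0 trs ft]] := inf rs; exists (t :: rs).
  by split; rewrite /= ?trs ?urs ?rrs ?srs // andbT /root -h // ft mulr0.
by have := max_poly_roots q0 rrs urs; rewrite srs ltnn.
Qed.

Definition laurent_mx (x : k -> 'M[k]_2) := forall i j, laurent (fun s => x s i j).

Lemma laurent_mx_const x : laurent_mx (fun=> x).
Proof. by move=> i j; exact: laurent_const. Qed.

Lemma laurent_mx_mul x y : laurent_mx x -> laurent_mx y -> laurent_mx (fun s => x s * y s).
Proof.
move=> hx hy i j; apply: laurent_ext (laurent_add (laurent_mul (hx i 0) (hy 0 j))
  (laurent_mul (hx i 1) (hy 1 j))) => s _.
by rewrite mul_mx2.
Qed.

Lemma laurent_mx_mk a b c e : laurent a -> laurent b -> laurent c -> laurent e ->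
  laurent_mx (fun s => mk2 (a s) (b s) (c s) (e s)).
Proof.
move=> ha hb hc he; do 2!apply: ord2P.
- by apply: laurent_ext ha => s _; rewrite mk2E.
- by apply: laurent_ext hb => s _; rewrite mk2E.
- by apply: laurent_ext hc => s _; rewrite mk2E.
- by apply: laurent_ext he => s _; rewrite mk2E.
Qed.

Definition dg (s : k) := mk2 s 0 0 s^-1.

Lemma laurent_mx_dg : laurent_mx dg.
Proof.
by apply: laurent_mx_mk; [exact: laurent_id|exact: laurent_const..|exact: laurent_inv].
Qed.

(** The change of basis [Q] will diagonalize an element of the group. *)
Definition conj_eval (p : {mpoly k[4]}) (Q x : 'M[k]_2) := p.@[mat_coords (Q * x * Q^-1)].

Lemma laurent_conj_eval p Q x : laurent_mx x -> laurent (fun s => conj_eval p Q (x s)).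
Proof.
move=> hx; apply: laurent_meval => i.
exact: (laurent_mx_mul (laurent_mx_mul (laurent_mx_const Q) hx) (laurent_mx_const Q^-1)).
Qed.

End Laurent.

(** * Spreading the vanishing from a torus to the whole group *)

Section Density.
Variables (k : fieldType) (abs : k -> R).
Hypothesis lf : local_field abs.

Let absP : is_abs_value abs. Proof. by case: lf. Qed.
Let nontriv : nontrivial_abs abs. Proof. by case: lf => _ []. Qed.
Let lc : locally_compact abs. Proof. by case: lf => _ []. Qed.

Lemma seq_abs_bound (rs : seq k) : exists C, (1 <= C)%Re /\
  forall x, (C < abs x)%Re -> x != 0 /\ x \notin rs.
Proof.
elim: rs => [|r rs [C [C1 hC]]].
  exists 1%Re; split=> [|x hx]; first by lra.
  by split=> //; apply/eqP => x0; rewrite x0 abs0 // in hx; lra.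
exists (Rmax C (abs r)); split; first by have := Rmax_l C (abs r); lra.
move=> x hx; have m1 := Rmax_l C (abs r); have m2 := Rmax_r C (abs r).
have [x0 xrs] := hC x ltac:(lra); split=> //.
by rewrite inE negb_or xrs andbT; apply/eqP => xr; rewrite xr in hx; lra.
Qed.

Lemma power_large x : (1 < abs x)%Re -> forall C, exists n, (C < abs (x ^+ n))%Re.
Proof.
move=> x1 C.
have [N hN] := Pow_x_infinity (abs x) ltac:(rewrite Rabs_pos_eq; lra) (C + 1)%Re.
exists N; have := hN N (PeanoNat.Nat.le_refl N).
by rewrite -absX // Rabs_pos_eq; [lra | exact: abs_ge0].
Qed.

Lemma linear_large x y : x <> 0 -> forall C, exists S, forall s, (S < abs s)%Re ->
  (C < abs (x * s + y / s)%R)%Re.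
Proof.
move=> x0 C; have px := abs_gt0 absP x0; have py := abs_ge0 absP y.
have pC := Rmax_r C 0; have pC' := Rmax_l C 0.
exists (1 + (Rmax C 0 + abs y) / abs x)%Re => s hs.
have q0 : (0 <= (Rmax C 0 + abs y) / abs x)%Re.
  by apply: Rmult_le_pos; [lra | left; exact: Rinv_0_lt_compat].
have h := absD absP (x * s + y / s) (- (y / s)).
rewrite addrK absN // !absM // absV // in h.
have i1 : (/ abs s <= 1)%Re by rewrite -Rinv_1; apply: Rinv_le_contravar; lra.
have h1 := Rmult_le_compat_l _ _ _ py i1.
have h2 := Rmult_lt_compat_l _ _ _ px hs.
have E : (abs x * ((Rmax C 0 + abs y) / abs x) = Rmax C 0 + abs y)%Re.
  by rewrite /Rdiv (Rmult_comm (Rmax C 0 + abs y)) -Rmult_assoc Rinv_r; lra.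
lra.
Qed.

Section Torus.
Variables (p : {mpoly k[4]}) (Q : 'M[k]_2) (lam : k) (h : 'M[k]_2) (G : mset k).
Hypothesis lam1 : (1 < abs lam)%Re.
Hypothesis GM : forall x y, G x -> G y -> G (x * y).
Hypothesis Glam : G (dg lam).
Hypothesis G1 : G 1.
Hypothesis Gh : G h.
Hypothesis dh : \det h = 1.
Hypothesis hnz : forall i j, h i j <> 0.
Hypothesis vanish : forall x, G x -> conj_eval p Q x = 0.

Lemma dg_powers n : G (dg (lam ^+ n)).
Proof.
elim: n => [|n IH].
  by suff -> : dg (lam ^+ 0) = 1 by []; apply: mx2P; rewrite /dg !mk2E !one_mx2 ?expr0 ?invr1.
suff -> : dg (lam ^+ n.+1) = dg lam * dg (lam ^+ n) by exact: GM.
apply: mx2P; rewrite /dg mul_mx2 !mk2E ?exprS ?invfM; ring.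
Qed.

Lemma laurent_powers f : laurent f -> (forall n, f (lam ^+ n) = 0) ->
  forall s, s != 0 -> f s = 0.
Proof.
move=> lfun H; apply: laurent_vanish => // rs.
have [C [_ hC]] := seq_abs_bound rs; have [n /hC [h1 h2]] := power_large lam1 C.
by exists (lam ^+ n).
Qed.

(** The powers of [lam] are unbounded, so a Laurent polynomial vanishing on them vanishes; this
    frees the three parameters one at a time. *)
Lemma vanish_torus s1 s s2 : s1 != 0 -> s != 0 -> s2 != 0 ->
  conj_eval p Q (dg s1 * (h * dg s * h) * dg s2) = 0.
Proof.
have C := @laurent_mx_const k; have M := @laurent_mx_mul k; have D := @laurent_mx_dg k.
move=> h1 h0 h2.
have step1 a b t : t != 0 ->
    conj_eval p Q (dg (lam ^+ a) * (h * dg (lam ^+ b) * h) * dg t) = 0.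
  move: t; apply: laurent_powers.
    by apply: laurent_conj_eval; apply: (M _ _ (C _) D).
  by move=> n; apply: vanish; do !apply: GM => //; exact: dg_powers.
have step2 a t : t != 0 -> conj_eval p Q (dg (lam ^+ a) * (h * dg t * h) * dg s2) = 0.
  move: t; apply: laurent_powers => [|n]; last exact: step1.
  apply: laurent_conj_eval; apply: (M _ _ _ (C _)); apply: (M _ _ (C _)).
  exact: (M _ _ (M _ _ (C _) D) (C _)).
move: s1 h1; apply: laurent_powers => [|n]; last exact: step2.
by apply: laurent_conj_eval; apply: (M _ _ (M _ _ D (C _)) (C _)).
Qed.

(** For nonzero [a] and [b], the matrix of determinant one with top row [a], [b] and product of
    diagonal entries [X]. *)
Definition cell (a b X : k) := mk2 a b ((X - 1) / b) (X / a).

Lemma large_inf (f : k -> k) (P : k -> Prop) :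
  (forall C, exists s, (C < abs (f s))%Re /\ P (f s)) ->
  forall rs : seq k, exists t, [/\ t != 0, t \notin rs & P t].
Proof.
move=> H rs; have [C [_ hC]] := seq_abs_bound rs.
by have [s [/hC [h1 h2] h3]] := H C; exists (f s).
Qed.

(* The double coset of the diagonal torus containing x consists, up to squares, of the
   matrices with the same product of diagonal entries. *)
Lemma vanish_cell_of (x : 'M[k]_2) : \det x = 1 -> x 0 0 != 0 -> x 0 1 != 0 ->
  (forall s1 s2, s1 != 0 -> s2 != 0 -> conj_eval p Q (dg s1 * x * dg s2) = 0) ->
  forall a b, a != 0 -> b != 0 -> conj_eval p Q (cell a b (x 0 0 * x 1 1)) = 0.
Proof.
rewrite det_mx2 => dx A0 B0 V a b a0 b0; move: a a0.
have tau0 : b / x 0 1 != 0 by rewrite mulf_neq0 ?invr_eq0.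
apply: laurent_vanish.
  apply: laurent_conj_eval; apply: laurent_mx_mk; try exact: laurent_const.
    exact: laurent_id.
  exact: (laurent_mul (laurent_const _) (laurent_inv k)).
(* Multiplying [x] by torus elements with top row entry [b] preserved reaches these values of [a], a
   fixed scalar times all squares. They are unbounded, which suffices. *)
apply: (large_inf (f := fun s => x 0 0 * (b / x 0 1) * (s * s))) => C.
have /eqP c0 : x 0 0 * (b / x 0 1) != 0 by rewrite mulf_neq0.
have pc := abs_gt0 absP c0.
have [s [s0' hs]] := large_abs absP nontriv (1 + Rmax C 0 / abs (x 0 0 * (b / x 0 1)%R)%R)%Re.
have /eqP s0 := s0'; exists s; split.
  rewrite absM // [abs (s * s)]absM //.
  set c := abs _ in pc hs *; have m1 := Rmax_l C 0; have m2 := Rmax_r C 0.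
  have q : (0 <= Rmax C 0 / c)%Re by apply: Rmult_le_pos => //; left; exact: Rinv_0_lt_compat.
  have E : (c * (Rmax C 0 / c) = Rmax C 0)%Re.
    by rewrite /Rdiv (Rmult_comm (Rmax C 0)) -Rmult_assoc Rinv_r; lra.
  have h1 := Rmult_lt_compat_l c _ _ pc hs.
  have h2 := Rmult_le_compat_l (c * abs s) 1 (abs s) ltac:(apply: Rmult_le_pos; lra) ltac:(lra).
  lra.
have V' : conj_eval p Q (dg (b / x 0 1 * s) * x * dg s) = 0.
  by apply: V => //; rewrite mulf_neq0.
rewrite -[RHS]V'; congr (conj_eval p Q _).
have e : x 0 0 * x 1 1 - 1 = x 0 1 * x 1 0 by rewrite -dx; ring.
apply: mx2P; rewrite /cell /dg !mul_mx2 !mk2E ?e; field; rewrite ?A0 ?B0 ?s0 ?b0 //.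
Qed.

(** The product of the diagonal entries of [h * dg s * h] takes infinitely many values, and the
    entries of [cell a b X] are polynomial in [X]. *)
Lemma vanish_cell a b X : a != 0 -> b != 0 -> conj_eval p Q (cell a b X) = 0.
Proof.
move=> a0 b0.
(* The shift puts [X] at the nonzero parameter [Y = 1]. *)
pose f Y := conj_eval p Q (cell a b (Y + (X - 1))).
suff H : forall Y, Y != 0 -> f Y = 0 by have := H 1 (oner_neq0 _); rewrite /f addrC subrK.
have lshift c : laurent (fun s : k => s + c).
  exact: laurent_add (laurent_id k) (laurent_const c).
apply: laurent_vanish.
  apply: laurent_conj_eval; apply: laurent_mx_mk; try exact: laurent_const.
    apply: laurent_mul; last exact: laurent_const.
    by apply: laurent_add (lshift _) _; exact: laurent_const.
  by apply: laurent_mul; [exact: lshift | exact: laurent_const].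
pose M s := h * dg s * h.
have ME s : [/\ M s 0 0 = h 0 0 * h 0 0 * s + (h 0 1 * h 1 0) / s,
    M s 0 1 = h 0 0 * h 0 1 * s + (h 0 1 * h 1 1) / s &
    M s 1 1 = h 1 0 * h 0 1 * s + (h 1 1 * h 1 1) / s].
  by split; rewrite /M !mul_mx2 /dg !mk2E; ring.
apply: (large_inf (f := fun s => M s 0 0 * M s 1 1 - (X - 1))) => C.
have nz i j i' j' : h i j * h i' j' <> 0.
  by apply/eqP; rewrite mulf_neq0 //; apply/eqP; exact: hnz.
(* The first two bounds make the top row of [M s] nonzero; the first and third make the product of
   its diagonal entries large. *)
have [S1 hS1] := linear_large (h 0 1 * h 1 0) (nz 0 0 0 0) 1%Re.
have [S2 hS2] := linear_large (h 0 1 * h 1 1) (nz 0 0 0 1) 1%Re.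
have [S3 hS3] := linear_large (h 1 1 * h 1 1) (nz 1 0 0 1) (Rmax 0 (C + abs (X - 1)%R))%Re.
have [s [/eqP s0 hs]] := large_abs absP nontriv (Rmax S1 (Rmax S2 S3)).
have m1 := Rmax_l S1 (Rmax S2 S3); have m2 := Rmax_r S1 (Rmax S2 S3).
have m3 := Rmax_l S2 S3; have m4 := Rmax_r S2 S3.
have [E1 E2 E3] := ME s.
have {}hS1 := hS1 s ltac:(lra); have {}hS2 := hS2 s ltac:(lra); have {}hS3 := hS3 s ltac:(lra).
rewrite -E1 in hS1; rewrite -E2 in hS2; rewrite -E3 in hS3.
have k1 := Rmax_l 0 (C + abs (X - 1)%R); have k2 := Rmax_r 0 (C + abs (X - 1)%R).
exists s; split; cbv beta.
  apply: Rlt_le_trans (abs_le_sub absP _ _); rewrite absM //.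
  have k3 := Rmult_le_compat_r (abs (M s 1 1)) 1 (abs (M s 0 0)) ltac:(lra) ltac:(lra).
  by rewrite Rmult_1_l in k3; apply: Rlt_le_trans (Rplus_le_compat_r _ _ _ k3); lra.
rewrite /f subrK.
have ne x : (1 < abs x)%Re -> x != 0.
  by move=> hx; apply/eqP => x0; rewrite x0 abs0 // in hx; lra.
apply: vanish_cell_of => //; [|exact: ne|exact: ne|].
  rewrite /M !det_mul1 // /dg det_mx2 !mk2E mul0r subr0 divff //.
by move=> s1 s2 h1 h2; exact: vanish_torus.
Qed.

(** Matrices without zeros in the top row are cells. Otherwise all but finitely many unipotent
    multiples of [x] in a suitable family are; [x] itself sits at the nonzero parameter [u = 1]. *)
Lemma vanish_SL2 x : \det x = 1 -> conj_eval p Q x = 0.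
Proof.
have generic y : \det y = 1 -> y 0 0 != 0 -> y 0 1 != 0 -> conj_eval p Q y = 0.
  move=> dy a0 b0; rewrite -(vanish_cell (y 0 0 * y 1 1) a0 b0); congr (conj_eval p Q _).
  move: dy; rewrite det_mx2 => dy.
  by apply: mx2P; rewrite /cell !mk2E // -?dy; field; rewrite ?a0 ?b0.
have avoid (a b : k) : a != 0 -> forall rs : seq k,
    exists u, [/\ u != 0, u \notin rs & a * (u - 1) + b != 0].
  move=> a0 rs; have [C [_ hC]] := seq_abs_bound (1 - b / a :: rs).
  have [u [_ /hC [u0]]] := large_abs absP nontriv C; rewrite inE negb_or => /andP [ub urs].
  exists u; split=> //; apply: contraNneq ub => E; apply/eqP.
  have E' : a * (u - 1) = - b by rewrite -[LHS](addrK b) E sub0r.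
  have -> : u = a * (u - 1) / a + 1 by field.
  by rewrite E'; ring.
have lsub : laurent (fun u : k => u - 1).
  exact: laurent_add (laurent_id k) (laurent_const _).
move=> dx; have [a0|a0] := eqVneq (x 0 0) 0.
  have b0 : x 0 1 != 0.
    by apply/eqP => b0; move: dx; rewrite det_mx2 a0 b0 !mul0r subrr => /esym/eqP;
      rewrite oner_eq0.
  pose f u := conj_eval p Q (x * mk2 1 0 (u - 1) 1).
  suff H : forall u, u != 0 -> f u = 0.
    have := H 1 (oner_neq0 _); rewrite /f subrr.
    have -> : mk2 1 0 0 1 = 1 :> 'M[k]_2 by apply: mx2P; rewrite mk2E !one_mx2.
    by rewrite mulr1.
  apply: laurent_vanish => [|rs].
    apply: laurent_conj_eval; apply: laurent_mx_mul; first exact: laurent_mx_const.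
    by apply: laurent_mx_mk => //; exact: laurent_const.
  have [u [u0 urs hu]] := avoid (x 0 1) (x 0 0) b0 rs; exists u; split=> //.
  apply: generic; rewrite ?mul_mx2 ?mk2E ?mulr0 ?add0r ?mulr1 //.
    by rewrite det_mul1 // det_mx2 !mk2E mul0r subr0 mulr1.
  by rewrite addrC.
pose f u := conj_eval p Q (x * mk2 1 (u - 1) 0 1).
suff H : forall u, u != 0 -> f u = 0.
  have := H 1 (oner_neq0 _); rewrite /f subrr.
  have -> : mk2 1 0 0 1 = 1 :> 'M[k]_2 by apply: mx2P; rewrite mk2E !one_mx2.
  by rewrite mulr1.
apply: laurent_vanish => [|rs].
  apply: laurent_conj_eval; apply: laurent_mx_mul; first exact: laurent_mx_const.
  by apply: laurent_mx_mk => //; exact: laurent_const.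
have [u [u0 urs hu]] := avoid (x 0 0) (x 0 1) a0 rs; exists u; split=> //.
apply: generic; rewrite ?mul_mx2 ?mk2E ?mulr0 ?addr0 ?mulr1 //.
by rewrite det_mul1 // det_mx2 !mk2E mulr0 subr0 mulr1.
Qed.

End Torus.

(* The root of smaller absolute value of y^2 - t y + 1 is a limit point of the iteration
   y -> 1 / (t - y), a contraction of the unit ball. *)
Lemma small_root t : (4 < abs t)%Re -> exists y, (abs y < 1)%Re /\ y * (t - y) = 1.
Proof.
move=> ht.
have far y : (abs y <= 1)%Re -> (3 <= abs (t - y)%R)%Re.
  by move=> hy; have := abs_le_sub absP t y; lra.
have nz y : (abs y <= 1)%Re -> t - y != 0.
  by move=> /far hy; apply/eqP => E; rewrite E abs0 // in hy; lra.
have small y : (abs y <= 1)%Re -> (abs (t - y)^-1 <= / 3)%Re.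
  by move=> /far hy; rewrite absV //; apply: Rinv_le_contravar; lra.
have contr y z : (abs y <= 1)%Re -> (abs z <= 1)%Re ->
    (abs ((t - y)^-1 - (t - z)^-1)%R <= abs (y - z)%R / 9)%Re.
  move=> hy hz.
  have -> : (t - y)^-1 - (t - z)^-1 = (y - z) * ((t - y)^-1 * (t - z)^-1).
    by have := nz y hy; have := nz z hz => z0 y0; field; rewrite y0 z0.
  rewrite !absM //; have := small y hy; have := small z hz => h1 h2.
  have := Rmult_le_compat _ _ _ _ (abs_ge0 absP (t - y)^-1) (abs_ge0 absP (t - z)^-1) h2 h1.
  by move=> /(Rmult_le_compat_l _ _ _ (abs_ge0 absP (y - z))); lra.
pose y n := iter n (fun z => (t - z)^-1) 0.
have y1 n : (abs (y n) <= 1)%Re.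
  elim: n => [|n IH] /=; first by rewrite abs0 //; lra.
  by have := small _ IH; lra.
(* The ratio 1/9 leaves ample room for this harmonic bound, which only has to tend to zero. *)
have ydiff n : (abs (y n.+1 - y n)%R <= / INR n.+1)%Re.
  elim: n => [|n IH].
    by rewrite -[y 0%N]/(0 : k) subr0 Rinv_1; exact: (y1 1%N).
  apply: Rle_trans (contr (y n.+1) (y n) (y1 _) (y1 _)) _.
  apply: Rle_trans (Rmult_le_compat_r (/ 9) _ _ ltac:(lra) IH) _.
  have p : (0 < INR n.+1)%Re by apply: lt_0_INR; apply/ltP.
  have p1 : (1 <= INR n.+1)%Re by rewrite S_INR; have := pos_INR n; lra.
  have : (/ (2 * INR n.+1) <= / INR n.+2)%Re.
    by apply: Rinv_le_contravar; rewrite (S_INR n.+1); lra.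
  rewrite Rinv_mult; have := Rinv_0_lt_compat _ p; lra.
have [phi [l [mono cv]]] := bounded_subseq absP nontriv lc y1.
have l1 : (abs l <= 1)%Re.
  apply: Rnot_lt_le => hl; have [N hN] := cv (abs l - 1)%Re ltac:(lra).
  have hN' : (abs (l - y (phi N))%R < abs l - 1)%Re by rewrite absB //; exact: (hN N).
  by have := Rlt_le_trans _ _ _ (Rle_lt_trans _ _ _ (abs_le_sub absP l (y (phi N))) hN')
    (Rle_refl _); have := y1 (phi N); lra.
have fixl : l = (t - l)^-1.
  apply/eqP; rewrite -subr_eq0; apply/eqP/(abs_eq0 absP)/Rle_antisym; last exact: abs_ge0.
  apply: Rnot_lt_le => he; set e := abs _ in he.
  have [N1 h1] := cv (e / 3)%Re ltac:(lra).
  have [N2 h2] := invS_small (Rdiv_lt_0_compat e 3 he ltac:(lra)).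
  pose n := maxn N1 N2.
  (* The sum [A + B + C] telescopes to [l - (t - l)^-1], as [(t - y (phi n))^-1] is the next
     iterate. *)
  pose A := l - y (phi n); pose B := y (phi n) - y (phi n).+1.
  pose C := (t - y (phi n))^-1 - (t - l)^-1.
  have c1 : (abs A < e / 3)%Re by rewrite /A absB //; exact: (h1 n (leq_maxl _ _)).
  have c2 : (/ INR (phi n).+1 < e / 3)%Re.
    by apply: h2; apply: leq_trans (phi_ge n mono); exact: leq_maxr.
  have c3 : (abs B <= / INR (phi n).+1)%Re by rewrite /B absB //; exact: ydiff.
  have c4 : (abs C <= abs A / 9)%Re by rewrite /A absB //; exact: contr.
  have c5 : (e <= abs A + abs B + abs C)%Re.
    rewrite /e; have -> : l - (t - l)^-1 = A + B + C; last exact: absD3.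
    by rewrite /A /B /C -[y (phi n).+1]/((t - y (phi n))^-1); ring.
  by have := abs_ge0 absP A; lra.
exists l; split; last by rewrite {1}fixl mulVf // nz.
by rewrite fixl; have := small l l1; lra.
Qed.

Lemma kernel_vector (A : 'M[k]_2) : \det A = 0 -> exists u, u != 0 /\ mv A u = 0.
Proof.
rewrite det_mx2 => dA.
have [h1|n1] := eqVneq ((A 0 1, - A 0 0) : k * k) 0; last first.
  exists (A 0 1, - A 0 0); split=> //; rewrite /mv /=; congr pair; first by ring.
  by rewrite -[RHS]oppr0 -dA; ring.
have [h2|n2] := eqVneq ((A 1 1, - A 1 0) : k * k) 0; last first.
  exists (A 1 1, - A 1 0); split=> //; rewrite /mv /=; congr pair; last by ring.
  by rewrite -dA; ring.
have e1 : A 0 1 = 0 by have := congr1 fst h1.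
have e2 : A 1 1 = 0 by have := congr1 fst h2.
exists (0, 1); rewrite -pair_eqE /= oner_eq0 andbF; split=> //.
by rewrite /mv /= e1 e2; congr pair; ring.
Qed.

(** For determinant one, the equation on [lam] is the characteristic equation. *)
Lemma eigenvector (g : 'M[k]_2) lam : \det g = 1 -> lam * (tr2 g - lam) = 1 ->
  exists u, u != 0 /\ mv g u = (lam * u.1, lam * u.2).
Proof.
rewrite det_mx2 /tr2 => dg root.
have [|u [u0 hu]] := @kernel_vector (mk2 (g 0 0 - lam) (g 0 1) (g 1 0) (g 1 1 - lam)).
  rewrite det_mx2 !mk2E.
  have -> : (g 0 0 - lam) * (g 1 1 - lam) - g 0 1 * g 1 0 =
    (g 0 0 * g 1 1 - g 0 1 * g 1 0) - lam * (g 0 0 + g 1 1 - lam) by ring.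
  by rewrite dg root subrr.
exists u; split=> //; case: hu; rewrite !mk2E => e1 e2; rewrite /mv; congr pair.
  by rewrite -[RHS]add0r -e1; ring.
by rewrite -[RHS]add0r -e2; ring.
Qed.

Theorem nonelementary_zariski_dense (G : mset k) : is_subgroup G -> in_SL2 G ->
  unbounded abs G -> nonelementary G -> zariski_dense_SL2 G.
Proof.
move=> Ggrp GS Gu NE p pG x dx; have [G1 [GM GV]] := Ggrp.
(* A trace of absolute value above 4 is what [small_root] needs to split the characteristic
   polynomial over [k]. *)
have [g [Gg tg]] := large_trace absP nontriv lc Ggrp GS Gu NE 4%Re.
have dg1 := GS _ Gg.
have [y [ysmall yroot]] := small_root tg.
have y0 : y != 0 by apply/eqP => y0; move: yroot; rewrite y0 mul0r => /esym/eqP; rewrite oner_eq0.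
pose lam := y^-1.
have lam1 : (1 < abs lam)%Re.
  rewrite /lam absV // -Rinv_1; have := abs_gt0 absP (elimN eqP y0) => py.
  by apply: Rinv_lt_contravar; lra.
have tE : tr2 g = y + lam.
  by rewrite -[LHS](subrK y) addrC; congr (_ + _); rewrite -[LHS](mulKf y0) yroot mulr1.
have [u1 [u10 hu1]] := @eigenvector g lam dg1 ltac:(by rewrite tE addrK mulVf).
have [u2 [u20 hu2]] := eigenvector dg1 yroot.
have lamy : lam != y.
  by apply/eqP => E; rewrite E in lam1; lra.
have indep : wedge u1 u2 != 0.
  apply/eqP => E; have [c hc] := wedge0_scale u20 E.
  have : mv g u1 = (y * u1.1, y * u1.2).
    by rewrite hc mv_scale hu2 /=; congr pair; ring.
  rewrite hu1 => -[/eqP e1 /eqP e2].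
  move: u10 e1 e2; case: (u1) => a b /= ab0.
  rewrite -!(subr_eq0 (lam * _)) -!mulrBl !mulf_eq0 !subr_eq0 (negbTE lamy) /= => /eqP a0 /eqP b0.
  by rewrite a0 b0 eqxx in ab0.
pose Q := mk2 u1.1 u2.1 u1.2 u2.2.
have dQ : \det Q = wedge u1 u2 by rewrite det_mx2 !mk2E /wedge; ring.
have uQ : Q \is a GRing.unit.
  by rewrite -[_ \is a _]/(Q \in unitmx) unitmxE dQ unitfE.
pose G' : mset k := fun x => G (Q * x * Q^-1).
have conjE z : Q * (Q^-1 * z * Q) * Q^-1 = z.
  by rewrite !mulrA divrr // mul1r mulrK.
have G'M a b : G' a -> G' b -> G' (a * b).
  move=> Ga Gb; rewrite /G'.
  have -> : Q * (a * b) * Q^-1 = (Q * a * Q^-1) * (Q * b * Q^-1).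
    by rewrite !mulrA mulrVK.
  exact: GM.
have G'1 : G' 1 by rewrite /G' mulr1 divrr.
have G'lam : G' (dg lam).
  rewrite /G'; have -> : Q * dg lam = g * Q.
    move: hu1 hu2; rewrite /mv => -[a1 a2] [b1 b2].
    apply: mx2P; rewrite !mul_mx2 /dg !mk2E ?a1 ?a2 ?b1 ?b2 /lam ?invrK; ring.
  by rewrite mulrK.
have entries z : Q * z = (Q * z * Q^-1) * Q by rewrite mulrVK.
(* In the eigenbasis the entries of [z] are wedges of images of eigenvectors, up to sign and a
   common factor, so (NE) becomes nonvanishing of entries. *)
have colz z : G' z -> let w := Q * z * Q^-1 in
   [/\ wedge (mv w u1) u2 = z 0 0 * wedge u1 u2, wedge (mv w u1) u1 = - z 1 0 * wedge u1 u2,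
    wedge (mv w u2) u2 = z 0 1 * wedge u1 u2 & wedge (mv w u2) u1 = - z 1 1 * wedge u1 u2].
  move=> _ /=; set w := Q * z * Q^-1.
  have E i j : (Q * z) i j = (w * Q) i j by rewrite {1}entries.
  move: w E => w E.
  have e1 : mv w u1 = (u1.1 * z 0 0 + u2.1 * z 1 0, u1.2 * z 0 0 + u2.2 * z 1 0).
    by have := E 0 0; have := E 1 0; rewrite !mul_mx2 !mk2E /mv => -> ->.
  have e2 : mv w u2 = (u1.1 * z 0 1 + u2.1 * z 1 1, u1.2 * z 0 1 + u2.2 * z 1 1).
    by have := E 0 1; have := E 1 1; rewrite !mul_mx2 !mk2E /mv => -> ->.
  by rewrite e1 e2 /wedge /=; split; ring.
have det_conj z : G' z -> \det z = 1.
  move=> Gz; have := GS _ Gz; rewrite -!mulmxE !det_mulmx -[Q^-1]/(invmx Q) det_inv.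
  by rewrite mulrAC divrr ?mul1r // unitfE dQ.
have fromG w : G w -> G' (Q^-1 * w * Q) by rewrite /G' conjE.
have nz (a b : k) : a * b <> 0 -> a <> 0 by move=> H a0; apply: H; rewrite a0 mul0r.
have nzN (a b : k) : - a * b <> 0 -> a <> 0 by move=> H a0; apply: H; rewrite a0 oppr0 mul0r.
(* The first column of [h1] and the second column of [h2] will have no zero entry; the latter is the
   first row of [h2^-1] up to sign and order. *)
have [w1 [Gw1 [n1 n2]]] := NE u1 u2 u10 u20.
have [w2 [Gw2 [n3 n4]]] := NE u2 u1 u20 u10.
pose h1 := Q^-1 * w1 * Q; pose h2 := Q^-1 * w2 * Q.
have G'h1 : G' h1 by exact: fromG.
have G'h2 : G' h2 by exact: fromG.
have [c1 c2 _ _] := colz h1 G'h1; rewrite /h1 conjE -/h1 in c1 c2.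
have [_ _ c3 c4] := colz h2 G'h2; rewrite /h2 conjE -/h2 in c3 c4.
rewrite c1 in n2; rewrite c2 in n1; rewrite c3 in n3; rewrite c4 in n4.
move: n1 n2 n3 n4 => /nzN n1 /nz n2 /nz n3 /nzN n4.
have G'h3 : G' h2^-1.
  have -> : h2^-1 = Q^-1 * w2^-1 * Q.
    have uw2 := det1_unit (GS _ Gw2).
    by rewrite /h2 !invrM ?unitrMr ?unitrV // invrK mulrA.
  by apply: fromG; exact: GV.
have inv2 := inv_mx2 (det_conj _ G'h2).
have a2 : h2^-1 0 0 <> 0 by rewrite inv2 mk2E.
have b2 : h2^-1 0 1 <> 0 by rewrite inv2 mk2E => /eqP; rewrite oppr_eq0 => /eqP.
have pr (a b : k) : a <> 0 -> b <> 0 -> a * b <> 0.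
  by move=> /eqP a0 /eqP b0; apply/eqP; rewrite mulf_neq0.
have hE s i j : (h1 * dg s * h2^-1) i j = h1 i 0 * h2^-1 0 j * s + (h1 i 1 * h2^-1 1 j) / s.
  by rewrite !mul_mx2 /dg !mk2E; ring.
have lead i j : h1 i 0 * h2^-1 0 j <> 0 by move: i j; do 2!apply: ord2P; apply: pr.
(* Each entry is dominated by its nonzero leading term in [s], so a high power of [lam] gives an
   element without zero entries. *)
have [S hS] : exists S, forall s, (S < abs s)%Re -> forall i j, (h1 * dg s * h2^-1) i j <> 0.
  have row i : exists S, forall s, (S < abs s)%Re -> forall j, (h1 * dg s * h2^-1) i j <> 0.
    have [S1 hS1] := linear_large (h1 i 1 * h2^-1 1 0) (lead i 0) 0%Re.
    have [S2 hS2] := linear_large (h1 i 1 * h2^-1 1 1) (lead i 1) 0%Re.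
    exists (Rmax S1 S2) => s hs; have := Rmax_l S1 S2; have := Rmax_r S1 S2 => m1 m2.
    apply: ord2P => E; [have := hS1 s ltac:(lra)|have := hS2 s ltac:(lra)];
      by rewrite -hE E abs0 //; lra.
  have [S1 hS1] := row 0; have [S2 hS2] := row 1.
  exists (Rmax S1 S2) => s hs; have := Rmax_l S1 S2; have := Rmax_r S1 S2 => m1 m2.
  by apply: ord2P; [apply: hS1; lra | apply: hS2; lra].
have [n hn] := power_large lam1 S.
pose h := h1 * dg (lam ^+ n) * h2^-1.
have G'h : G' h by do !apply: (G'M) => //; exact: (dg_powers G'M G'lam G'1).
rewrite -(conjE x); apply: (vanish_SL2 lam1 G'M G'lam G'1 G'h (det_conj _ G'h) (hS _ hn)).
  by move=> z Gz; apply: pG.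
by rewrite -!mulmxE !det_mulmx -[Q^-1]/(invmx Q) det_inv dx mulr1 mulVf // dQ.
Qed.

End Density.

Theorem mainTheorem1 (k : fieldType) (abs : k -> R) (G : 'M[k]_2 -> Prop) :
  local_field abs ->
  is_subgroup G -> in_SL2 G -> countable_set G ->
  center_free G -> unbounded abs G ->
  (almost_simple_type G <-> zariski_dense_SL2 G) /\
  (zariski_dense_SL2 G <-> ~ virtually_solvable G) /\
  (~ virtually_solvable G <-> highly_transitive G).
Proof.
move=> lf Ggrp GS Gc cf Gu.
have ne4 := nonelementary_highly_transitive Ggrp GS lf Gc cf Gu.
have ne2 := nonelementary_zariski_dense lf Ggrp GS Gu.
have h41 := highly_transitive_almost_simple lf Ggrp GS Gu.
have h13 := almost_simple_not_virtually_solvable lf Ggrp GS Gu.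
have h3ne := not_virtually_solvable_nonelementary Ggrp GS.
have h2ne := @zariski_dense_nonelementary k G.
split; first by split=> [/h13/h3ne/ne2|/h2ne/ne4/h41].
split; first by split=> [/h2ne/ne4/h41/h13|/h3ne/ne2].
by split=> [/h3ne/ne4|/h41/h13].
Qed.
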